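(* Let $f\colon\mathbb{C}\to\widehat{\mathbb{C}}$ be a meromorphic function with a wandering domain $U$. Then, for any $z,w\in U$ and all $n\geq 0$, \[ e^{-2d_U(z,w)}(1-\lambda_n(w)) \leq 1-\lambda_n(z) \leq e^{2d_U(z,w)}(1-\lambda_n(w)). \] In particular, whether the series $\sum_{n=0}^{\infty}(1-\lambda_n(z))$ converges, diverges, or has a finite number of non-zero terms does not depend on the choice of $z\in U$.
   Context: The Fatou set of $f$ is the set of $z\in\mathbb{C}$ having a neighbourhood on which all iterates $f^n$ are defined and form a normal family; a Fatou component is a connected component of it. If $U$ is a Fatou component, $U_n$ denotes the Fatou component containing $f^n(U)$ (with $U_0=U$); $U$ is a wandering domain if $U_n\neq U_m$ for all $n\neq m$. $d_X$ denotes the hyperbolic distance on a hyperbolic Riemann surface $X$, normalised to have curvature $-1$, so that $d_{\mathbb{D}}(0,r)=\log\frac{1+r}{1-r}$ for $0\le r<1$ in the unit disc $\mathbb{D}$. For a holomorphic map $g\colon X\to Y$ between hyperbolic Riemann surfaces, the hyperbolic distortion at $z_0\in X$ is $\|\mathrm{D}g(z_0)\|_X^Y=\lim_{z\to z_0} d_Y(g(z),g(z_0))/d_X(z,z_0)$. For $z\in U$ and $n\ge0$, $\lambda_n(z)=\|\mathrm{D}f(f^n(z))\|_{U_n}^{U_{n+1}}$. *)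

(* Defs.v *)
From mathcomp Require Export all_boot all_order all_algebra.
From mathcomp Require Export all_classical all_reals all_analysis.
From mathcomp Require Export complex.
Export Order.TTheory GRing.Theory Num.Theory numFieldNormedType.Exports.
Set Implicit Arguments.
Unset Strict Implicit.
Unset Printing Implicit Defensive.
Local Open Scope classical_set_scope.
Local Open Scope ring_scope.

(* The regular-module alias [^o] is what carries the topology and the structure
   of normed module over R[i] on R[i]; hence [derivable _ _ 1] below is complex
   differentiability. *)
Notation CC R := (R[i]^o).

(* [None] is the point at infinity. *)
Notation Chat R := (one_point_compactification (CC R)).

Definition cmod (R : realType) (z : CC R) : R := complex.Re `|z|.

(* The value 0 at infinity is junk. *)
Definition finpart (R : realType) (f : CC R -> Chat R) (z : CC R) : CC R :=
  odflt 0 (f z).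

Definition finite_holo_at (R : realType) (f : CC R -> Chat R) (z : CC R) : Prop :=
  f z <> None /\ derivable (finpart f) z 1.

Definition meromorphic (R : realType) (f : CC R -> Chat R) : Prop :=
  forall z : CC R,
    (\forall w \near z, finite_holo_at f w) \/
    [/\ f z = None, (\forall w \near z^', finite_holo_at f w) &
        f w @[w --> z^'] --> (None : Chat R)].

(* [f^n z], or [None] if the n-th iterate takes the value infinity at [z] or is
   not defined there because an earlier iterate takes the value infinity. *)
Definition iterate (R : realType) (f : CC R -> Chat R) (n : nat) (z : CC R) :
    Chat R :=
  iter n (obind f) (Some z).

Definition iterate_defined (R : realType) (f : CC R -> Chat R) (n : nat)
    (z : CC R) : Prop :=
  forall m : nat, (m < n)%N -> iterate f m z <> None.

Definition chordal (R : realType) (p q : Chat R) : R :=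
  match p, q with
  | Some z, Some w =>
      2 * cmod (z - w) /
        (Num.sqrt (1 + cmod z ^+ 2) * Num.sqrt (1 + cmod w ^+ 2))
  | Some z, None | None, Some z => 2 / Num.sqrt (1 + cmod z ^+ 2)
  | None, None => 0
  end.

Definition normal_family (R : realType) (N : set (CC R))
    (F : set (CC R -> Chat R)) : Prop :=
  forall g : nat -> CC R -> Chat R, (forall k, F (g k)) ->
    exists (s : nat -> nat) (h : CC R -> Chat R),
      (forall j k, (j < k)%N -> (s j < s k)%N) /\
      (forall K : set (CC R), compact K -> K `<=` N ->
        forall e : R, 0 < e ->
          \forall k \near \oo, forall z, K z -> chordal (g (s k) z) (h z) < e).

Definition fatou_set (R : realType) (f : CC R -> Chat R) : set (CC R) :=
  [set z | exists N : set (CC R),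
    [/\ open N, N z, (forall n w, N w -> iterate_defined f n w) &
        normal_family N (range (iterate f))]].

Definition fatou_component (R : realType) (f : CC R -> Chat R)
    (V : set (CC R)) : Prop :=
  exists2 z, fatou_set f z & V = connected_component (fatou_set f) z.

(* The Fatou component containing [f^n(U)]; it is unique for a Fatou component
   [U], and [set0] is a default value that is then not used. *)
Definition component_of_image (R : realType) (f : CC R -> Chat R)
    (U : set (CC R)) (n : nat) : set (CC R) :=
  xget set0 [set V | fatou_component f V /\ iterate f n @` U `<=` Some @` V].

Definition wandering_domain (R : realType) (f : CC R -> Chat R)
    (U : set (CC R)) : Prop :=
  fatou_component f U /\
  forall n m : nat, n <> m ->
    component_of_image f U n <> component_of_image f U m.

Definition unit_disc (R : realType) : set (CC R) := [set a | cmod a < 1].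

(* The distance with length element 2|dz|/(1-|z|^2), of curvature -1. *)
Definition disc_dist (R : realType) (a b : CC R) : R :=
  let r := cmod ((a - b) / (1 - conjc a * b)) in ln ((1 + r) / (1 - r)).

(* [p] restricted to the unit disc is a holomorphic covering map onto [X]; it is
   a universal covering since the disc is simply connected. [W] is the set of
   sheets over the evenly covered neighbourhood [V], and [s] is the inverse of
   [p] on a sheet. *)
Definition disc_covering (R : realType) (X : set (CC R)) (p : CC R -> CC R) :
    Prop :=
  [/\ forall a, unit_disc a -> derivable p a 1,
      p @` @unit_disc R = X &
      forall x, X x -> exists (V : set (CC R)) (W : set (set (CC R))),
        [/\ open V /\ V x, V `<=` X,
            \bigcup_(A in W) A = @unit_disc R `&` p @^-1` V,
            trivIset W id &
            forall A, W A -> open A /\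
              exists s : CC R -> CC R,
                [/\ {within V, continuous s},
                    forall y, V y -> A (s y) /\ p (s y) = y &
                    forall a, A a -> V (p a) /\ s (p a) = a]]].

(* The quotient of the distance of the disc by a universal covering. The
   coverings of a hyperbolic [X] by the disc differ only by automorphisms of the
   disc, which are isometries, so each of them gives the same infimum. *)
Definition hyp_dist (R : realType) (X : set (CC R)) (z w : CC R) : R :=
  inf [set t | exists p a b, disc_covering X p /\
    [/\ unit_disc a, unit_disc b, p a = z, p b = w & t = disc_dist a b]].

Definition hyp_distortion (R : realType) (X Y : set (CC R))
    (g : CC R -> CC R) (z0 : CC R) : R :=
  lim (hyp_dist Y (g z) (g z0) / hyp_dist X z z0 @[z --> z0^']).

Definition lambda (R : realType) (f : CC R -> Chat R) (U : set (CC R))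
    (n : nat) (z : CC R) : R :=
  hyp_distortion (component_of_image f U n) (component_of_image f U n.+1)
    (finpart f) (finpart (iterate f n) z).

(* Main.v *)
(* If the maps f^n : U -> U_n and f : U_n -> U_{n+1} are lifted to self-maps of
   the disc through coverings of U, U_n and U_{n+1}, then lambda_n becomes the
   hyperbolic derivative, at h(a), of a holomorphic self-map T of the disc, where
   h is a lift of f^n. The difference quotient
   T_a(b) = ((Tb - Ta) / (1 - conj(Ta) Tb)) / ((b - a) / (1 - conj(a) b)) maps the
   disc into the closed disc, so the Schwarz-Pick lemma gives
   1 - |T_a(b)| <= e^d (1 - |T_a(c)|) for points b, c at distance d. Since
   |T_a(b)| = |T_b(a)|, passing from (a, a) to (a, b) and from there to (b, b)
   costs the factor e^{2d}, and h does not increase d.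
   Where U_n or U_{n+1} has no covering by the disc, lambda_n vanishes
   identically by the junk values of the infimum and of the division. The
   wandering domain U itself always has one: it omits an open disc, namely one in
   another Fatou component, so an inversion makes it bounded and Koebe's proof of
   the uniformization theorem for plane domains applies. The function theory this
   needs rests on Goursat's theorem for squares. *)

Require Import Defs.
From mathcomp Require Import ring lra.
Set Implicit Arguments.
Unset Strict Implicit.
Unset Printing Implicit Defensive.
Local Open Scope classical_set_scope.
Local Open Scope ring_scope.

(** * The modulus and complex differentiability *)

Section Modulus.
Variable R : realType.
Implicit Types (z w a : CC R) (e : R) (f g : CC R -> CC R).

(** The function theory avoids power series and winding numbers. Removability of a point where only
    continuity is known makes difference quotients holomorphic, so [F w = F a + (w - a) * G w] with
    [G] holomorphic; iterating this and using the maximum principle yields orders of zeros, Cauchy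
    estimates, Hurwitz's theorem and open mapping. Limits are taken along ultrafilters: bounded
    families then converge at every point at once, and the Cauchy estimates make the limit
    holomorphic; this replaces Montel's theorem. In Koebe's construction the approximating maps are
    described by their sections over all discs contained in [U]. These discs are the same for every
    map, so the sections have limits too. The infimum in [hyp_dist] is known to be attained only
    locally. That suffices to compute [hyp_distortion]; the global estimate is proved for each
    competitor and then passed to the infimum. That [f] maps U_n into U_{n+1} has to be proved as
    well: it rests on forward invariance of the Fatou set at points where [f] is not locally
    constant. *)

Lemma normCE z : `|z| = (cmod z)%:C%C.
Proof. by rewrite /cmod normc_def. Qed.

Lemma cmodE z : cmod z = Num.sqrt (complex.Re z ^+ 2 + complex.Im z ^+ 2).
Proof. by rewrite /cmod normc_def. Qed.

Lemma cmod_sqr z : cmod z ^+ 2 = complex.Re z ^+ 2 + complex.Im z ^+ 2.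
Proof. by rewrite cmodE sqr_sqrtr// addr_ge0// sqr_ge0. Qed.

Lemma cmod_ge0 z : 0 <= cmod z.
Proof. by rewrite cmodE sqrtr_ge0. Qed.

Lemma cmod_eq0 z : (cmod z == 0) = (z == 0).
Proof. by rewrite -[RHS]normr_eq0 normCE eq_complex/= eqxx andbT. Qed.

Lemma cmod_gt0 z : (0 < cmod z) = (z != 0).
Proof. by rewrite lt0r cmod_ge0 andbT cmod_eq0. Qed.

Lemma cmod0 : cmod (0 : CC R) = 0.
Proof. by apply/eqP; rewrite cmod_eq0. Qed.

Lemma cmod1 : cmod (1 : CC R) = 1.
Proof. by rewrite /cmod normr1. Qed.

Lemma cmodM z w : cmod (z * w) = cmod z * cmod w.
Proof. by apply: complexI; rewrite rmorphM/= -!normCE normrM. Qed.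

Lemma cmodX z n : cmod (z ^+ n) = cmod z ^+ n.
Proof. by elim: n => [|n ih]; rewrite ?expr0 ?cmod1// !exprS cmodM ih. Qed.

Lemma cmodV z : cmod z^-1 = (cmod z)^-1.
Proof. by apply: complexI; rewrite fmorphV/= -!normCE normfV. Qed.

Lemma cmod_div z w : cmod (z / w) = cmod z / cmod w.
Proof. by rewrite cmodM cmodV. Qed.

Lemma cmodN z : cmod (- z) = cmod z.
Proof. by rewrite /cmod normrN. Qed.

Lemma cmodBC z w : cmod (z - w) = cmod (w - z).
Proof. by rewrite -cmodN opprB. Qed.

Lemma cmodD z w : cmod (z + w) <= cmod z + cmod w.
Proof. by rewrite -lecR rmorphD/= -!normCE ler_normD. Qed.

Lemma cmodB z w : cmod (z - w) <= cmod z + cmod w.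
Proof. by rewrite -[in leRHS](cmodN w) cmodD. Qed.

Lemma cmod_triang (z u w : CC R) : cmod (z - w) <= cmod (z - u) + cmod (u - w).
Proof. by rewrite -(subrKA u z) cmodD. Qed.

Lemma cmod_subl z w : cmod z - cmod w <= cmod (z - w).
Proof. by rewrite lerBlDr -[in leLHS](subrK w z) cmodD. Qed.

Lemma cmod_real (x : R) : cmod x%:C%C = `|x|.
Proof. by rewrite cmodE/= expr0n/= addr0 sqrtr_sqr. Qed.

Lemma cmod_nat n : cmod (n%:R : CC R) = n%:R.
Proof. by have := cmod_real n%:R; rewrite rmorph_nat normr_nat. Qed.

Lemma cmodi : cmod ('i%C : CC R) = 1.
Proof. by rewrite cmodE/= expr0n/= add0r expr1n sqrtr1. Qed.

Lemma cmodJ z : cmod (conjc z) = cmod z.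
Proof. by case: z => a b; rewrite !cmodE/= sqrrN. Qed.

Lemma ler_Re_cmod z : `|complex.Re z| <= cmod z.
Proof. by rewrite cmodE -sqrtr_sqr ler_wsqrtr// lerDl sqr_ge0. Qed.

Lemma ler_Im_cmod z : `|complex.Im z| <= cmod z.
Proof. by rewrite cmodE -sqrtr_sqr ler_wsqrtr// lerDr sqr_ge0. Qed.

Lemma ler_cmod_ReIm z : cmod z <= `|complex.Re z| + `|complex.Im z|.
Proof.
rewrite -(@ler_pXn2r _ 2)// ?nnegrE ?cmod_ge0 ?addr_ge0//.
rewrite cmod_sqr sqrrD !real_normK ?num_real// -addrA addrCA addrC -addrA.
by rewrite lerD2l lerDl mulrn_wge0// mulr_ge0.
Qed.

Lemma cmod_sqrJ z : (cmod z ^+ 2)%:C%C = z * conjc z.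
Proof. by rewrite rmorphXn/= -normCE sqr_normc. Qed.

Lemma cmod_nbhsP z (A : set (CC R)) :
  nbhs z A <-> exists2 e : R, 0 < e & forall w, cmod (w - z) < e -> A w.
Proof.
split=> [/nbhs_ballP[e /= e0 eA]|[e e0 eA]].
  (* Balls of the normed module have radii in [R[i]]; a positive radius there is a real number. *)
  have ee : e = (complex.Re e)%:C%C by rewrite RRe_real// gtr0_real.
  exists (complex.Re e); first by rewrite -ltcR -ee.
  by move=> w we; apply: eA; rewrite -ball_normE/= ee normCE ltcR cmodBC.
apply/nbhs_ballP; exists e%:C%C; first by rewrite /= ltcR.
by move=> w; rewrite -ball_normE/= normCE ltcR cmodBC => /eA.
Qed.

Lemma cmod_openP (A : set (CC R)) :
  open A <-> forall z, A z -> exists2 e : R, 0 < e & forall w, cmod (w - z) < e -> A w.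
Proof.
rewrite openE; split=> AP z Az; first by have /cmod_nbhsP := AP _ Az.
by apply/cmod_nbhsP/AP.
Qed.

Lemma cmod_cvgP (T : Type) (F : set_system T) (FF : Filter F) (f : T -> CC R) z :
  f @ F --> z <-> forall e, 0 < e -> \forall t \near F, cmod (f t - z) < e.
Proof.
split=> [fz e e0|fz A /cmod_nbhsP[e e0 eA]].
  by apply: (fz [set w | cmod (w - z) < e]); apply/cmod_nbhsP; exists e.
by apply: filterS (fz _ e0) => t /eA.
Qed.

(* [ccont] and [holo] are sealed in inductive types: the notions they wrap unfold
   to quantified statements, which derails unification and implicit arguments. *)
Variant ccont (f : CC R -> CC R) z : Prop := CCont of {for z, continuous f}.

Lemma ccontE f z : ccont f z <-> {for z, continuous f}.
Proof. by split=> [[]|]. Qed.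

Lemma cmod_contP (f : CC R -> CC R) z :
  ccont f z <-> forall e, 0 < e ->
    exists2 d : R, 0 < d & forall w, cmod (w - z) < d -> cmod (f w - f z) < e.
Proof.
split=> [[/cmod_cvgP fz] e /fz /cmod_nbhsP//|fz]; split.
by apply/(@cmod_cvgP _ (nbhs z)) => e /fz ?; apply/cmod_nbhsP.
Qed.

(** Differentiability without a quotient, so that [w = z] needs no exception. *)
Definition has_cderiv (f : CC R -> CC R) z (l : CC R) := forall e, 0 < e ->
  exists2 d : R, 0 < d & forall w, cmod (w - z) < d ->
    cmod (f w - f z - l * (w - z)) <= e * cmod (w - z).

Lemma has_cderivP (f : CC R -> CC R) z (l : CC R) :
  has_cderiv f z l <-> is_derive z 1 f l.
Proof.
pose g (h : CC R) : CC R := h^-1 *: ((f \o shift z) (h *: (1 : CC R)) - f z).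
have gE w : w != z -> g (w - z) = (f w - f z) / (w - z).
  by move=> wz; rewrite /g /= /shift/= !/(_ *: _)/= mulr1 subrK mulrC.
split=> [fl|[fd fl] e e0].
  have gl : g @ (0 : CC R)^' --> (l : CC R).
    apply/cmod_cvgP => e e0.
    have [d d0 dP] := fl (e / 2) ltac:(by rewrite divr_gt0).
    apply/cmod_nbhsP; exists d => // h; rewrite subr0 => hd h0.
    have hz : h + z != z by rewrite -subr_eq0 addrK.
    have := gE _ hz; rewrite addrK => ->.
    rewrite -(@ltr_pM2l _ (cmod h)) ?cmod_gt0// -cmodM mulrBr mulrC divfK//.
    have := dP (h + z); rewrite addrK => /(_ hd).
    rewrite [h * l]mulrC => /le_lt_trans; apply.
    by rewrite [ltRHS]mulrC ltr_pM2r ?cmod_gt0//; lra.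
  by apply: DeriveDef; [apply/cvg_ex; exists l|apply/cvg_lim].
have {fd} : g @ (0 : CC R)^' --> (l : CC R) by rewrite -fl.
move=> /cmod_cvgP/(_ _ e0)/cmod_nbhsP[d d0 dP]; exists d => // w wd.
have [->|wz] := eqVneq w z; first by rewrite !subrr mulr0 subrr cmod0 mulr0.
have := dP (w - z); rewrite subr0 subr_eq0 => /(_ wd wz).
rewrite gE// => /ltW.
have wz0 : w - z != 0 by rewrite subr_eq0.
rewrite -(@ler_pM2r _ (cmod (w - z))) ?cmod_gt0// -cmodM.
by rewrite mulrBl divfK.
Qed.

Variant holo (f : CC R -> CC R) z : Prop := Holo of derivable f z 1.

Lemma holoE f z : holo f z <-> derivable f z 1.
Proof. by split=> [[]|]. Qed.

Lemma holoP (f : CC R -> CC R) z :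
  holo f z <-> exists l, has_cderiv f z l.
Proof.
split=> [[/derivableP fz]|[l /has_cderivP[fl _]]]; last exact: Holo.
by eexists; apply/has_cderivP; exact: fz.
Qed.

Lemma holo_cont (f : CC R -> CC R) z :
  holo f z -> ccont f z.
Proof. by move=> [/derivable1_diffP/differentiable_continuous fz]; split. Qed.

Lemma near_eq_holo (f g : CC R -> CC R) z :
  (\forall w \near z, f w = g w) -> holo f z -> holo g z.
Proof.
move=> /[dup]/nbhs_singleton fgz /cmod_nbhsP[d d0 dP] /holoP[l fl].
apply/holoP; exists l => e /fl[d' d'0 d'P].
exists (Num.min d d'); first by rewrite lt_min d0.
by move=> w; rewrite lt_min => /andP[? ?]; rewrite -fgz -dP//; exact: d'P.
Qed.

Lemma near_eq_ccont (f g : CC R -> CC R) z :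
  (\forall w \near z, f w = g w) -> ccont f z -> ccont g z.
Proof.
move=> /[dup]/nbhs_singleton fgz /cmod_nbhsP[d d0 dP] /cmod_contP fz.
apply/cmod_contP => e /fz[d' d'0 d'P].
exists (Num.min d d'); first by rewrite lt_min d0.
by move=> w; rewrite lt_min => /andP[? ?]; rewrite -fgz -dP//; exact: d'P.
Qed.

Lemma holo_cst (a z : CC R) : holo (fun=> a) z.
Proof. by split; exact: derivable_cst. Qed.

Lemma holo_id z : holo (fun x => x) z.
Proof. by split; exact: derivable_id. Qed.

Lemma holoD (f g : CC R -> CC R) z :
  holo f z -> holo g z -> holo (fun w => f w + g w) z.
Proof. by move=> [fz] [gz]; split; exact: (derivableD fz gz). Qed.

Lemma holoB (f g : CC R -> CC R) z :
  holo f z -> holo g z -> holo (fun w => f w - g w) z.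
Proof. by move=> [fz] [gz]; split; exact: (derivableB fz gz). Qed.

Lemma holoM (f g : CC R -> CC R) z :
  holo f z -> holo g z -> holo (fun w => f w * g w) z.
Proof. by move=> [fz] [gz]; split; exact: (derivableM fz gz). Qed.

Lemma holoV (f : CC R -> CC R) z : f z != 0 ->
  holo f z -> holo (fun w => (f w)^-1) z.
Proof. by move=> f0 [fz]; split; exact: (derivableV f0 fz). Qed.

Lemma holo_div (f g : CC R -> CC R) z : g z != 0 ->
  holo f z -> holo g z -> holo (fun w => f w / g w) z.
Proof. move=> g0 fz gz; exact: holoM fz (holoV g0 gz). Qed.

Lemma holoX (f : CC R -> CC R) n z :
  holo f z -> holo (fun w => f w ^+ n) z.
Proof.
move=> fz; elim: n => [|n ih]; first exact: holo_cst.
rewrite (_ : (fun w => _) = (fun w => f w * f w ^+ n)); first exact: holoM.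
by apply/funext => w; rewrite exprS.
Qed.

Lemma holo_comp (f g : CC R -> CC R) z :
  holo f z -> holo g (f z) -> holo (fun w => g (f w)) z.
Proof.
move=> [/derivable1_diffP fz] [/derivable1_diffP gz]; split.
exact/derivable1_diffP/(differentiable_comp fz gz).
Qed.

Lemma ccont_cst a z : ccont (fun=> a) z.
Proof. exact: holo_cont (holo_cst a z). Qed.

Lemma ccont_id z : ccont (fun x => x) z.
Proof. exact: holo_cont (holo_id z). Qed.

Lemma ccontD f g z : ccont f z -> ccont g z -> ccont (fun w => f w + g w) z.
Proof. by move=> [fz] [gz]; split; exact: (continuousD fz gz). Qed.

Lemma ccontB f g z : ccont f z -> ccont g z -> ccont (fun w => f w - g w) z.
Proof. by move=> [fz] [gz]; split; exact: (continuousB fz gz). Qed.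

Lemma ccontM f g z : ccont f z -> ccont g z -> ccont (fun w => f w * g w) z.
Proof. by move=> [fz] [gz]; split; exact: (continuousM fz gz). Qed.

Lemma ccont_comp f g z : ccont f z -> ccont g (f z) -> ccont (fun w => g (f w)) z.
Proof. by move=> [fz] [gz]; split; exact: (continuous_comp fz gz). Qed.

Lemma ccontV f z : f z != 0 -> ccont f z -> ccont (fun w => (f w)^-1) z.
Proof.
move=> f0 fz.
exact: (@ccont_comp f GRing.inv z fz (holo_cont (holoV f0 (holo_id (f z))))).
Qed.

Lemma ccont_div f g z : g z != 0 -> ccont f z -> ccont g z -> ccont (fun w => f w / g w) z.
Proof. move=> g0 fz gz; exact: ccontM fz (ccontV g0 gz). Qed.

Lemma ccontX f n z : ccont f z -> ccont (fun w => f w ^+ n) z.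
Proof.
move=> fz; elim: n => [|n ih]; first exact: ccont_cst.
rewrite (_ : (fun w => _) = (fun w => f w * f w ^+ n)); first exact: ccontM.
by apply/funext => w; rewrite exprS.
Qed.

Lemma ler_dist_cmod z w : `|cmod z - cmod w| <= cmod (z - w).
Proof. by rewrite ler_norml cmod_subl lerNl opprB cmodBC cmod_subl. Qed.

End Modulus.

(** * Connectedness, convexity and bisection of squares in the plane *)

Section PlaneTopology.
Variable R : realType.
Implicit Types (z w a : CC R) (x y L e r : R).

(** Continuation along a connected set: the last two conditions say that [P] is open and closed
    relative to [X]. *)
Lemma connected_clopen_ind (X P : set (CC R)) a : connected X -> X a -> P a ->
  (forall z, X z -> P z ->
     exists2 e : R, 0 < e & forall w, X w -> cmod (w - z) < e -> P w) ->
  (forall z, X z ->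
     (forall e : R, 0 < e -> exists w, [/\ X w, cmod (w - z) < e & P w]) -> P z) ->
  forall z, X z -> P z.
Proof.
move=> cX Xa Pa Po Pc.
suff <- : X `&` P = X by move=> z [].
apply: cX.
- by exists a.
- exists (interior (P `|` ~` X)); first exact: open_interior.
  apply/seteqP; split=> z; last first.
    by move=> [Xz /nbhs_singleton[]].
  move=> [Xz Pz]; split=> //; apply/cmod_nbhsP.
  have [e e0 eP] := Po _ Xz Pz; exists e => // w we.
  by have [Xw|] := pselect (X w); [left; exact: eP|right].
- exists (closure (X `&` P)); first exact: closed_closure.
  apply/seteqP; split=> z; first by move=> XPz; split; [case: XPz|exact: subset_closure].
  move=> [Xz clz]; split=> //; apply: Pc => // e e0.
  have : nbhs z [set w | cmod (w - z) < e] by apply/cmod_nbhsP; exists e.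
  by move=> /clz[w [[Xw Pw] we]]; exists w.
Qed.

Lemma Complex_continuous : continuous (fun p : R * R => Complex p.1 p.2 : CC R).
Proof.
move=> [x y]; apply/(@cmod_cvgP _ _ (nbhs _)) => e e0.
exists ([set u | `|x - u| < e / 2], [set u | `|y - u| < e / 2]) => /=.
  by split; apply/nbhs_ballP; exists (e / 2) => //=; rewrite divr_gt0.
move=> [u v] /= [xu yv]; apply: le_lt_trans (ler_cmod_ReIm _) _ => /=.
by rewrite (distrC u) (distrC v); lra.
Qed.

Definition csquare x y L : set (CC R) :=
  [set w | x <= complex.Re w <= x + L /\ y <= complex.Im w <= y + L].

Lemma csquare_compact x y L : compact (csquare x y L).
Proof.
have -> : csquare x y L =
    (fun p : R * R => Complex p.1 p.2 : CC R) @`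
      (`[x, x + L] `*` `[y, y + L]).
  apply/seteqP; split=> [[u v] /= [xu yv]|w /= [[u v] /= []]].
    by exists (u, v) => //=; rewrite !in_itv.
  by rewrite !in_itv/= => xu yv <-.
apply: continuous_compact.
  by apply: continuous_subspaceT; exact: Complex_continuous.
by apply: compact_setX; exact: segment_compact.
Qed.

Lemma cmod_le_closed a r : closed [set w : CC R | cmod (w - a) <= r].
Proof.
rewrite -[X in closed X]setCK; apply: open_closedC; apply/cmod_openP => w /= /negP.
rewrite -ltNge => rw; exists (cmod (w - a) - r); first by rewrite subr_gt0.
move=> u uw; apply/negP; rewrite -ltNge.
by have := cmod_triang w u a; rewrite (cmodBC w u); lra.
Qed.

Lemma closed_disc_compact a r : compact [set w : CC R | cmod (w - a) <= r].
Proof.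
apply: (subclosed_compact _
  (@csquare_compact (complex.Re a - r) (complex.Im a - r) (r + r))).
  exact: cmod_le_closed.
move=> w /= wr; have := le_trans (ler_Re_cmod _) wr.
have := le_trans (ler_Im_cmod _) wr.
by case: w a {wr} => [u v] [b c] /=; rewrite !ler_norml => h1 h2; split=> /=; lra.
Qed.

Lemma cdisc_open a r : open [set w : CC R | cmod (w - a) < r].
Proof.
apply/cmod_openP => w /= wr; exists (r - cmod (w - a)); first by rewrite subr_gt0.
by move=> u uw; have := cmod_triang u w a; lra.
Qed.

Definition cconvex (K : set (CC R)) := forall a b (t : R),
  K a -> K b -> 0 <= t <= 1 -> K (a + t%:C%C * (b - a)).

Lemma cconvex_connected K : cconvex K -> connected K.
Proof.
move=> cK; have [->|/set0P[a Ka]] := eqVneq K set0; first exact: connected0.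
pose seg b : set (CC R) := (fun t : R => a + t%:C%C * (b - a)) @` `[0, 1].
have -> : K = \bigcup_(b in K) seg b.
  apply/seteqP; split=> [b Kb|w [b Kb [t]]].
    exists b => //; exists 1; first by rewrite /= in_itv/= ler01 lexx.
    by rewrite mul1r addrC subrK.
  by rewrite /= in_itv/= => t01 <-; exact: cK.
apply: bigcup_connected.
  exists a => b Kb; exists 0; first by rewrite /= in_itv/= ler01 lexx.
  by rewrite mul0r addr0.
move=> b Kb; apply: connected_continuous_connected; first exact: segment_connected.
apply: continuous_subspaceT => t; apply/(@cmod_cvgP _ _ (nbhs t)) => e e0.
have c0 : 0 < cmod (b - a) + 1 by rewrite ltr_wpDl ?cmod_ge0.
apply/nbhs_ballP; exists (e / (cmod (b - a) + 1)); first by rewrite /= divr_gt0.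
move=> s; rewrite /ball/= distrC => ts.
have -> : a + s%:C%C * (b - a) - (a + t%:C%C * (b - a)) = (s - t)%:C%C * (b - a).
  by rewrite rmorphB/=; ring.
rewrite cmodM cmod_real; move: ts; rewrite ltr_pdivlMr//.
by have := cmod_ge0 (b - a); have := normr_ge0 (s - t); nra.
Qed.

Lemma cconvexI (K L : set (CC R)) : cconvex K -> cconvex L -> cconvex (K `&` L).
Proof. by move=> cK cL a b t [? ?] [? ?] t01; split; [exact: cK|exact: cL]. Qed.

Lemma cmod_convex a b c (t : R) : 0 <= t <= 1 ->
  cmod (a + t%:C%C * (b - a) - c) <= (1 - t) * cmod (a - c) + t * cmod (b - c).
Proof.
move=> /andP[t0 t1].
have -> : a + t%:C%C * (b - a) - c = (1 - t)%:C%C * (a - c) + t%:C%C * (b - c).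
  by rewrite rmorphB rmorph1/=; ring.
apply: le_trans (cmodD _ _) _; rewrite !cmodM !cmod_real !ger0_norm//; lra.
Qed.

Lemma cconvex_disc c r : cconvex [set w | cmod (w - c) < r].
Proof.
move=> a b t /= ar br t01; apply: le_lt_trans (cmod_convex _ _ _ t01) _.
apply: (@le_lt_trans _ _ (Num.max (cmod (a - c)) (cmod (b - c)))); last first.
  by rewrite gt_max ar br.
have : cmod (a - c) <= Num.max (cmod (a - c)) (cmod (b - c)) by rewrite le_max lexx.
have : cmod (b - c) <= Num.max (cmod (a - c)) (cmod (b - c)) by rewrite le_max lexx orbT.
by case/andP: t01; nra.
Qed.

Lemma cconvex_closed_disc c r : cconvex [set w | cmod (w - c) <= r].
Proof.
move=> a b t /= ar br t01; apply: le_trans (cmod_convex _ _ _ t01) _.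
by case/andP: t01; nra.
Qed.

(** If [P] failed on the large square, it would fail on one quarter, then on a quarter of that, and
    so on; at the common point of these nested squares the local hypothesis gives a contradiction.
    Both Goursat's theorem and the lifting of maps over squares are instances. *)
Lemma csquare_bisection (P : R -> R -> R -> Prop) x0 y0 L0 : 0 < L0 ->
  (forall x y L, 0 < L -> csquare x y L `<=` csquare x0 y0 L0 ->
     P x y (L / 2) -> P (x + L / 2) y (L / 2) ->
     P x (y + L / 2) (L / 2) -> P (x + L / 2) (y + L / 2) (L / 2) -> P x y L) ->
  (forall z, csquare x0 y0 L0 z -> exists2 d : R, 0 < d &
     forall x y L, 0 < L < d -> csquare x y L z ->
       csquare x y L `<=` csquare x0 y0 L0 -> P x y L) ->
  P x0 y0 L0.
Proof.
move=> L00 Padd Ploc; apply: contrapT => nP0.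
pose bad (q : R * R * R) := [/\ 0 < q.2, csquare q.1.1 q.1.2 q.2 `<=` csquare x0 y0 L0
  & ~ P q.1.1 q.1.2 q.2].
(* The conclusion is conditional on [bad q] so that a total successor function can be chosen. *)
have next (q : R * R * R) : exists q' : R * R * R, bad q ->
    [/\ bad q', q'.2 = q.2 / 2,
      q.1.1 <= q'.1.1 <= q.1.1 + q.2 / 2 & q.1.2 <= q'.1.2 <= q.1.2 + q.2 / 2].
  have [bq|] := pselect (bad q); last by move=> nb; exists q => /nb.
  case: q bq => [[x y] L] [/= Lp sub nP].
  have [q' [nq' q2 qx qy]] : exists q' : R * R * R,
      [/\ ~ P q'.1.1 q'.1.2 q'.2, q'.2 = L / 2,
        x <= q'.1.1 <= x + L / 2 & y <= q'.1.2 <= y + L / 2].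
    apply: contrapT => /forallNP no; apply: nP; apply: Padd => //.
    - by apply: contrapT => n; apply: (no (x, y, L / 2)); split=> //=; lra.
    - by apply: contrapT => n; apply: (no (x + L / 2, y, L / 2)); split=> //=; lra.
    - by apply: contrapT => n; apply: (no (x, y + L / 2, L / 2)); split=> //=; lra.
    - by apply: contrapT => n; apply: (no (x + L / 2, y + L / 2, L / 2));
        split=> //=; lra.
  exists q' => _; split=> //; split=> //; first by rewrite q2; lra.
  move=> w [wx wy]; apply: sub; rewrite q2 in wx wy; split; lra.
have [nx nxP] := choice next.
pose q n := iter n nx (x0, y0, L0).
have bad0 : bad (q 0%N) by split=> /=.
have badq n : bad (q n) by elim: n => [//|n /nxP[]].
have qL n : (q n).2 = L0 / 2 ^+ n.
  elim: n => [|n ih]; first by rewrite expr0 divr1.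
  by have [_ -> _ _] := nxP _ (badq n); rewrite ih exprS invfM mulrCA mulrC.
(* To be used with [f] the abscissa and the ordinate of the lower left corner: the supremum along
   the nested squares is a coordinate of a point common to all of them. *)
have mono (f : R * R * R -> R) : (forall n, f (q n) <= f (q n.+1) <= f (q n) + (q n).2 / 2) ->
    exists s, forall n, f (q n) <= s <= f (q n) + (q n).2.
  move=> fq.
  have up n k : f (q n) <= f (q (k + n)%N) <= f (q n) + (q n).2 - (q (k + n)%N).2.
    elim: k => [|k ih]; first by rewrite add0n; lra.
    have [_ qE _ _] := nxP _ (badq (k + n)%N).
    have := fq (k + n)%N; rewrite -/(q (k + n).+1) in qE *; rewrite addSn qE; lra.
  have all n m : f (q n) <= f (q m) + (q m).2.
    have L0m k : 0 < (q k).2 by case: (badq k).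
    case: (leqP n m) => [nm|/ltnW mn].
      by have := up n (m - n)%N; rewrite subnK//; have := L0m m; lra.
    by have := up m (n - m)%N; rewrite subnK//; have := L0m n; lra.
  exists (sup (range (fun n => f (q n)))) => n; apply/andP; split.
    apply: ub_le_sup; last by exists n.
    by exists (f (q 0%N) + (q 0%N).2) => _ [m _ <-].
  by apply: ge_sup; [exists (f (q 0%N)), 0%N|move=> _ [m _ <-]].
have [sx sxP] := mono (fun q => q.1.1) (fun n => let: And4 _ _ h _ := nxP _ (badq n) in h).
have [sy syP] := mono (fun q => q.1.2) (fun n => let: And4 _ _ _ h := nxP _ (badq n) in h).
pose z : CC R := Complex sx sy.
have [d d0 dP] := Ploc z ltac:(by split=> /=; [exact: (sxP 0%N)|exact: (syP 0%N)]).
have [n nd] : exists n, L0 / 2 ^+ n < d.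
  have := @cvg_geometric _ L0 (2^-1 : R) ltac:(by rewrite ger0_norm; lra).
  move=> /cvgr_lt/(_ d d0)[n _ /(_ n (leqnn n))] /=.
  by rewrite exprVn => ?; exists n.
have [Ln sn] := badq n; apply; apply: dP => //; first by rewrite Ln qL.
Qed.

End PlaneTopology.

(** * Integration over squares and removable singularities *)

Section SquareIntegral.
Variable R : realType.
Implicit Types (z w : CC R) (x y L M s t : R) (g h : R -> CC R) (G H : CC R -> CC R).

Local Notation mu := (@lebesgue_measure R).

Definition Cint g (a b : R) : CC R :=
  Complex (\int[mu]_(t in `[a, b]) complex.Re (g t))
          (\int[mu]_(t in `[a, b]) complex.Im (g t)).

Definition cont_itv g (a b : R) := forall t, a <= t <= b -> {for t, continuous g}.

Lemma real_cvgP (f : R -> R) t : {for t, continuous f} <->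
  forall e, 0 < e -> \forall s \near t, `|f s - f t| < e.
Proof.
split=> [/cvgrPdist_lt ft e /ft|ft]; first by apply: filterS => s; rewrite distrC.
by apply/cvgrPdist_lt => e /ft; apply: filterS => s; rewrite distrC.
Qed.

Lemma Re_continuous g t : {for t, continuous g} ->
  {for t, continuous (fun s => complex.Re (g s))}.
Proof.
move=> /(@cmod_cvgP _ _ (nbhs t)) gt; apply/real_cvgP => e /gt.
by apply: filterS => s; apply: le_lt_trans; rewrite (le_trans _ (ler_Re_cmod _))//; case: (g s) (g t) => ? ? [].
Qed.

Lemma Im_continuous g t : {for t, continuous g} ->
  {for t, continuous (fun s => complex.Im (g s))}.
Proof.
move=> /(@cmod_cvgP _ _ (nbhs t)) gt; apply/real_cvgP => e /gt.
by apply: filterS => s; apply: le_lt_trans; rewrite (le_trans _ (ler_Im_cmod _))//; case: (g s) (g t) => ? ? [].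
Qed.

Lemma cont_integrable (f : R -> R) a b :
  (forall t, a <= t <= b -> {for t, continuous f}) ->
  mu.-integrable `[a, b] (EFin \o f).
Proof.
move=> cf; apply: continuous_compact_integrable; first exact: segment_compact.
by apply: continuous_in_subspaceT => t; rewrite inE/= in_itv/=; exact: cf.
Qed.

Lemma Re_integrable g a b : cont_itv g a b ->
  mu.-integrable `[a, b] (EFin \o (fun t => complex.Re (g t))).
Proof. by move=> cg; apply: cont_integrable => t /cg; exact: Re_continuous. Qed.

Lemma Im_integrable g a b : cont_itv g a b ->
  mu.-integrable `[a, b] (EFin \o (fun t => complex.Im (g t))).
Proof. by move=> cg; apply: cont_integrable => t /cg; exact: Im_continuous. Qed.

Lemma eq_Cint g h a b : (forall t, a <= t <= b -> g t = h t) ->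
  Cint g a b = Cint h a b.
Proof.
by move=> gh; congr Complex; apply: eq_Rintegral => t;
  rewrite inE/= in_itv/= => /gh ->.
Qed.

Lemma CintD g h a b : cont_itv g a b -> cont_itv h a b ->
  Cint (fun t => g t + h t) a b = Cint g a b + Cint h a b.
Proof.
move=> cg ch; rewrite /Cint; congr Complex.
  rewrite -RintegralD//; [|exact: Re_integrable..].
  by apply: eq_Rintegral => t _; case: (g t) (h t) => ? ? [].
rewrite -RintegralD//; [|exact: Im_integrable..].
by apply: eq_Rintegral => t _; case: (g t) (h t) => ? ? [].
Qed.

Lemma CintZ (c : CC R) g a b : cont_itv g a b ->
  Cint (fun t => c * g t) a b = c * Cint g a b.
Proof.
move=> cg; case: c => u v; rewrite /Cint; congr Complex.
  rewrite -!RintegralZl//; do ?[exact: Re_integrable|exact: Im_integrable].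
  rewrite -RintegralB//.
  - by apply: eq_Rintegral => t _; case: (g t).
  - apply: cont_integrable => t /cg /Re_continuous ct.
    by apply: continuousM => //; exact: cvg_cst.
  - apply: cont_integrable => t /cg /Im_continuous ct.
    by apply: continuousM => //; exact: cvg_cst.
rewrite -!RintegralZl//; do ?[exact: Re_integrable|exact: Im_integrable].
rewrite -RintegralD//.
- by apply: eq_Rintegral => t _; case: (g t).
- apply: cont_integrable => t /cg /Im_continuous ct.
  by apply: continuousM => //; exact: cvg_cst.
- apply: cont_integrable => t /cg /Re_continuous ct.
  by apply: continuousM => //; exact: cvg_cst.
Qed.

Lemma Rint_cst (c a b : R) : a <= b -> \int[mu]_(t in `[a, b]) c = c * (b - a).
Proof.
move=> ab; rewrite Rintegral_cst//; have e := lebesgue_measure_itv `[a, b].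
rewrite /= lte_fin in e; rewrite [X in fine X]e.
by case: ltP => [//|ba]; rewrite (le_anti (introT andP (conj ab ba))) subrr.
Qed.

Lemma Cint_cst (c : CC R) a b : a <= b -> Cint (fun=> c) a b = (b - a)%:C%C * c.
Proof.
move=> ab; rewrite /Cint !Rint_cst//; case: c => u v /=.
by apply/eqP; rewrite eq_complex/=; apply/andP; split; apply/eqP; ring.
Qed.

Lemma Cint_split g a m b : a <= m <= b -> cont_itv g a b ->
  Cint g a b = Cint g a m + Cint g m b.
Proof.
move=> /andP[am mb] cg.
have key (f : R -> R) : (forall t, a <= t <= b -> {for t, continuous f}) ->
    \int[mu]_(t in `[a, b]) f t = \int[mu]_(t in `[a, m]) f t + \int[mu]_(t in `[m, b]) f t.
  move=> cf.
  rewrite -(Rintegral_itv_obnd_cbnd (r := m)); last first.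
    apply: (integrableS _ _ _ (cont_integrable cf)) => //.
    by move=> t /=; rewrite !in_itv/= => /andP[/ltW mt ->]; rewrite (le_trans am mt).
  have := @Rintegral_itvB R f (BLeft a) (BRight b) m (cont_integrable cf).
  rewrite !bnd_simp => /(_ am mb) <-.
  by rewrite addrC subrK.
rewrite /Cint (key (fun t => complex.Re (g t))); last by move=> t /cg /Re_continuous.
by rewrite (key (fun t => complex.Im (g t)))//; move=> t /cg /Im_continuous.
Qed.

(** The factor 2 comes from estimating real and imaginary parts separately. *)
Lemma Cint_bound g a b M : a <= b -> cont_itv g a b ->
  (forall t, a <= t <= b -> cmod (g t) <= M) -> cmod (Cint g a b) <= 2 * M * (b - a).
Proof.
move=> ab cg gM.
have key (f : R -> R) : (forall t, a <= t <= b -> {for t, continuous f}) ->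
    (forall t, a <= t <= b -> `|f t| <= M) ->
    `|\int[mu]_(t in `[a, b]) f t| <= M * (b - a).
  move=> cf fM; apply: (le_trans (le_normr_Rintegral _ _)) => //.
    exact: cont_integrable.
  rewrite -Rint_cst//; apply: le_Rintegral => //.
  - apply: cont_integrable => t /cf ct.
    exact: continuous_comp ct (@norm_continuous _ _ _).
  - by apply: cont_integrable => t _; exact: cvg_cst.
apply: le_trans (ler_cmod_ReIm _) _ => /=.
have := key (fun t => complex.Re (g t)) (fun t ht => Re_continuous (cg t ht))
  (fun t ht => le_trans (ler_Re_cmod _) (gM t ht)).
have := key (fun t => complex.Im (g t)) (fun t ht => Im_continuous (cg t ht))
  (fun t ht => le_trans (ler_Im_cmod _) (gM t ht)).
lra.
Qed.

Lemma continuousBf g h t : {for t, continuous g} -> {for t, continuous h} ->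
  {for t, continuous (fun s => g s - h s)}.
Proof.
move=> /(@cmod_cvgP _ _ (nbhs t)) cg /(@cmod_cvgP _ _ (nbhs t)) ch.
apply/(@cmod_cvgP _ _ (nbhs t)) => e e0.
have e20 : 0 < e / 2 by rewrite divr_gt0.
apply: filterS2 (cg _ e20) (ch _ e20) => s gs hs.
rewrite opprD addrACA -opprD.
by apply: le_lt_trans (cmodB _ _) _; lra.
Qed.

Lemma continuousNf g t : {for t, continuous g} ->
  {for t, continuous (fun s => - g s)}.
Proof.
move=> /(@cmod_cvgP _ _ (nbhs t)) cg.
apply/(@cmod_cvgP _ _ (nbhs t)) => e e0.
by apply: filterS (cg _ e0) => s gs; rewrite -opprD cmodN.
Qed.

Lemma CintB g h a b : cont_itv g a b -> cont_itv h a b ->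
  Cint (fun s => g s - h s) a b = Cint g a b - Cint h a b.
Proof.
move=> cg ch; have cN : cont_itv (fun s => - h s) a b.
  by move=> t ht; apply: continuousNf; exact: ch.
rewrite (CintD cg cN); congr (_ + _); rewrite -mulN1r -(CintZ _ ch).
by apply: eq_Cint => t _; rewrite mulN1r.
Qed.

Definition cont_sq G x y L := forall z, csquare x y L z -> ccont G z.

Definition on_boundary x y L w := csquare x y L w /\
  [\/ complex.Re w = x, complex.Re w = x + L, complex.Im w = y | complex.Im w = y + L].

(** The Cauchy kernel is singular inside the square, so continuity is asked for at boundary points
    only. *)
Definition cont_bd G x y L := forall z, on_boundary x y L z -> ccont G z.

Lemma cont_sq_bd G x y L : cont_sq G x y L -> cont_bd G x y L.
Proof. by move=> cG z [/cG]. Qed.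

(* The line integral of [G dz] along the boundary of a square, counterclockwise. *)
Definition sqint G x y L : CC R :=
  Cint (fun s => G (Complex s y) - G (Complex s (y + L))) x (x + L) +
  'i%C * Cint (fun s => G (Complex (x + L) s) - G (Complex x s)) y (y + L).

Lemma horizontal_cont G y s : ccont G (Complex s y) ->
  {for s, continuous (fun t => G (Complex t y))}.
Proof.
move=> /cmod_contP cG; apply/(@cmod_cvgP _ _ (nbhs s)) => e /cG[d d0 dP].
apply/nbhs_ballP; exists d => //= t; rewrite /ball/= distrC => st; apply: dP.
by rewrite /= cmodE/= subrr expr0n/= addr0 sqrtr_sqr.
Qed.

Lemma vertical_cont G x s : ccont G (Complex x s) ->
  {for s, continuous (fun t => G (Complex x t))}.
Proof.
move=> /cmod_contP cG; apply/(@cmod_cvgP _ _ (nbhs s)) => e /cG[d d0 dP].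
apply/nbhs_ballP; exists d => //= t; rewrite /ball/= distrC => st; apply: dP.
by rewrite /= cmodE/= subrr expr0n/= add0r sqrtr_sqr.
Qed.

Lemma bd_horizontal G x y L : 0 <= L -> cont_bd G x y L ->
  cont_itv (fun s => G (Complex s y) - G (Complex s (y + L))) x (x + L).
Proof.
move=> L0 cG t xt; apply: continuousBf; apply: horizontal_cont; apply: cG.
  by split; [split=> /=; lra|apply: Or43].
by split; [split=> /=; lra|apply: Or44].
Qed.

Lemma bd_vertical G x y L : 0 <= L -> cont_bd G x y L ->
  cont_itv (fun s => G (Complex (x + L) s) - G (Complex x s)) y (y + L).
Proof.
move=> L0 cG t xt; apply: continuousBf; apply: vertical_cont; apply: cG.
  by split; [split=> /=; lra|apply: Or42].
by split; [split=> /=; lra|apply: Or41].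
Qed.

Lemma eq_sqint G H x y L : 0 <= L -> (forall z, on_boundary x y L z -> G z = H z) ->
  sqint G x y L = sqint H x y L.
Proof.
move=> L0 GH; rewrite /sqint; congr (_ + _ * _); apply: eq_Cint => t xt; congr (_ - _);
 apply: GH.
- by split; [split=> /=; lra|apply: Or43].
- by split; [split=> /=; lra|apply: Or44].
- by split; [split=> /=; lra|apply: Or42].
- by split; [split=> /=; lra|apply: Or41].
Qed.

Lemma sqintD G H x y L : 0 <= L -> cont_bd G x y L -> cont_bd H x y L ->
  sqint (fun z => G z + H z) x y L = sqint G x y L + sqint H x y L.
Proof.
move=> L0 cG cH; rewrite /sqint.
under eq_Cint do rewrite opprD addrACA.
rewrite (CintD (bd_horizontal L0 cG) (bd_horizontal L0 cH)).
under [X in _ + _ * X]eq_Cint do rewrite opprD addrACA.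
rewrite (CintD (bd_vertical L0 cG) (bd_vertical L0 cH)).
by rewrite mulrDr addrACA.
Qed.

Lemma sqintZ (c : CC R) G x y L : 0 <= L -> cont_bd G x y L ->
  sqint (fun z => c * G z) x y L = c * sqint G x y L.
Proof.
move=> L0 cG; rewrite /sqint.
under eq_Cint do rewrite -mulrBr.
rewrite (CintZ _ (bd_horizontal L0 cG)).
under [X in _ + _ * X]eq_Cint do rewrite -mulrBr.
rewrite (CintZ _ (bd_vertical L0 cG)).
by rewrite mulrDr mulrCA.
Qed.

(** Between opposite sides the integrand differs by a constant, [- d * i L] for the horizontal pair
    and [d * L] for the vertical one, and the two contributions cancel. *)
Lemma sqint_affine (c d : CC R) x y L : 0 <= L ->
  sqint (fun z => c + d * z) x y L = 0.
Proof.
move=> L0; rewrite /sqint.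
rewrite (@eq_Cint _ (fun=> d * - Complex 0 L)); last first.
  move=> t _; rewrite opprD addrACA subrr add0r -mulrBr; congr (_ * _).
  by apply/eqP; rewrite eq_complex/=; apply/andP; split; apply/eqP; ring.
rewrite Cint_cst; last by lra.
rewrite (@eq_Cint _ (fun=> d * L%:C%C)); last first.
  move=> t _; rewrite opprD addrACA subrr add0r -mulrBr; congr (_ * _).
  by apply/eqP; rewrite eq_complex/=; apply/andP; split; apply/eqP; ring.
rewrite Cint_cst; last by lra.
have -> : Complex 0 L = 'i%C * L%:C%C :> CC R.
  by apply/eqP; rewrite eq_complex/=; apply/andP; split; apply/eqP; ring.
rewrite (_ : x + L - x = L); last by ring.
by rewrite (_ : y + L - y = L); ring.
Qed.

Lemma sqint_bound G x y L M : 0 <= L -> cont_bd G x y L ->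
  (forall z, on_boundary x y L z -> cmod (G z) <= M) ->
  cmod (sqint G x y L) <= 8 * M * L.
Proof.
move=> L0 cG GM; apply: le_trans (cmodD _ _) _; rewrite cmodM cmodi mul1r.
have B u v : cmod u <= M -> cmod v <= M -> cmod (u - v) <= 2 * M.
  by move=> uM vM; apply: le_trans (cmodB _ _) _; lra.
have := @Cint_bound _ x (x + L) (2 * M) _ (bd_horizontal L0 cG).
have := @Cint_bound _ y (y + L) (2 * M) _ (bd_vertical L0 cG).
rewrite (_ : x + L - x = L); last by ring.
rewrite (_ : y + L - y = L); last by ring.
move=> h1 h2.
have {}h1 : cmod (Cint (fun s => G (Complex (x + L) s) - G (Complex x s)) y (y + L)) <= 2 * (2 * M) * L.
  apply: h1; first by lra.
  move=> t xt; apply: B; apply: GM.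
    by split; [split=> /=; lra|apply: Or42].
  by split; [split=> /=; lra|apply: Or41].
have {}h2 : cmod (Cint (fun s => G (Complex s y) - G (Complex s (y + L))) x (x + L)) <= 2 * (2 * M) * L.
  apply: h2; first by lra.
  move=> t xt; apply: B; apply: GM.
    by split; [split=> /=; lra|apply: Or43].
  by split; [split=> /=; lra|apply: Or44].
lra.
Qed.

Lemma sqint_quarter G x y L : 0 <= L -> cont_sq G x y L ->
  sqint G x y L =
  sqint G x y (L / 2) + sqint G (x + L / 2) y (L / 2) +
  sqint G x (y + L / 2) (L / 2) + sqint G (x + L / 2) (y + L / 2) (L / 2).
Proof.
move=> L0 cG; rewrite /sqint.
have hc v : y <= v <= y + L -> cont_itv (fun s => G (Complex s v)) x (x + L).
  by move=> hv t ht; apply: horizontal_cont; apply: cG; split=> /=; lra.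
have vc u : x <= u <= x + L -> cont_itv (fun s => G (Complex u s)) y (y + L).
  by move=> hv t ht; apply: vertical_cont; apply: cG; split=> /=; lra.
have xL a : a + L / 2 + L / 2 = a + L by lra.
have sub g (a b a' b' : R) : cont_itv g a b -> a <= a' -> b' <= b -> cont_itv g a' b'.
  by move=> cg aa bb t ht; apply: cg; lra.
rewrite !xL.
have h1 := hc y ltac:(lra); have h2 := hc (y + L / 2) ltac:(lra).
have h3 := hc (y + L) ltac:(lra).
have v1 := vc x ltac:(lra); have v2 := vc (x + L / 2) ltac:(lra).
have v3 := vc (x + L) ltac:(lra).
have lo g a : cont_itv g a (a + L) -> cont_itv g a (a + L / 2) by move/sub; apply; lra.
have hi g a : cont_itv g a (a + L) -> cont_itv g (a + L / 2) (a + L) by move/sub; apply; lra.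
rewrite (CintB h1 h3) (CintB v3 v1) (CintB (lo _ _ h1) (lo _ _ h2)).
rewrite (CintB (hi _ _ h1) (hi _ _ h2)) (CintB (lo _ _ h2) (lo _ _ h3)).
rewrite (CintB (hi _ _ h2) (hi _ _ h3)) (CintB (lo _ _ v2) (lo _ _ v1)).
rewrite (CintB (hi _ _ v2) (hi _ _ v1)) (CintB (lo _ _ v3) (lo _ _ v2)).
rewrite (CintB (hi _ _ v3) (hi _ _ v2)).
have sp g a : cont_itv g a (a + L) ->
    Cint g a (a + L) = Cint g a (a + L / 2) + Cint g (a + L / 2) (a + L).
  by move=> cg; apply: Cint_split => //; lra.
rewrite (sp _ _ h1) (sp _ _ h3) (sp _ _ v1) (sp _ _ v3).
ring.
Qed.

(** The integral is 2 pi i, but its nonvanishing is all that the Cauchy formula below uses. On each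
    side the integrand of the imaginary part has the form [v / (u ^+ 2 + v ^+ 2)] with [d <= v <= L]
    and [|u| <= L], hence is at least [d / (2 * L ^+ 2)]. *)
Lemma sqint_inv_gt0 x y L z : x < complex.Re z < x + L -> y < complex.Im z < y + L ->
  0 < complex.Im (sqint (fun w => (w - z)^-1) x y L).
Proof.
case: z => a b /= xa yb.
set G := fun w : CC R => (w - Complex a b)^-1.
have L0 : 0 < L by lra.
have GE u v : (u != a) || (v != b) ->
    G (Complex u v) = Complex ((u - a) / ((u - a) ^+ 2 + (v - b) ^+ 2))
      (- ((v - b) / ((u - a) ^+ 2 + (v - b) ^+ 2))).
  by move=> uv; rewrite /G.
have cG : cont_bd G x y L.
  move=> w [ww wb]; apply: holo_cont; apply: holoV; last first.
    by apply: holoB; [exact: holo_id|exact: holo_cst].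
  apply/eqP => wz; have {}wz : w = Complex a b.
    by apply/eqP; rewrite -subr_eq0; apply/eqP.
  by move: wb; rewrite wz /=; case; lra.
have [d [d0 dx dy]] : exists d, [/\ 0 < d, x + d < a < x + L - d & y + d < b < y + L - d].
  exists (Num.min (Num.min (a - x) (x + L - a)) (Num.min (b - y) (y + L - b)) / 2).
  set m := Num.min _ _.
  have m0 : 0 < m by rewrite /m !lt_min; lra.
  have := le_refl m; rewrite {2}/m !le_min => /andP[/andP[? ?] /andP[? ?]].
  by split; lra.
have pos (f : R -> R) c : (forall t, c <= t <= c + L -> {for t, continuous f}) ->
    (forall t, c <= t <= c + L -> d / (2 * L ^+ 2) <= f t) ->
    0 < \int[mu]_(t in `[c, c + L]) f t.
  move=> cf fd; apply: (@lt_le_trans _ _ (d / (2 * L ^+ 2) * (c + L - c))).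
    by rewrite mulr_gt0// ?divr_gt0 ?mulr_gt0 ?exprn_gt0//; lra.
  rewrite -Rint_cst; last by lra.
  apply: le_Rintegral => //.
  - by apply: cont_integrable => t _; exact: cvg_cst.
  - exact: cont_integrable.
have LL0 : 0 < L ^+ 2 by rewrite exprn_gt0.
have low (u v : R) : `|u| <= L -> d <= v <= L -> d / (2 * L ^+ 2) <= v / (u ^+ 2 + v ^+ 2).
  rewrite ler_norml => uL /andP[dv vL].
  have v0 : 0 < v by lra.
  have uv0 : 0 < u ^+ 2 + v ^+ 2 by rewrite ltr_wpDl ?sqr_ge0// exprn_gt0.
  rewrite ler_pdivrMr ?mulr_gt0// mulrAC ler_pdivlMr//.
  have : u ^+ 2 + v ^+ 2 <= 2 * L ^+ 2 by nra.
  have : 0 <= u ^+ 2 + v ^+ 2 by lra.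
  nra.
have nzu (u : R) : (0 : R) <= u ^+ 2 by exact: sqr_ge0.
rewrite /sqint /=.
have h1 := Im_continuous (bd_horizontal (ltW L0) cG _).
have p1 := pos _ x (fun t ht => Im_continuous (bd_horizontal (ltW L0) cG ht)).
have p2 := pos _ y (fun t ht => Re_continuous (bd_vertical (ltW L0) cG ht)).
rewrite mul1r mul0r add0r; apply: addr_gt0.
  apply: p1 => t ht; rewrite !GE /=; last 2 first.
  - by rewrite orbC; apply/orP; left; apply/eqP; lra.
  - by rewrite orbC; apply/orP; left; apply/eqP; lra.
  have := low (t - a) (b - y) ltac:(rewrite ler_norml; lra) ltac:(lra).
  have := low (t - a) (y + L - b) ltac:(rewrite ler_norml; lra) ltac:(lra).
  rewrite -(sqrrN (b - y)) opprB -(opprB y b) mulNr.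
  have : 0 < d / (2 * L ^+ 2) by rewrite divr_gt0// mulr_gt0.
  lra.
apply: p2 => t ht; rewrite !GE /=; last 2 first.
- by apply/orP; left; apply/eqP; lra.
- by apply/orP; left; apply/eqP; lra.
have := low (t - b) (a - x) ltac:(rewrite ler_norml; lra) ltac:(lra).
have := low (t - b) (x + L - a) ltac:(rewrite ler_norml; lra) ltac:(lra).
rewrite -(sqrrN (a - x)) opprB -(opprB x a) mulNr.
rewrite ![(t - b) ^+ 2 + _]addrC.
have : 0 < d / (2 * L ^+ 2) by rewrite divr_gt0// mulr_gt0.
lra.
Qed.

End SquareIntegral.

(** * Goursat's theorem with two exceptional points *)

Section Cauchy.
Variable R : realType.
Implicit Types (z w a b : CC R) (x y L M s t u d e r : R) (F G H : CC R -> CC R).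

Definition ssqrt (u : R) := Num.sg u * Num.sqrt `|u|.

Lemma ssqrt_ge0 u : 0 <= u -> ssqrt u = Num.sqrt u.
Proof.
move=> u0; rewrite /ssqrt ger0_norm//.
by move: u0; rewrite le0r => /orP[/eqP->|/gtr0_sg->]; rewrite ?sqrtr0 ?mulr0 ?mul1r.
Qed.

Lemma ssqrtN u : ssqrt (- u) = - ssqrt u.
Proof. by rewrite /ssqrt sgrN normrN mulNr. Qed.

Lemma ssqrt_mono : {homo ssqrt : u v / u <= v}.
Proof.
move=> u v uv; have [u0|u0] := leP 0 u.
  by rewrite !ssqrt_ge0 ?ler_wsqrtr// (le_trans u0).
have [v0|v0] := leP 0 v.
  rewrite (ssqrt_ge0 v0) -(opprK u) ssqrtN ssqrt_ge0; last by lra.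
  by apply: (@le_trans _ _ 0); rewrite ?oppr_le0 ?sqrtr_ge0.
have : ssqrt (- v) <= ssqrt (- u) by rewrite !ssqrt_ge0 ?ler_wsqrtr ?lerN2//; lra.
by rewrite !ssqrtN lerN2.
Qed.

Lemma ssqrt_incr u L : 0 <= L -> u <= 0 <= u + L -> Num.sqrt L <= ssqrt (u + L) - ssqrt u.
Proof.
move=> L0 /andP[u0 uL]; rewrite -[X in _ - ssqrt X]opprK ssqrtN opprK !ssqrt_ge0//; last by lra.
have p := sqrtr_ge0 (u + L); have q := sqrtr_ge0 (- u).
rewrite -(@ler_pXn2r _ 2)// ?nnegrE ?sqrtr_ge0 ?addr_ge0// sqrrD !sqr_sqrtr//; last by lra.
by have := mulr_ge0 p q; lra.
Qed.

(** The mass of the square for the product of two measures on the line, with distribution functions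
    [ssqrt] centred at the coordinates of [a]. An interval of length [L] containing the centre has
    mass at least [Num.sqrt L], so a square containing [a] has mass at least [L] rather than of
    order [L ^+ 2]. *)
Definition pmass a x y L :=
  (ssqrt (x + L - complex.Re a) - ssqrt (x - complex.Re a)) *
  (ssqrt (y + L - complex.Im a) - ssqrt (y - complex.Im a)).

Lemma pmass_ge0 a x y L : 0 <= L -> 0 <= pmass a x y L.
Proof. by move=> L0; rewrite mulr_ge0// subr_ge0 ssqrt_mono//; lra. Qed.

Lemma pmass_quarter a x y L : pmass a x y L =
  pmass a x y (L / 2) + pmass a (x + L / 2) y (L / 2) +
  pmass a x (y + L / 2) (L / 2) + pmass a (x + L / 2) (y + L / 2) (L / 2).
Proof.
rewrite /pmass.
have E u : u + L / 2 + L / 2 = u + L by lra.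
by rewrite !E; ring.
Qed.

Lemma pmass_lower a x y L : 0 <= L -> csquare x y L a -> L <= pmass a x y L.
Proof.
move=> L0 [/andP[xa xb] /andP[ya yb]].
have E (u v : R) : u + L - v = u - v + L by lra.
rewrite /pmass !E -[leLHS](sqr_sqrtr L0) expr2.
by apply: ler_pM; rewrite ?sqrtr_ge0// ssqrt_incr//; lra.
Qed.

Lemma csquare_diam x y L z w : csquare x y L z -> csquare x y L w ->
  cmod (w - z) <= 2 * L.
Proof.
case: z w => [a b] [c d] [/= h1 h2] [/= h3 h4].
apply: le_trans (ler_cmod_ReIm _) _ => /=.
have : `|c - a| <= L by rewrite ler_norml; lra.
have : `|d - b| <= L by rewrite ler_norml; lra.
lra.
Qed.

(** An affine function integrates to zero, so only the deviation from it counts. *)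
Lemma sqint_sub_affine G (c d : CC R) x y L M : 0 <= L -> cont_sq G x y L ->
  (forall z, csquare x y L z -> cmod (G z - (c + d * z)) <= M) ->
  cmod (sqint G x y L) <= 8 * M * L.
Proof.
move=> L0 cG GM.
have cA : cont_sq (fun z => - c + (- d) * z) x y L.
  move=> z _; apply: holo_cont; apply: holoD; first exact: holo_cst.
  by apply: holoM; [exact: holo_cst|exact: holo_id].
have E := sqintD L0 (cont_sq_bd cG) (cont_sq_bd cA).
rewrite sqint_affine// addr0 in E; rewrite -E.
apply: sqint_bound => // [z zb|z [zs _]]; last by have := GM z zs; rewrite opprD mulNr.
by apply: cont_sq_bd zb => w ws; apply: ccontD; [exact: cG|exact: cA].
Qed.

(* At an exceptional point only continuity is available, so the integral over a
   small square is merely o(L); it is absorbed by [pmass], an additive set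
   function that is at least [L] on every square containing that point. *)
Lemma goursat G x0 y0 L0 a b : 0 < L0 -> cont_sq G x0 y0 L0 ->
  (forall z, csquare x0 y0 L0 z -> z != a -> z != b -> holo G z) ->
  sqint G x0 y0 L0 = 0.
Proof.
move=> L00 cG dG.
(* This gauge is additive under quartering. The area pays for the points of differentiability, where
   the integral is o(L^2). *)
pose m x y L := L ^+ 2 + pmass a x y L + pmass b x y L.
have m0 x y L : 0 <= L -> 0 <= m x y L.
  by move=> Lp; rewrite /m !addr_ge0// ?sqr_ge0 ?pmass_ge0.
suff all e : 0 < e -> cmod (sqint G x0 y0 L0) <= e * m x0 y0 L0.
  apply/eqP; rewrite -cmod_eq0; apply/eqP/le_anti; rewrite cmod_ge0 andbT.
  apply/ler_addgt0Pl => e e0; rewrite addr0.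
  have M0 := m0 x0 y0 L0 (ltW L00).
  apply: le_trans (all (e / (m x0 y0 L0 + 1)) _) _.
    by rewrite divr_gt0//; lra.
  rewrite mulrAC ler_pdivrMr; last by lra.
  by rewrite ler_pM2l//; lra.
move=> e0.
apply: (@csquare_bisection _ (fun x y L => cmod (sqint G x y L) <= e * m x y L)) => //.
  move=> x y L Lp sub h1 h2 h3 h4.
  rewrite sqint_quarter; [|exact: ltW|by move=> z /sub/cG].
  have -> : m x y L = m x y (L / 2) + m (x + L / 2) y (L / 2) +
      m x (y + L / 2) (L / 2) + m (x + L / 2) (y + L / 2) (L / 2).
    by rewrite /m pmass_quarter (pmass_quarter b); field.
  have := cmodD (sqint G x y (L / 2) + sqint G (x + L / 2) y (L / 2) +
    sqint G x (y + L / 2) (L / 2)) (sqint G (x + L / 2) (y + L / 2) (L / 2)).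
  have := cmodD (sqint G x y (L / 2) + sqint G (x + L / 2) y (L / 2))
    (sqint G x (y + L / 2) (L / 2)).
  have := cmodD (sqint G x y (L / 2)) (sqint G (x + L / 2) y (L / 2)).
  lra.
move=> z zs.
have [zab|/norP[za zb]] := boolP ((z == a) || (z == b)).
  have /cmod_contP/(_ (e / 8))[|d d0 dP] := cG _ zs; first by rewrite divr_gt0.
  exists (d / 2); first by rewrite divr_gt0.
  move=> x y L /andP[Lp Ld] zL sub.
  have mL : L <= m x y L.
    have pa := pmass_ge0 a x y (ltW Lp); have pb := pmass_ge0 b x y (ltW Lp).
    have LL := sqr_ge0 L; rewrite /m.
    case/orP: zab => /eqP zE; rewrite zE in zL.
      by have := pmass_lower (ltW Lp) zL; lra.
    by have := pmass_lower (ltW Lp) zL; lra.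
  apply: (@le_trans _ _ (8 * (e / 8) * L)).
    apply: (@sqint_sub_affine _ (G z) 0); [exact: ltW|by move=> w /sub/cG|].
    move=> w wL; rewrite mul0r addr0; apply/ltW/dP.
    by apply: le_lt_trans (csquare_diam zL wL) _; lra.
  rewrite (_ : 8 * (e / 8) = e); last by field.
  by rewrite ler_pM2l.
(* The 16 absorbs the factor 8 of [sqint_sub_affine] and the bound [2 * L] for the diameter. *)
have /holoP[l /(_ (e / 16))[|d d0 dP]] := dG _ zs za zb.
  by rewrite divr_gt0.
exists (d / 2); first by rewrite divr_gt0.
move=> x y L /andP[Lp Ld] zL sub.
apply: (@le_trans _ _ (8 * (e / 16 * (2 * L)) * L)).
  apply: (@sqint_sub_affine _ (G z - l * z) l); [exact: ltW|by move=> w /sub/cG|].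
  move=> w wL; have D := csquare_diam zL wL.
  have -> : G w - (G z - l * z + l * w) = G w - G z - l * (w - z) by ring.
  apply: le_trans (dP w _) _; first by lra.
  by rewrite ler_pM2l// divr_gt0.
have pa := pmass_ge0 a x y (ltW Lp); have pb := pmass_ge0 b x y (ltW Lp).
rewrite (_ : 8 * (e / 16 * (2 * L)) * L = e * L ^+ 2); last by field.
by rewrite ler_pM2l// /m; lra.
Qed.

End Cauchy.

(** * The Cauchy formula and removable singularities *)

Section CauchyFormula.
Variable R : realType.
Implicit Types (z w a b : CC R) (x y L M s t d e r : R) (F G H : CC R -> CC R).

Lemma cont_eq_punctured F G a d : 0 < d ->
  ccont F a -> ccont G a ->
  (forall w, cmod (w - a) < d -> w != a -> F w = G w) -> F a = G a.
Proof.
move=> d0 /cmod_contP cF /cmod_contP cG FG.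
apply/eqP; rewrite -subr_eq0 -cmod_eq0; apply/eqP/le_anti; rewrite cmod_ge0 andbT.
apply/ler_addgt0Pl => e e0; rewrite addr0.
have e20 : 0 < e / 2 by rewrite divr_gt0.
have [d1 d10 P1] := cF _ e20; have [d2 d20 P2] := cG _ e20.
pose t := Num.min d (Num.min d1 d2) / 2.
have : 0 < Num.min d (Num.min d1 d2) by rewrite !lt_min d0 d10.
have := le_refl (Num.min d (Num.min d1 d2)).
rewrite {2}/Num.min -/(Num.min d1 d2).
rewrite !le_min => /andP[td /andP[td1 td2]] t20.
have ct : cmod (a + t%:C%C - a) = t.
  by rewrite addrC addKr cmod_real ger0_norm// /t; lra.
have ta : a + t%:C%C != a.
  by rewrite -subr_eq0 -cmod_eq0 ct /t gt_eqF//; lra.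
have h1 := P1 (a + t%:C%C) ltac:(rewrite ct /t; lra).
have h2 := P2 (a + t%:C%C) ltac:(rewrite ct /t; lra).
have h3 := FG (a + t%:C%C) ltac:(rewrite ct /t; lra) ta.
rewrite h3 in h1.
have := cmod_triang (F a) (G (a + t%:C%C)) (G a).
by rewrite (cmodBC (F a) (G (_ + _))); lra.
Qed.

Lemma compact_cmod_bounded F (K : set (CC R)) : compact K ->
  (forall z, K z -> ccont F z) -> exists M, forall z, K z -> cmod (F z) <= M.
Proof.
move=> cK cF.
have cc : {within K, continuous (fun z => cmod (F z) : R)}.
  apply: continuous_in_subspaceT => z; rewrite inE => /cF /cmod_contP c.
  apply/(@cvgrPdist_lt _ _ _ (nbhs z)) => e /c[d d0 dP].
  apply/cmod_nbhsP; exists d => // w /dP.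
  by apply: le_lt_trans; rewrite cmodBC; exact: ler_dist_cmod.
have /compact_bounded[M [_ MP]] := continuous_compact cc cK.
exists (M + 1) => z Kz; have := MP (M + 1) ltac:(lra) (cmod (F z)) ltac:(by exists z).
by rewrite /= ger0_norm// cmod_ge0.
Qed.

Definition dquot F z (l : CC R) : CC R -> CC R :=
  fun w => if w == z then l else (F w - F z) / (w - z).

Lemma dquot_holo F z l w : w != z -> holo F w -> holo (dquot F z l) w.
Proof.
move=> wz dF; have wz0 : w - z != 0 by rewrite subr_eq0.
have dq : holo (fun u => (F u - F z) / (u - z)) w.
  exact: (holo_div _ (holoB dF (holo_cst _ _)) (holoB (holo_id _) (holo_cst _ _))).
apply: near_eq_holo dq; apply/cmod_nbhsP; exists (cmod (w - z)).
  by rewrite cmod_gt0.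
move=> u uw; rewrite /dquot; case: eqP => // uz.
by rewrite uz cmodBC ltxx in uw.
Qed.

Lemma dquot_cont_off F z l w : w != z -> ccont F w ->
  ccont (dquot F z l) w.
Proof.
move=> wz cF; have wz0 : w - z != 0 by rewrite subr_eq0.
have dq : ccont (fun u => (F u - F z) / (u - z)) w.
  exact: (ccont_div _ (ccontB cF (ccont_cst _ _)) (ccontB (ccont_id _) (ccont_cst _ _))).
apply: near_eq_ccont dq; apply/cmod_nbhsP; exists (cmod (w - z)).
  by rewrite cmod_gt0.
move=> u uw; rewrite /dquot; case: eqP => // uz.
by rewrite uz cmodBC ltxx in uw.
Qed.

Lemma dquot_cont F z l : has_cderiv F z l -> ccont (dquot F z l) z.
Proof.
move=> Fl; apply/cmod_contP => e e0.
have [d d0 dP] := Fl (e / 2) ltac:(by rewrite divr_gt0).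
exists d => // w wd; rewrite {2}/dquot eqxx /dquot.
case: eqP => [_|/eqP wz]; first by rewrite subrr cmod0.
have wz0 : w - z != 0 by rewrite subr_eq0.
have -> : (F w - F z) / (w - z) - l = (F w - F z - l * (w - z)) / (w - z).
  by field.
rewrite cmod_div ltr_pdivrMr ?cmod_gt0//; apply: le_lt_trans (dP _ wd) _.
by rewrite ltr_pM2r ?cmod_gt0//; lra.
Qed.

Definition inside x y L z :=
  x < complex.Re z < x + L /\ y < complex.Im z < y + L.

Lemma inside_csquare x y L z : inside x y L z -> csquare x y L z.
Proof. by move=> [h1 h2]; split; lra. Qed.

Lemma inside_dist x y L z : inside x y L z -> exists2 d : R, 0 < d &
  (forall w, on_boundary x y L w -> d <= cmod (w - z)) /\
  (forall w, cmod (w - z) < d -> inside x y L w).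
Proof.
case: z => a b [/= h1 h2].
exists (Num.min (Num.min (a - x) (x + L - a)) (Num.min (b - y) (y + L - b))).
  by rewrite !lt_min; lra.
set m := Num.min _ _.
have := le_refl m; rewrite {2}/m !le_min => /andP[/andP[m1 m2] /andP[m3 m4]].
split=> [[c d] [[/= c1 c2] c3]|[c d] /= wm].
  have := ler_Re_cmod (Complex c d - Complex a b : CC R).
  have := ler_Im_cmod (Complex c d - Complex a b : CC R).
  rewrite /= !ler_norml.
  by case: c3; lra.
have := le_lt_trans (ler_Re_cmod (Complex c d - Complex a b : CC R)) wm.
have := le_lt_trans (ler_Im_cmod (Complex c d - Complex a b : CC R)) wm.
by rewrite /= !ltr_norml /inside/=; split; lra.
Qed.

(** The Cauchy integral without the factor 1 / (2 pi i); dividing by the transform of the constant 1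
    takes its place. *)
Definition cauchy_transform F x y L z := sqint (fun w => F w / (w - z)) x y L.

Lemma bd_cont_div F x y L z n : 0 < L -> cont_bd F x y L -> inside x y L z ->
  cont_bd (fun w => F w / (w - z) ^+ n) x y L.
Proof.
move=> L0 cF zi w wb; have [d d0 [dP _]] := inside_dist zi.
have wz : w - z != 0 by rewrite -cmod_gt0 (lt_le_trans d0)// dP.
apply: ccontM; first exact: cF.
apply: ccontV; first by rewrite expf_neq0.
apply: holo_cont; apply: holoX.
by apply: holoB; [exact: holo_id|exact: holo_cst].
Qed.

(** Differentiation under the integral sign, done on the kernel: the remainder has the integrand [F
    w * (u - z) ^+ 2 / ((w - z) ^+ 2 * (w - u))], and on the boundary [w] stays at distance [d] from
    [z] and [d / 2] from [u]. With the factor 8 of [sqint_bound] this gives the constant [C]. *)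
Lemma cauchy_transform_holo F x y L z : 0 < L -> cont_sq F x y L ->
  inside x y L z -> holo (cauchy_transform F x y L) z.
Proof.
move=> L0 cF zi; have L00 := ltW L0.
have [d d0 [dP dI]] := inside_dist zi.
have [M MP] := compact_cmod_bounded (@csquare_compact R x y L) cF.
have M0 : 0 <= M.
  by apply: le_trans (cmod_ge0 _) (MP _ (inside_csquare zi)).
pose C := 16 * M * L / d ^+ 3.
have C0 : 0 <= C by rewrite divr_ge0 ?exprn_ge0 ?mulr_ge0// ltW.
apply/holoP; exists (sqint (fun w => F w / (w - z) ^+ 2) x y L) => e e0.
exists (Num.min (d / 2) (e / (C + 1))).
  by rewrite lt_min !divr_gt0//; lra.
move=> u; rewrite lt_min => /andP[ud ue].
have ui : inside x y L u by apply: dI; lra.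
have cFb := cont_sq_bd cF.
have c1 := bd_cont_div 1 L0 cFb ui; have c2 := bd_cont_div 1 L0 cFb zi.
have c3 := bd_cont_div 2 L0 cFb zi.
have cc G c : cont_bd G x y L -> cont_bd (fun w => c * G w) x y L.
  by move=> cG w wb; apply: ccontM; [exact: ccont_cst|exact: cG].
have E : cauchy_transform F x y L u - cauchy_transform F x y L z -
    sqint (fun w => F w / (w - z) ^+ 2) x y L * (u - z) =
    sqint (fun w => F w / (w - u) ^+ 1 + ((-1) * (F w / (w - z) ^+ 1) +
      (- (u - z)) * (F w / (w - z) ^+ 2))) x y L.
  rewrite sqintD//; last first.
    by move=> w wb; apply: ccontD; [exact: (cc _ _ c2)|exact: (cc _ _ c3)].
  rewrite sqintD//; [|exact: cc|exact: cc].
  rewrite !sqintZ// mulNr mul1r /cauchy_transform addrA -[in RHS]mulrC mulrN.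
  by [].
rewrite E.
have bnd w : on_boundary x y L w -> cmod (F w / (w - u) ^+ 1 +
    ((-1) * (F w / (w - z) ^+ 1) + (- (u - z)) * (F w / (w - z) ^+ 2))) <=
    2 * M / d ^+ 3 * cmod (u - z) ^+ 2.
  move=> wb; have wz := dP _ wb.
  have wu : d / 2 <= cmod (w - u) by have := cmod_triang w u z; lra.
  have wz0 : w - z != 0 by rewrite -cmod_gt0; lra.
  have wu0 : w - u != 0 by rewrite -cmod_gt0; lra.
  have -> : F w / (w - u) ^+ 1 + ((-1) * (F w / (w - z) ^+ 1) +
      (- (u - z)) * (F w / (w - z) ^+ 2)) =
      F w * (u - z) ^+ 2 / ((w - z) ^+ 2 * (w - u)).
    by field; rewrite wz0 wu0.
  rewrite cmod_div (cmodM (F w)) (cmodX (u - z)) (cmodM _ (w - u)) (cmodX (w - z)).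
  rewrite mulrAC ler_wpM2r ?sqr_ge0//.
  have den : d ^+ 3 / 2 <= cmod (w - z) ^+ 2 * cmod (w - u).
    rewrite (_ : d ^+ 3 / 2 = d ^+ 2 * (d / 2)); last by field.
    by apply: ler_pM; rewrite ?ler_pXn2r ?nnegrE ?cmod_ge0 ?exprn_ge0//; lra.
  have d30 : 0 < d ^+ 3 by rewrite exprn_gt0.
  rewrite ler_pdivrMr; last by lra.
  rewrite mulrAC ler_pdivlMr//.
  have FM := MP _ (proj1 wb); have F0 := cmod_ge0 (F w).
  nra.
apply: le_trans (sqint_bound _ _ bnd) _ => //.
  move=> w wb; apply: ccontD; first exact: c1.
  by apply: ccontD; [exact: (cc _ _ c2)|exact: (cc _ _ c3)].
have -> : 8 * (2 * M / d ^+ 3 * cmod (u - z) ^+ 2) * L = C * cmod (u - z) * cmod (u - z).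
  by rewrite /C; field; rewrite gt_eqF.
rewrite ler_wpM2r ?cmod_ge0//.
move: ue; rewrite ltr_pdivlMr; last by lra.
by have := cmod_ge0 (u - z); nra.
Qed.

(** The difference quotient of [F] at [z] integrates to zero; splitting it on the boundary gives the
    formula. *)
Lemma cauchy_formula F x y L a z : 0 < L -> cont_sq F x y L ->
  (forall w, csquare x y L w -> w != a -> holo F w) ->
  inside x y L z -> z != a ->
  cauchy_transform F x y L z = F z * cauchy_transform (fun=> 1) x y L z.
Proof.
move=> L0 cF dF zi za.
have /holoP[l Fl] := dF _ (inside_csquare zi) za.
have : sqint (dquot F z l) x y L = 0.
  (* The exceptional points are the possible singularity [a] of [F] and the point [z], where the
     difference quotient is so far only known to be continuous. *)
  apply: (@goursat _ _ _ _ _ a z) => //.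
    move=> w ws; have [->|wz] := eqVneq w z; first exact: dquot_cont.
    by apply: dquot_cont_off => //; exact: cF.
  by move=> w ws wa wz; apply: dquot_holo => //; exact: dF.
have [d d0 [dP _]] := inside_dist zi.
have bz w : on_boundary x y L w -> w != z.
  by move=> /dP; rewrite -subr_eq0 -cmod_gt0; apply: lt_le_trans.
have cF1 : cont_bd (fun w => F w / (w - z) ^+ 1) x y L.
  by apply: bd_cont_div => //; exact: cont_sq_bd.
have c1 : cont_bd (fun w => 1 / (w - z) ^+ 1) x y L.
  by apply: bd_cont_div => // w _; exact: ccont_cst.
rewrite (@eq_sqint _ _ (fun w => F w / (w - z) ^+ 1 + (- F z) * (1 / (w - z) ^+ 1))).
- rewrite sqintD//; [|exact: ltW|]; last first.
    by move=> w wb; apply: ccontM; [exact: ccont_cst|exact: c1].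
  rewrite sqintZ//; last exact: ltW.
  by move=> /eqP; rewrite mulNr subr_eq0 => /eqP.
- exact: ltW.
- move=> w /bz wz; rewrite /dquot (negbTE wz) !expr1; have wz0 : w - z != 0 by rewrite subr_eq0.
  by field.
Qed.

(** Off [a] the function equals the quotient of its Cauchy transform by that of the constant 1. This
    quotient is holomorphic at [a] too, and continuity extends the equality to [a]. *)
Lemma removable_singularity F a r : 0 < r ->
  (forall w, cmod (w - a) < r -> ccont F w) ->
  (forall w, cmod (w - a) < r -> w != a -> holo F w) -> holo F a.
Proof.
move=> r0 cF dF.
pose x := complex.Re a - r / 4; pose y := complex.Im a - r / 4; pose L := r / 2.
have L0 : 0 < L by rewrite divr_gt0.
have sq w : csquare x y L w -> cmod (w - a) < r.
  case: w a @x @y {cF dF} => [u v] [b c] /= [h1 h2].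
  apply: le_lt_trans (ler_cmod_ReIm _) _ => /=.
  rewrite /= /L in h1 h2.
  have : `|u - b| <= r / 4 by rewrite ler_norml; lra.
  have : `|v - c| <= r / 4 by rewrite ler_norml; lra.
  lra.
have ia : inside x y L a by rewrite /x /y /L; split; lra.
have cS : cont_sq F x y L by move=> w /sq/cF.
have c1 : cont_sq (fun=> 1) x y L by move=> w _; exact: ccont_cst.
pose K1 := cauchy_transform (fun=> 1) x y L.
have K0 w : inside x y L w -> K1 w != 0.
  move=> [h1 h2]; apply/eqP => K10; have := sqint_inv_gt0 h1 h2.
  rewrite (@eq_sqint _ _ (fun u => 1 / (u - w))); [|exact: ltW|by move=> u _; rewrite mul1r].
  by rewrite -/(cauchy_transform (fun=> 1) x y L w) -/(K1 w) K10 ltxx.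
pose Q w := cauchy_transform F x y L w / K1 w.
have dQ : holo Q a.
  by apply: holo_div; [exact: K0|exact: cauchy_transform_holo..].
have [d d0 [_ dI]] := inside_dist ia.
have FQ w : cmod (w - a) < d -> w != a -> F w = Q w.
  move=> /dI wi wa; rewrite /Q (@cauchy_formula F x y L a w)//.
    by rewrite mulfK// K0.
  by move=> u /sq; exact: dF.
have FQa : F a = Q a.
  apply: (cont_eq_punctured d0) => //; last exact: holo_cont.
  by apply: cF; rewrite subrr cmod0.
apply: near_eq_holo dQ; apply/cmod_nbhsP; exists d => // w wd.
by have [->|wa] := eqVneq w a; [|rewrite FQ].
Qed.

Lemma dquot_holo_at F z l r : 0 < r ->
  (forall w, cmod (w - z) < r -> holo F w) -> has_cderiv F z l ->
  holo (dquot F z l) z.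
Proof.
move=> r0 dF Fl; apply: (removable_singularity r0) => w wr.
  have [->|wz] := eqVneq w z; first exact: dquot_cont.
  by apply: dquot_cont_off => //; apply/holo_cont/dF.
by move=> wz; apply: dquot_holo => //; exact: dF.
Qed.

End CauchyFormula.

(** * Local theory of holomorphic functions *)

Section FunctionTheory.
Variable R : realType.
Implicit Types (z w a b c : CC R) (M r d e : R) (F G H p s : CC R -> CC R).

Definition holo_near F a := exists2 r, 0 < r & forall w, cmod (w - a) < r -> holo F w.

Lemma holo_disc_near F a r z : (forall w, cmod (w - a) < r -> holo F w) ->
  cmod (z - a) < r -> holo_near F z.
Proof.
move=> hF za; exists (r - cmod (z - a)); first by rewrite subr_gt0.
by move=> w wz; apply: hF; have := cmod_triang w z a; lra.
Qed.

(** The substitute for power series: repeated division gives finite Taylor expansions with a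
    holomorphic remainder factor. *)
Lemma holo_division F a : holo_near F a -> exists2 G,
  (forall w, F w = F a + (w - a) * G w) & (forall w, holo F w -> holo G w).
Proof.
move=> [r r0 hF].
have /holoP[l Fl] : holo F a by apply: hF; rewrite subrr cmod0.
exists (dquot F a l) => w.
  rewrite /dquot; case: eqVneq => [->|wa]; first by rewrite subrr mul0r addr0.
  have wa0 : w - a != 0 by rewrite subr_eq0.
  by rewrite mulrC divfK// addrC subrK.
have [-> _|wa hw] := eqVneq w a; last exact: dquot_holo.
exact: (dquot_holo_at r0).
Qed.

Lemma cmod_ccont F a : ccont F a -> {for a, continuous (fun z => cmod (F z) : R)}.
Proof.
move=> /cmod_contP c; apply/(@cvgrPdist_lt _ _ _ (nbhs a)) => e /c[d d0 dP].
apply/cmod_nbhsP; exists d => // w /dP.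
by apply: le_lt_trans; rewrite cmodBC; exact: ler_dist_cmod.
Qed.

Lemma Re_ccont F a : ccont F a -> {for a, continuous (fun z => complex.Re (F z) : R)}.
Proof.
move=> /cmod_contP c; apply/(@cvgrPdist_lt _ _ _ (nbhs a)) => e /c[d d0 dP].
apply/cmod_nbhsP; exists d => // w /dP; apply: le_lt_trans.
rewrite cmodBC; apply: le_trans (ler_Re_cmod _).
by case: (F a) (F w) => ? ? [].
Qed.

(** Add the four inequalities. The powers [k] and [k ^+ 2] sum to zero over the fourth roots of
    unity, while the squares of [cmod (p + h k)] sum to four times [cmod p ^+ 2 + h ^+ 2]; the gain
    [4 * t * h ^+ 2] outweighs the errors [v1] to [v4]. *)
Lemma four_point_mean (h t B v1 v2 v3 v4 : R) (al g q p : CC R) :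
  let val (k : CC R) v := B + complex.Re (al * (h%:C%C * k * g)) +
    complex.Re (al * (h%:C%C ^+ 2 * k ^+ 2 * q)) + v + t * cmod (p + h%:C%C * k) ^+ 2 in
  `|v1| < t * h ^+ 2 -> `|v2| < t * h ^+ 2 -> `|v3| < t * h ^+ 2 -> `|v4| < t * h ^+ 2 ->
  val 1 v1 <= B + t * cmod p ^+ 2 -> val (- 1) v2 <= B + t * cmod p ^+ 2 ->
  val 'i%C v3 <= B + t * cmod p ^+ 2 -> val (- 'i%C) v4 <= B + t * cmod p ^+ 2 -> False.
Proof.
rewrite /= !sqrrN (sqr_i R : ('i%C : CC R) ^+ 2 = -1) !cmod_sqr.
rewrite !ltr_norml => /andP[v1h _] /andP[v2h _] /andP[v3h _] /andP[v4h _].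
by case: al g q p => [a1 a2] [g1 g2] [q1 q2] [p1 p2] /=; lra.
Qed.

(* If [|F|] exceeded [M] at [a], then for small [t > 0] the function
   Re (conj (F a) * F) + t |w - c|^2 would have an interior maximum. But its mean
   over the four points [m + d i^k] exceeds its value at [m], since the terms of
   order one and two in the expansion of [F] cancel. *)
Lemma maximum_modulus F c r M : (forall w, cmod (w - c) <= r -> ccont F w) ->
  (forall w, cmod (w - c) < r -> holo F w) ->
  (forall w, cmod (w - c) = r -> cmod (F w) <= M) ->
  forall a, cmod (a - c) <= r -> cmod (F a) <= M.
Proof.
move=> cF hF FM a; rewrite le_eqVlt => /predU1P[/FM//|ar].
have r0 : 0 < r by exact: le_lt_trans (cmod_ge0 _) ar.
rewrite leNgt; apply/negP => MF.
have M0 : 0 <= M.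
  apply: le_trans (cmod_ge0 _) (FM (c + r%:C%C) _).
  by rewrite addrC addKr cmod_real gtr0_norm.
pose al : CC R := conjc (F a).
have alc : cmod al = cmod (F a) by exact: cmodJ.
have Fa0 : 0 < cmod (F a) by exact: le_lt_trans MF.
(* With this [t], the function [u] is at most [(cmod (F a) ^+ 2 + cmod (F a) * M) / 2] on the
   circle, less than its value at [a]; so the maximum is interior. *)
pose t := cmod (F a) * (cmod (F a) - M) / (2 * r ^+ 2).
have t0 : 0 < t by rewrite divr_gt0 ?mulr_gt0 ?exprn_gt0 ?subr_gt0.
pose u w : R := complex.Re (al * F w) + t * cmod (w - c) ^+ 2.
have cu : {within [set w : CC R | cmod (w - c) <= r], continuous u}.
  apply: continuous_in_subspaceT => w; rewrite inE/= => wr.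
  have c1 := Re_ccont (ccontM (ccont_cst al w) (cF w wr)).
  have c2 := cmod_ccont (ccontB (ccont_id w) (ccont_cst c w)).
  have c3 := continuousM c2 c2.
  have c0 : {for w, continuous (cst t : CC R -> R)} by apply: cst_continuous.
  have c4 := continuousM c0 c3.
  exact: continuousD c1 c4.
have [m] := compact_EVT_max (ex_intro _ a (ltW ar) : [set w : CC R | cmod (w - c) <= r] !=set0)
  (@closed_disc_compact R c r) cu.
rewrite inE/= => mr mmax.
have ReFa : complex.Re (al * F a) = cmod (F a) ^+ 2.
  by rewrite mulrC -cmod_sqrJ.
have um : cmod (F a) ^+ 2 <= u m.
  apply: le_trans (mmax a _); last by rewrite inE/= ltW.
  by rewrite /u ReFa lerDl mulr_ge0// ?sqr_ge0// ltW.
have {}mr : cmod (m - c) < r.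
  rewrite lt_neqAle mr andbT; apply/eqP => mr'.
  have : u m <= cmod (F a) * M + t * r ^+ 2.
    rewrite /u mr' lerD2r; apply: le_trans (ler_norm _) _.
    apply: le_trans (ler_Re_cmod _) _; rewrite cmodM alc.
    by rewrite ler_wpM2l ?cmod_ge0// FM.
  have -> : t * r ^+ 2 = cmod (F a) * (cmod (F a) - M) / 2.
    by rewrite /t; field; rewrite gt_eqF.
  move: um Fa0 MF; rewrite expr2; nra.
(* Two divisions expand [F] at [m] to second order; continuity of [H] at [m] makes the error [v] in
   [key] smaller than [t * h ^+ 2]. *)
have [G FG hG] := holo_division (holo_disc_near hF mr).
have [H GH hH] := holo_division (holo_disc_near (fun w wr => hG w (hF w wr)) mr).
have cH : ccont H m by apply: holo_cont; apply: hH; apply: hG; exact: hF.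
have Fa1 : 0 < cmod (F a) + 1 by lra.
move/cmod_contP: cH => /(_ (t / (cmod (F a) + 1)))[|d d0 dP]; first by rewrite divr_gt0.
pose h := Num.min (r - cmod (m - c)) d / 2.
have h0 : 0 < h by rewrite divr_gt0// lt_min d0 subr_gt0 mr.
have [hr hd] : h < r - cmod (m - c) /\ h < d.
  have := le_refl (Num.min (r - cmod (m - c)) d); rewrite {2}/Num.min -/(Num.min _ d).
  by rewrite le_min => /andP[]; move: h0; rewrite /h; lra.
have key (q : CC R) : cmod q = 1 -> 
    exists2 v : R, `|v| < t * h ^+ 2 &
    u (m + h%:C%C * q) = complex.Re (al * F m) + complex.Re (al * (h%:C%C * q * G m)) +
      complex.Re (al * (h%:C%C ^+ 2 * q ^+ 2 * H m)) + v + t * cmod (m - c + h%:C%C * q) ^+ 2.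
  move=> q1; exists (complex.Re (al * (h%:C%C ^+ 2 * q ^+ 2 * (H (m + h%:C%C * q) - H m)))).
    apply: le_lt_trans (ler_Re_cmod _) _.
    rewrite !cmodM q1 alc !cmod_real (gtr0_norm h0) !mulr1.
    have := dP (m + h%:C%C * q); rewrite [X in cmod X < d](_ : _ = h%:C%C * q); last by ring.
    rewrite cmodM q1 mulr1 cmod_real (gtr0_norm h0) => /(_ hd); rewrite ltr_pdivlMr//.
    have hh : 0 < h ^+ 2 by rewrite exprn_gt0.
    set X := cmod (_ - H m) => Xt; have X0 : 0 <= X by exact: cmod_ge0.
    rewrite (_ : _ * _ = h ^+ 2 * (X * cmod (F a))); last by ring.
    by rewrite [ltRHS]mulrC ltr_pM2l//; lra.
  rewrite /u; have -> : m + h%:C%C * q - c = m - c + h%:C%C * q by ring.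
  congr (_ + _); rewrite FG (GH (m + _)).
  have -> : m + h%:C%C * q - m = h%:C%C * q by ring.
  have ReD (x y : CC R) : complex.Re x + complex.Re y = complex.Re (x + y) by case: x y => ? ? [].
  by rewrite !ReD; congr complex.Re; ring.
have umax q : cmod q = 1 -> u (m + h%:C%C * q) <= u m.
  move=> q1; apply: mmax; rewrite inE/=.
  have -> : m + h%:C%C * q - c = (m - c) + h%:C%C * q by ring.
  apply: le_trans (cmodD _ _) _.
  by rewrite cmodM q1 mulr1 cmod_real ger0_norm; lra.
have i1 : cmod ('i%C : CC R) = 1 by exact: cmodi.
have [v1 v1h e1] := key 1 (cmod1 R).
have [v2 v2h e2] := key (- 1) ltac:(by rewrite cmodN cmod1).
have [v3 v3h e3] := key 'i%C i1.
have [v4 v4h e4] := key (- 'i%C) ltac:(by rewrite cmodN i1).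
have um1 := umax 1 (cmod1 R).
have um2 := umax (- 1) ltac:(by rewrite cmodN cmod1).
have um3 := umax 'i%C i1.
have um4 := umax (- 'i%C) ltac:(by rewrite cmodN i1).
rewrite e1 in um1; rewrite e2 in um2; rewrite e3 in um3; rewrite e4 in um4.
exact: four_point_mean v1h v2h v3h v4h um1 um2 um3 um4.
Qed.

End FunctionTheory.

(** * Orders of zeros, Hurwitz's theorem, open mapping and identity theorem *)

Section LocalTheory.
Variable R : realType.
Implicit Types (z w a b c y l : CC R) (M r d e : R) (F G H p s : CC R -> CC R).

Lemma ler_geometric0 (x M q : R) : 0 <= q < 1 -> (forall n, x <= M * q ^+ n) -> x <= 0.
Proof.
move=> /andP[q0 q1] xM.
have := @cvg_geometric _ M q ltac:(by rewrite ger0_norm).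
move=> /cvgr_to_ge; apply; exact: nearW.
Qed.

(** If division by [w - a] never stops, then [F] is divisible by every power of it, and the maximum
    principle on the circle of radius [q] bounds [cmod (F w)] by [M * (cmod (w - a) / q) ^+ n] for
    all [n]. *)
Lemma zero_order F a r : 0 < r -> (forall w, cmod (w - a) < r -> holo F w) ->
  (forall w, cmod (w - a) < r -> F w = 0) \/
  exists k G, [/\ forall w, cmod (w - a) < r -> holo G w, G a != 0 &
    forall w, F w = (w - a) ^+ k * G w].
Proof.
move=> r0 hF; have [|no] := pselect (exists k G,
  [/\ forall w, cmod (w - a) < r -> holo G w, G a != 0 &
    forall w, F w = (w - a) ^+ k * G w]); [by right|left].
have all k : exists2 G, (forall w, cmod (w - a) < r -> holo G w) &
    forall w, F w = (w - a) ^+ k * G w.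
  elim: k => [|k [G hG FG]]; first by exists F => // w; rewrite expr0 mul1r.
  have [H GH hH] := holo_division (ex_intro2 _ _ r r0 hG).
  exists H => w; first by move=> wr; apply: hH; exact: hG.
  rewrite FG GH; have [->|Ga] := eqVneq (G a) 0; first by rewrite add0r mulrA -exprSr.
  by exfalso; apply: no; exists k, G.
move=> w wr.
pose q := (cmod (w - a) + r) / 2.
have w0 := cmod_ge0 (w - a).
have [wq qr] : cmod (w - a) < q /\ q < r by rewrite /q; split; lra.
have cF u : cmod (u - a) <= q -> ccont F u.
  by move=> uq; apply: holo_cont; apply: hF; lra.
have [M MP] := compact_cmod_bounded (@closed_disc_compact R a q) cF.
have q0 : 0 < q by lra.
apply/eqP; rewrite -cmod_eq0; apply/eqP/le_anti; rewrite cmod_ge0 andbT.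
apply: (@ler_geometric0 _ M (cmod (w - a) / q)).
  by apply/andP; split; [rewrite divr_ge0// ltW|rewrite ltr_pdivrMr// mul1r].
move=> n; have [G hG FG] := all n.
have GM : cmod (G w) <= M / q ^+ n.
  apply: (@maximum_modulus _ G a q) => //; last exact: ltW.
  - by move=> u uq; apply: holo_cont; apply: hG; lra.
  - by move=> u uq; apply: hG; lra.
  - move=> u uq; rewrite ler_pdivlMr ?exprn_gt0// mulrC -uq -cmodX -cmodM -FG.
    by apply: MP; rewrite /= uq.
rewrite FG cmodM cmodX expr_div_n (_ : M * _ = cmod (w - a) ^+ n * (M / q ^+ n)).
  by rewrite ler_wpM2l// exprn_ge0.
by rewrite mulrCA.
Qed.

Definition locally_constant F a := exists2 e, 0 < e &
  forall w, cmod (w - a) < e -> F w = F a.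

Lemma value_order F a r : 0 < r -> (forall w, cmod (w - a) < r -> holo F w) ->
  ~ locally_constant F a ->
  exists k G, [/\ forall w, cmod (w - a) < r -> holo G w, G a != 0 &
    forall w, F w = F a + (w - a) ^+ k.+1 * G w].
Proof.
move=> r0 hF nc.
have hF' w : cmod (w - a) < r -> holo (fun w => F w - F a) w.
  by move=> /hF h; apply: holoB => //; exact: holo_cst.
have [F0|[[|k] [G [hG Ga FG]]]] := zero_order r0 hF'.
- by exfalso; apply: nc; exists r => // w /F0/eqP; rewrite subr_eq0 => /eqP.
- have := FG a; rewrite expr0 mul1r subrr => /esym/eqP G0.
  by rewrite G0 in Ga.
- by exists k, G; split=> // w; rewrite -FG addrC subrK.
Qed.

Lemma ccont_nonzero G a : ccont G a -> G a != 0 -> exists2 e, 0 < e &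
  forall w, cmod (w - a) < e -> cmod (G a) / 2 <= cmod (G w).
Proof.
move=> /cmod_contP cG Ga; have [|d d0 dP] := cG (cmod (G a) / 2).
  by rewrite divr_gt0// cmod_gt0.
exists d => // w /dP; rewrite cmodBC => h.
by have := cmod_subl (G a) (G w); lra.
Qed.

Lemma isolated_value F a : holo_near F a -> ~ locally_constant F a ->
  exists2 r, 0 < r & forall q, 0 < q < r -> exists2 d, 0 < d &
    forall w, cmod (w - a) = q -> d <= cmod (F w - F a).
Proof.
move=> [r r0 hF] nc; have [k [G [hG Ga FG]]] := value_order r0 hF nc.
have [e e0 eP] := ccont_nonzero (holo_cont (hG a ltac:(by rewrite subrr cmod0))) Ga.
exists e => // q /andP[q0 qe]; exists (q ^+ k.+1 * (cmod (G a) / 2)).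
  by rewrite mulr_gt0 ?exprn_gt0// divr_gt0// cmod_gt0.
move=> w wq; rewrite FG addrC addKr cmodM cmodX wq ler_pM2l ?exprn_gt0//.
by apply: eP; rewrite wq.
Qed.

(** A zero-free [F] would have an inverse of modulus at most [d^-1] on the circle but larger at the
    centre, against the maximum principle. *)
Lemma hurwitz_zero F a q d : 0 < d -> (forall w, cmod (w - a) <= q -> holo F w) ->
  (forall w, cmod (w - a) = q -> d <= cmod (F w)) -> 0 <= q -> cmod (F a) < d ->
  exists2 w, cmod (w - a) <= q & F w = 0.
Proof.
move=> d0 hF Fd q0 Fa; apply: contrapT => no.
have nz w : cmod (w - a) <= q -> F w != 0.
  by move=> wq; apply/eqP => Fw; apply: no; exists w.
have hV w : cmod (w - a) <= q -> holo (fun u => (F u)^-1) w.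
  by move=> wq; apply: holoV; [exact: nz|exact: hF].
have : cmod (F a)^-1 <= d^-1.
  apply: (@maximum_modulus _ (fun u => (F u)^-1) a q).
  - by move=> w wq; apply: holo_cont; exact: hV.
  - by move=> w /ltW wq; exact: hV.
  - move=> w wq; rewrite cmodV lef_pV2 ?posrE ?Fd//.
    by rewrite cmod_gt0 nz// wq.
  - by rewrite subrr cmod0.
rewrite cmodV lef_pV2 ?posrE//; first by lra.
by rewrite cmod_gt0 nz// subrr cmod0.
Qed.

(** [hurwitz_zero] for [F w - c] on a circle where [F w - F a] has modulus at least [d]: for [c]
    within [d / 2] of [F a] at least [d / 2] remains. *)
Lemma open_mapping F a : holo_near F a -> ~ locally_constant F a ->
  forall r, 0 < r -> exists2 d, 0 < d & forall c, cmod (c - F a) < d ->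
    exists2 w, cmod (w - a) < r & F w = c.
Proof.
move=> hF nc r r0; have [r1 r10 isol] := isolated_value hF nc.
have [r2 r20 hF2] := hF.
pose m := Num.min r (Num.min r1 r2).
have m0 : 0 < m by rewrite !lt_min r0 r10.
have := le_refl m; rewrite {2}/m !le_min => /andP[mr /andP[m1 m2]].
have [d d0 dP] := isol (m / 2) ltac:(lra).
exists (d / 2); first by rewrite divr_gt0.
move=> c cd.
have [|w wq|w wq|||w wm Fw] := @hurwitz_zero (fun w => F w - c) a (m / 2) (d / 2).
- by rewrite divr_gt0.
- by apply: holoB; [apply: hF2; lra|exact: holo_cst].
- by have := dP _ wq; have := cmod_triang (F w) c (F a); lra.
- lra.
- by rewrite cmodBC.
exists w; first by lra.
by apply/eqP; rewrite -subr_eq0 Fw.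
Qed.

Lemma identity_theorem F (X : set (CC R)) a : open X -> connected X ->
  (forall z, X z -> holo F z) -> X a -> locally_constant F a ->
  forall z, X z -> F z = F a.
Proof.
move=> oX cX hF Xa [e0 e00 e0P].
pose P z := exists2 e, 0 < e & forall w, cmod (w - z) < e -> F w = F a.
suff all z : X z -> P z.
  by move=> z /all[e e1 eP]; apply: eP; rewrite subrr cmod0.
move: z; apply: (connected_clopen_ind cX Xa); first by exists e0.
- move=> z Xz [e e1 eP]; exists e => // w _ wz.
  exists (e - cmod (w - z)); first by rewrite subr_gt0.
  by move=> u uw; apply: eP; have := cmod_triang u w z; lra.
- move=> z Xz Pz.
  have [r r0 rX] := proj1 (cmod_openP _) oX _ Xz.
  have hFz w : cmod (w - z) < r -> holo F w by move=> /rX/hF.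
  have Fza : F z = F a.
    apply/eqP; rewrite -subr_eq0 -cmod_eq0; apply/eqP/le_anti; rewrite cmod_ge0 andbT.
    apply/ler_addgt0Pl => e e1; rewrite addr0.
    have /cmod_contP/(_ _ e1)[d d0 dP] := holo_cont (hF _ Xz).
    have [w [_ wz [d' d'0 wP]]] := Pz _ d0.
    have := dP _ wz; rewrite (wP w); last by rewrite subrr cmod0.
    by rewrite cmodBC => /ltW.
  (* If [F] were not locally constant at [z], it would omit the value [F z] on all small circles
     around [z]; but it takes this value at nearby points [w] with property [P]. *)
  apply: contrapT => nP.
  have nc : ~ locally_constant F z.
    by move=> [e e1 eP]; apply: nP; exists e => // w /eP; rewrite Fza.
  have [r1 r10 isol] := isolated_value (ex_intro2 _ _ r r0 hFz) nc.
  have [w [_ wz [d d0 wP]]] := Pz _ r10.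
  have [wz0|wz0] := eqVneq w z; first by apply: nP; exists d => //; rewrite -wz0.
  have [d1 d10 d1P] := isol (cmod (w - z)) ltac:(by rewrite cmod_gt0 subr_eq0 wz0).
  have := d1P w erefl; rewrite Fza wP ?subrr ?cmod0//.
  lra.
Qed.

Lemma has_cderiv_unique F z l l' : has_cderiv F z l -> has_cderiv F z l' -> l = l'.
Proof. by move=> /has_cderivP[_ <-] /has_cderivP[_ <-]. Qed.

Lemma has_cderivM F G z l l' : has_cderiv F z l -> has_cderiv G z l' ->
  has_cderiv (fun w => F w * G w) z (F z * l' + G z * l).
Proof.
by move=> /has_cderivP h /has_cderivP h'; apply/has_cderivP.
Qed.

Lemma has_cderivX a k z : has_cderiv (fun w => (w - a) ^+ k.+1) z ((z - a) ^+ k * k.+1%:R).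
Proof.
elim: k => [|k ih].
  rewrite expr0 mul1r; move=> e e0; exists 1 => // w _.
  rewrite [X in cmod X <= _](_ : _ = 0); last by ring.
  by rewrite cmod0 mulr_ge0 ?cmod_ge0// ltW.
have h1 : has_cderiv (fun w => w - a) z 1.
  move=> e e0; exists 1 => // w _.
  rewrite [X in cmod X <= _](_ : _ = 0); last by ring.
  by rewrite cmod0 mulr_ge0 ?cmod_ge0// ltW.
have := has_cderivM h1 ih.
rewrite (_ : (fun w => (w - a) * (w - a) ^+ k.+1) = (fun w => (w - a) ^+ k.+2)); last first.
  by apply/funext => w; rewrite [in RHS]exprS.
congr (has_cderiv _ _ _); rewrite -[k.+2%:R]natr1 !exprS; ring.
Qed.

Lemma has_cderiv_cstD F c z l : has_cderiv F z l -> has_cderiv (fun w => c + F w) z l.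
Proof.
move=> h e /h[d d0 dP]; exists d => // w /dP.
by rewrite opprD addrACA subrr add0r.
Qed.

End LocalTheory.

(** * Cauchy estimates, holomorphy of sections and of limits *)

Section Estimates.
Variable R : realType.
Implicit Types (z w a b c y l : CC R) (M r d e : R) (F G H p s : CC R -> CC R).

(** Obtained from the maximum principle on the circle of radius [r / 2]: there a difference quotient
    of a function bounded by [N] is at most [2 * N / (r / 2) = 4 * N / r]. Applied once this gives
    [4 * M / r], applied twice [16 * M / r ^+ 2]. *)
Lemma cauchy_estimates F a r M : 0 < r -> (forall w, cmod (w - a) < r -> holo F w) ->
  (forall w, cmod (w - a) < r -> cmod (F w) <= M) ->
  exists l, [/\ has_cderiv F a l, cmod l <= 4 * M / r,
    forall w, cmod (w - a) <= r / 2 ->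
      cmod (F w - F a - l * (w - a)) <= 16 * M / r ^+ 2 * cmod (w - a) ^+ 2 &
    forall w, cmod (w - a) <= r / 2 -> cmod (F w - F a) <= 4 * M / r * cmod (w - a)].
Proof.
move=> r0 hF FM.
have aa : cmod (a - a) < r by rewrite subrr cmod0.
have M0 : 0 <= M by exact: le_trans (cmod_ge0 _) (FM _ aa).
have bound G N : (forall w, cmod (w - a) < r -> holo G w) ->
    (forall w, cmod (w - a) <= r / 2 -> cmod (G w) <= N) ->
    exists H, [/\ forall w, G w = G a + (w - a) * H w,
      forall w, cmod (w - a) < r -> holo H w &
      forall w, cmod (w - a) <= r / 2 -> cmod (H w) <= 4 * N / r].
  move=> hG GN.
  have [H GH hH] := holo_division (ex_intro2 _ _ r r0 hG).
  have hH' w : cmod (w - a) < r -> holo H w by move=> /hG/hH.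
  exists H; split=> // w wr.
  apply: (@maximum_modulus _ H a (r / 2)) wr.
  - by move=> u ur; apply/holo_cont/hH'; lra.
  - by move=> u ur; apply/hH'; lra.
  - move=> u ur; have -> : 4 * N / r = (2 * N) / (r / 2) by field; rewrite gt_eqF.
    rewrite ler_pdivlMr; last by lra.
    rewrite mulrC -ur -cmodM.
    have -> : (u - a) * H u = G u - G a by rewrite GH; ring.
    apply: le_trans (cmodB _ _) _.
    have := GN u ltac:(by rewrite ur); have := GN a ltac:(by rewrite subrr cmod0; lra).
    lra.
have [G [FG hG GM]] := bound F M hF (fun w wr => FM w ltac:(lra)).
have [H [GH hH HM]] := bound G _ hG GM.
have HM' w : cmod (w - a) <= r / 2 ->
    cmod (F w - F a - G a * (w - a)) <= 16 * M / r ^+ 2 * cmod (w - a) ^+ 2.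
  move=> wr; have -> : F w - F a - G a * (w - a) = H w * (w - a) ^+ 2.
    by rewrite FG GH; ring.
  rewrite cmodM cmodX ler_wpM2r ?sqr_ge0//.
  have -> : 16 * M / r ^+ 2 = 4 * (4 * M / r) / r by field; rewrite gt_eqF.
  exact: HM.
exists (G a); split=> //.
- move=> e e0; have C0 : 0 <= 16 * M / r ^+ 2 by rewrite divr_ge0 ?sqr_ge0// mulr_ge0.
  exists (Num.min (r / 2) (e / (16 * M / r ^+ 2 + 1))).
    by rewrite lt_min !divr_gt0//; lra.
  move=> w; rewrite lt_min => /andP[/ltW wr we].
  apply: le_trans (HM' _ wr) _; rewrite expr2 mulrA ler_wpM2r ?cmod_ge0//.
  move: we; rewrite ltr_pdivlMr; last by lra.
  by have := cmod_ge0 (w - a); nra.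
- by apply: GM; rewrite subrr cmod0; lra.
- move=> w wr; have -> : F w - F a = G w * (w - a) by rewrite FG; ring.
  by rewrite cmodM ler_wpM2r ?cmod_ge0// GM.
Qed.

Lemma inverse_holo p s y l r : 0 < r -> ccont s y -> has_cderiv p (s y) l -> l != 0 ->
  (forall u, cmod (u - y) < r -> p (s u) = u) -> holo s y.
Proof.
move=> r0 /cmod_contP cs pl l0 ps; apply/holoP; exists l^-1 => e e0.
have L0 : 0 < cmod l by rewrite cmod_gt0.
(* The first tolerance bounds [D] by [2 * cmod (u - y) / cmod l]; the second then yields the
   required error [e * cmod (u - y)]. *)
have [|d d0 dP] := pl (Num.min (cmod l / 2) (e * cmod l ^+ 2 / 2)).
  by rewrite lt_min !divr_gt0 ?mulr_gt0 ?exprn_gt0.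
have [d' d'0 d'P] := cs _ d0.
exists (Num.min r d'); first by rewrite lt_min r0.
move=> u; rewrite lt_min => /andP[ur /d'P/dP].
rewrite ps// ps ?subrr ?cmod0//; set D := s u - s y => h.
have h1 : cmod (u - y - l * D) <= cmod l / 2 * cmod D.
  by apply: le_trans h _; rewrite ler_wpM2r ?cmod_ge0// ge_min lexx.
have h2 : cmod (u - y - l * D) <= e * cmod l ^+ 2 / 2 * cmod D.
  by apply: le_trans h _; rewrite ler_wpM2r ?cmod_ge0// ge_min lexx orbT.
have h3 : cmod l * cmod D <= 2 * cmod (u - y).
  have := cmodB (u - y) (u - y - l * D).
  by rewrite (_ : u - y - _ = l * D) ?cmodM; [lra|ring].
rewrite -(@ler_pM2l _ (cmod l))// -cmodM mulrBr mulrA mulfV// mul1r (cmodBC (l * D)).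
apply: le_trans h2 _; have D0 := cmod_ge0 D; have u0 := cmod_ge0 (u - y).
have -> : e * cmod l ^+ 2 / 2 * cmod D = cmod l * (e / 2) * (cmod l * cmod D) by field.
have -> : cmod l * (e * cmod (u - y)) = cmod l * (e / 2) * (2 * cmod (u - y)) by field.
by rewrite ler_wpM2l// mulr_ge0; lra.
Qed.

(* Away from the isolated critical points of [p] this is the inverse function
   rule; at a critical point the continuous function [s] has a removable
   singularity. *)
Lemma section_holo p s y r : 0 < r -> (forall u, cmod (u - y) < r -> ccont s u) ->
  (forall u, cmod (u - y) < r -> p (s u) = u) -> holo_near p (s y) -> holo s y.
Proof.
move=> r0 cs ps [rp rp0 hp]; set a := s y in hp.
have yy : cmod (y - y) < r by rewrite subrr cmod0.
have pa : p a = y by rewrite ps.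
have nc : ~ locally_constant p a.
  move=> [e e0 eP]; have /cmod_contP/(_ _ e0)[d d0 dP] := cs _ yy.
  pose t := Num.min r d / 2.
  have t0 : 0 < Num.min r d by rewrite lt_min r0.
  have := le_refl (Num.min r d); rewrite {2}/Num.min -/(Num.min r d) le_min => /andP[tr td].
  have yt : cmod (y + t%:C%C - y) = t.
    by rewrite addrC addKr cmod_real gtr0_norm// /t; lra.
  have := ps (y + t%:C%C) ltac:(rewrite yt /t; lra).
  rewrite (eP (s (y + t%:C%C))) ?pa; last by apply: dP; rewrite yt /t; lra.
  move=> /eqP; rewrite eq_sym -subr_eq0 -cmod_eq0 yt => /eqP; rewrite /t; lra.
have [k [G [hG Ga FG]]] := value_order rp0 hp nc.
have aa : cmod (a - a) < rp by rewrite subrr cmod0.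
have [e e0 eP] := ccont_nonzero (holo_cont (hG _ aa)) Ga.
have cG w : cmod (w - a) <= rp / 2 -> ccont G w by move=> h; apply/holo_cont/hG; lra.
have [M MP] := compact_cmod_bounded (@closed_disc_compact R a (rp / 2)) cG.
have G0 : 0 < cmod (G a) by rewrite cmod_gt0.
have M0 : 0 <= M.
  by apply: le_trans (cmod_ge0 _) (MP a _); rewrite /= subrr cmod0; lra.
pose B := 4 * M / (rp / 4).
have B0 : 0 <= B by rewrite divr_ge0 ?mulr_ge0//; lra.
(* The derivative of [p] at [w] is [(w - a) ^+ k] times [k.+1%:R * G w + (w - a) * l'], where [l']
   is the derivative of [G], bounded by [B]. The last entry keeps the second term below
   [cmod (G a) / 2], hence below the first. *)
pose q := Num.min (Num.min e (rp / 4)) (cmod (G a) / 2 / (B + 1)).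
have q0 : 0 < q by rewrite !lt_min e0 !divr_gt0//; lra.
have dp w : cmod (w - a) < q -> w != a -> exists2 l, has_cderiv p w l & l != 0.
  rewrite !lt_min => /andP[/andP[we wr] wB] wa.
  have [|||l' [Gl' l'B _ _]] := @cauchy_estimates G w (rp / 4) M.
  - lra.
  - by move=> u uw; apply: hG; have := cmod_triang u w a; lra.
  - by move=> u uw; apply: MP => /=; have := cmod_triang u w a; lra.
  have pE : p = (fun w => p a + (w - a) ^+ k.+1 * G w) by apply/funext => u; exact: FG.
  eexists.
    rewrite pE; apply: has_cderiv_cstD; exact: has_cderivM (has_cderivX a k w) Gl'.
  rewrite /= exprS (_ : _ + _ = (w - a) ^+ k * (k.+1%:R * G w - - ((w - a) * l'))); last by ring.
  have wa0 : w - a != 0 by rewrite subr_eq0.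
  rewrite mulf_neq0 ?expf_neq0// -cmod_gt0.
  apply: lt_le_trans (cmod_subl _ _).
  rewrite subr_gt0 cmodN !cmodM cmod_nat.
  have h1 := eP _ we.
  have h2 : cmod (G a) / 2 <= k.+1%:R * cmod (G w).
    by apply: le_trans h1 _; rewrite ler_peMl ?cmod_ge0// ler1n.
  move: wB; rewrite ltr_pdivlMr; last by lra.
  have := cmod_ge0 (w - a); have := cmod_ge0 l'.
  rewrite -/B in l'B.
  nra.
have /cmod_contP/(_ _ q0)[d d0 dP] := cs _ yy.
apply: (@removable_singularity _ s y (Num.min r d)); first by rewrite lt_min r0.
  by move=> u; rewrite lt_min => /andP[/cs].
move=> u; rewrite lt_min => /andP[ur ud] uy.
have sa : s u != a by apply: contra_neq uy => sua; rewrite -(ps _ ur) sua pa.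
have [l pl l0] := dp _ (dP _ ud) sa.
apply: (@inverse_holo p s u l (r - cmod (u - y))) => //; first by rewrite subr_gt0.
  exact: cs.
by move=> v vu; apply: ps; have := cmod_triang v u y; lra.
Qed.

Lemma cmod_lim_le (T : Type) (FF : set_system T) {PF : ProperFilter FF}
    (u : T -> CC R) l M : u @ FF --> l -> (\forall t \near FF, cmod (u t) <= M) ->
  cmod l <= M.
Proof.
move=> /cmod_cvgP ul uM; apply/ler_addgt0Pl => e e0.
have [t [h1 h2]] := filter_ex (filterI uM (ul _ e0)).
by have := cmod_triang l (u t) 0; rewrite !subr0 (cmodBC l); lra.
Qed.

(** Along an ultrafilter a bounded family converges outright; this takes the place of extracting
    subsequences. *)
Lemma ultra_bounded_cvg (T : Type) (FF : set_system T) {UF : UltraFilter FF}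
    (u : T -> CC R) M : (\forall t \near FF, cmod (u t) <= M) ->
  exists2 l, cmod l <= M & u @ FF --> l.
Proof.
move=> uM.
have /(_ (u @ FF) _)[] := @closed_disc_compact R 0 M.
  by apply: filterS uM => t /=; rewrite subr0.
move=> l [/=]; rewrite subr0 => lM cl; exists l => // V nV.
have [//|nuV] := in_ultra_setVsetC (u @^-1` V) UF.
have [z [/= h1 h2]] := cl (~` V) V nuV nV.
by [].
Qed.

Lemma cvg_cmodP (T : Type) (FF : set_system T) {PF : ProperFilter FF}
    (u : T -> CC R) l : u @ FF --> l ->
  (fun t => (cmod (u t) : R)) @ FF --> cmod l.
Proof.
move=> /cmod_cvgP ul; apply/cvgrPdist_lt => e e0; near=> t.
apply: le_lt_trans (ler_dist_cmod _ _) _; rewrite cmodBC.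
by near: t; exact: ul.
Unshelve. all: by end_near. Qed.

(** The derivatives at [a] are bounded, so they converge along the ultrafilter, and the quadratic
    remainder estimate, uniform in [t], survives the pointwise limit. *)
Lemma limit_holo (T : Type) (FF : set_system T) {UF : UltraFilter FF}
    (f : T -> CC R -> CC R) H a r M : 0 < r ->
  (\forall t \near FF, forall w, cmod (w - a) < r -> holo (f t) w /\ cmod (f t w) <= M) ->
  (forall w, cmod (w - a) < r -> (fun t => f t w) @ FF --> H w) -> holo H a.
Proof.
move=> r0 hf fH.
pose P t (l : CC R) := cmod l <= 4 * M / r /\ forall w, cmod (w - a) <= r / 2 ->
  cmod (f t w - f t a - l * (w - a)) <= 16 * M / r ^+ 2 * cmod (w - a) ^+ 2.
have ex t : exists l, (forall w, cmod (w - a) < r -> holo (f t) w /\ cmod (f t w) <= M) -> P t l.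
  have [h|] := pselect (forall w, cmod (w - a) < r -> holo (f t) w /\ cmod (f t w) <= M).
    have [l [_ h1 h2 _]] := cauchy_estimates r0 (fun w wr => proj1 (h w wr)) (fun w wr => proj2 (h w wr)).
    by exists l => _; split.
  by move=> nh; exists 0 => /nh.
have [l lP] := choice ex.
have nP : \forall t \near FF, P t (l t) by apply: filterS hf => t; exact: lP.
have [l0 _ l0P] : exists2 l0, cmod l0 <= 4 * M / r & l @ FF --> l0.
  by apply: ultra_bounded_cvg; apply: filterS nP => t [].
apply/holoP; exists l0.
have est w : cmod (w - a) <= r / 2 ->
    cmod (H w - H a - l0 * (w - a)) <= 16 * M / r ^+ 2 * cmod (w - a) ^+ 2.
  move=> wr; apply: (@cmod_lim_le _ FF _ (fun t => f t w - f t a - l t * (w - a))).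
    apply: cvgB.
      by apply: cvgB; apply: fH; rewrite ?subrr ?cmod0//; lra.
    have c0 : (cst (w - a) : T -> CC R) @ FF --> w - a by exact: cvg_cst.
    exact: (cvgM l0P c0).
  by apply: filterS nP => t [_]; apply.
have M0 : 0 <= M.
  have [t /(_ a)] := filter_ex hf; rewrite subrr cmod0 => /(_ r0)[_].
  exact/le_trans/cmod_ge0.
move=> e e0; have C0 : 0 <= 16 * M / r ^+ 2 by rewrite divr_ge0 ?sqr_ge0// mulr_ge0.
exists (Num.min (r / 2) (e / (16 * M / r ^+ 2 + 1))).
  by rewrite lt_min !divr_gt0//; lra.
move=> w; rewrite lt_min => /andP[/ltW wr we].
apply: le_trans (est _ wr) _; rewrite expr2 mulrA ler_wpM2r ?cmod_ge0//.
move: we; rewrite ltr_pdivlMr; last by lra.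
by have := cmod_ge0 (w - a); nra.
Qed.

End Estimates.

(** * The Schwarz-Pick lemma for difference quotients *)

Section SchwarzPick.
Variable R : realType.
Implicit Types (z w a b c : CC R) (x y M r d e : R) (g T S G : CC R -> CC R).

Local Notation D := (@unit_disc R).

Definition pdist a b : R := cmod ((a - b) / (1 - conjc a * b)).

(** Twice the inverse hyperbolic tangent, which turns the pseudo-hyperbolic distance into the
    hyperbolic one. *)
Definition psi r : R := ln ((1 + r) / (1 - r)).

Lemma disc_distE a b : disc_dist a b = psi (pdist a b).
Proof. by []. Qed.

Lemma sub1_conj_neq0 a b : D a -> D b -> 1 - conjc a * b != 0.
Proof.
rewrite /unit_disc/= => aD bD; rewrite -cmod_gt0.
apply: lt_le_trans (cmod_subl _ _); rewrite cmod1 subr_gt0 cmodM cmodJ.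
by have := cmod_ge0 a; have := cmod_ge0 b; nra.
Qed.

Lemma cmod_sub1_conjC a b : cmod (1 - conjc a * b) = cmod (1 - conjc b * a).
Proof.
rewrite -cmodJ; congr cmod.
by rewrite rmorphB rmorph1 rmorphM/= conjcK mulrC.
Qed.

Lemma pdistC a b : pdist a b = pdist b a.
Proof. by rewrite /pdist !cmod_div cmod_sub1_conjC (cmodBC a). Qed.

Lemma pdist_ge0 a b : 0 <= pdist a b.
Proof. exact: cmod_ge0. Qed.

Lemma pdistxx a : pdist a a = 0.
Proof. by rewrite /pdist subrr mul0r cmod0. Qed.

Lemma sub1_conj_identity a b :
  cmod (1 - conjc a * b) ^+ 2 - cmod (a - b) ^+ 2 =
  (1 - cmod a ^+ 2) * (1 - cmod b ^+ 2).
Proof. by rewrite !cmod_sqr; case: a b => [a1 a2] [b1 b2] /=; ring. Qed.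

Lemma pdist_sqr a b : D a -> D b -> 1 - pdist a b ^+ 2 =
  (1 - cmod a ^+ 2) * (1 - cmod b ^+ 2) / cmod (1 - conjc a * b) ^+ 2.
Proof.
move=> aD bD; have := sub1_conj_neq0 aD bD; rewrite -cmod_gt0 => h.
have h2 : cmod (1 - conjc a * b) ^+ 2 != 0 by rewrite expf_neq0// gt_eqF.
rewrite -sub1_conj_identity mulrBl divff// /pdist cmod_div.
by rewrite expr_div_n.
Qed.

Lemma sub_sqr_gt0 a : D a -> 0 < 1 - cmod a ^+ 2.
Proof. by rewrite /unit_disc/= => aD; have := cmod_ge0 a; nra. Qed.

Lemma pdist_lt1 a b : D a -> D b -> pdist a b < 1.
Proof.
move=> aD bD; have : 0 < 1 - pdist a b ^+ 2.
  rewrite pdist_sqr//; apply: divr_gt0.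
    by apply: mulr_gt0; exact: sub_sqr_gt0.
  by apply: exprn_gt0; rewrite cmod_gt0 sub1_conj_neq0.
by have := pdist_ge0 a b; nra.
Qed.

Lemma pdist_gt0 a b : D a -> D b -> a != b -> 0 < pdist a b.
Proof.
move=> aD bD ab; rewrite /pdist cmod_gt0 mulf_neq0 ?subr_eq0//.
by rewrite invr_neq0// sub1_conj_neq0.
Qed.

Lemma ler_cmod_pdist a b : D a -> D b -> cmod (a - b) <= 2 * pdist a b.
Proof.
move=> aD bD; have := sub1_conj_neq0 aD bD; rewrite -cmod_gt0 => h.
rewrite /pdist cmod_div mulrA ler_pdivlMr// mulrC.
rewrite ler_wpM2r ?cmod_ge0//; apply: le_trans (cmodB _ _) _.
rewrite cmod1 cmodM cmodJ; move: aD bD; rewrite /unit_disc/=.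
by have := cmod_ge0 a; have := cmod_ge0 b; nra.
Qed.

Lemma psi_arg r : 0 <= r < 1 -> 0 < (1 + r) / (1 - r).
Proof. by move=> h; rewrite divr_gt0//; lra. Qed.

Lemma expR_psi r : 0 <= r < 1 -> expR (psi r) = (1 + r) / (1 - r).
Proof. by move=> h; rewrite lnK// posrE psi_arg. Qed.

Lemma psi_ge0 r : 0 <= r < 1 -> 0 <= psi r.
Proof.
by move=> h; rewrite ln_ge0// ler_pdivlMr; lra.
Qed.

Lemma psi_mono r r' : 0 <= r -> r <= r' -> r' < 1 -> psi r <= psi r'.
Proof.
move=> r0 rr r1; rewrite ler_ln ?posrE ?psi_arg//; try lra.
rewrite ler_pdivrMr; last by lra.
rewrite mulrAC ler_pdivlMr; last by lra.
nra.
Qed.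

(** This and [psi_upper] come from [1 + x <= expR x], here at [x = - (2 * r / (1 + r))], there at
    [x = 2 * r / (1 - r)]. *)
Lemma psi_lower r : 0 <= r < 1 -> 2 * r / (1 + r) <= psi r.
Proof.
move=> h; rewrite -ler_expR expR_psi//.
have := expR_ge1Dx (- (2 * r / (1 + r))); rewrite expRN => h1.
have e0 := expR_gt0 (2 * r / (1 + r)).
have E : (1 - r) / (1 + r) = 1 - 2 * r / (1 + r) by field; lra.
rewrite -E in h1; rewrite -(invrK (expR _)) -[leRHS]invrK lef_pV2 ?posrE ?invr_gt0 ?psi_arg//.
by rewrite invf_div.
Qed.

Lemma psi_upper r : 0 <= r < 1 -> psi r <= 2 * r / (1 - r).
Proof.
move=> h; rewrite -ler_expR expR_psi//.
have := expR_ge1Dx (2 * r / (1 - r)).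
by have -> : (1 + r) / (1 - r) = 1 + 2 * r / (1 - r) by field; lra.
Qed.

Lemma disc_dist_ge0 a b : D a -> D b -> 0 <= disc_dist a b.
Proof. by move=> aD bD; rewrite disc_distE psi_ge0// pdist_ge0 pdist_lt1. Qed.

Lemma ler_cmod_disc_dist a b : D a -> D b -> cmod (a - b) <= 2 * disc_dist a b.
Proof.
move=> aD bD; apply: le_trans (ler_cmod_pdist aD bD) _.
rewrite ler_pM2l// disc_distE.
have p0 := pdist_ge0 a b; have p1 := pdist_lt1 aD bD.
have /psi_lower : 0 <= pdist a b < 1 by rewrite p0.
apply: le_trans; rewrite ler_pdivlMr; last by lra.
nra.
Qed.

Definition disc_map T := forall a, D a -> holo T a /\ D (T a).

(** The bound by 1 is the maximum principle on large circles: [pdist (T a) (T u)] is less than 1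
    while [pdist a u] tends to 1 as [u] approaches the unit circle. *)
Lemma schwarz_pick_quotient T a : disc_map T -> D a -> exists S : CC R -> CC R,
  (forall b, D b -> holo S b /\ cmod (S b) <= 1) /\
  forall b, D b -> cmod (S b) * pdist a b = pdist (T a) (T b).
Proof.
move=> dT aD.
have [G TG hG] : exists2 G, (forall b, T b = T a + (b - a) * G b) &
    (forall b, holo T b -> holo G b).
  apply: holo_division; exists (1 - cmod a); first by rewrite subr_gt0.
  move=> w wa; apply: (proj1 (dT w _)); rewrite /unit_disc/=.
  by have := cmod_triang w a 0; rewrite !subr0; lra.
pose S b := G b * (1 - conjc a * b) / (1 - conjc (T a) * T b).
have Sp b : D b -> cmod (S b) * pdist a b = pdist (T a) (T b).
  move=> bD; have n1 := sub1_conj_neq0 aD bD.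
  have n2 := sub1_conj_neq0 (proj2 (dT _ aD)) (proj2 (dT _ bD)).
  have E : T a - T b = (a - b) * G b by rewrite {1}(TG b); ring.
  rewrite /pdist -cmodM E /S; congr cmod.
  move: n1 n2; set d1 := 1 - _ * b; set d2 := 1 - _ * T b => n1 n2.
  rewrite mulrC [_ * d1]mulrC !mulrA divfK//.
have hS b : D b -> holo S b.
  move=> bD; have hTb := proj1 (dT _ bD).
  have lin (u : CC R) (F : CC R -> CC R) : holo F b -> holo (fun b => 1 - u * F b) b.
    by move=> hF; exact: (holoB (holo_cst _ _) (holoM (holo_cst _ _) hF)).
  apply: (holo_div _ (holoM (hG _ hTb) (lin _ _ (holo_id b))) (lin _ _ hTb)).
  exact: sub1_conj_neq0 (proj2 (dT _ aD)) (proj2 (dT _ bD)).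
exists S; split=> // b bD; split; first exact: hS.
rewrite leNgt; apply/negP; set s := cmod (S b) => s1.
pose t := (1 + s) / 2.
have [t1 ts] : 1 < t /\ t < s by rewrite /t; split; lra.
pose k := 1 - t^-1 ^+ 2.
have tV : 0 < t^-1 < 1 by rewrite invr_gt0 invf_lt1; lra.
have k0 : 0 < k < 1 by rewrite /k; nra.
have aD' : cmod a < 1 by [].
have bD' : cmod b < 1 by [].
have a1 : 0 < (1 - cmod a) ^+ 2 by rewrite exprn_gt0// subr_gt0.
pose C := (1 - cmod a ^+ 2) / (1 - cmod a) ^+ 2.
have C0 : 0 < C by rewrite divr_gt0// sub_sqr_gt0.
(* The first entry keeps [b] inside the circle of radius [q]. The second gives
   [C * (1 - q ^+ 2) <= k], so that [pdist a u >= t^-1] and hence [cmod (S u) <= t] on that circle,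
   which contradicts [t < s]. *)
pose q := Num.max ((1 + cmod b) / 2) (1 - k / (2 * C + 1)).
have kC : 0 < k / (2 * C + 1) by rewrite divr_gt0; lra.
have bq : cmod b < q by rewrite lt_max; apply/orP; left; lra.
have q1 : q < 1 by rewrite gt_max; apply/andP; split; lra.
have qk : 1 - k / (2 * C + 1) <= q by rewrite le_max lexx orbT.
have q0 : 0 < q by have := cmod_ge0 b; lra.
suff : s <= t by lra.
apply: (@maximum_modulus _ S 0 q).
- by move=> w; rewrite subr0 => wq; apply/holo_cont/hS; rewrite /unit_disc/=; lra.
- by move=> w; rewrite subr0 => wq; apply/hS; rewrite /unit_disc/=; lra.
- move=> u; rewrite subr0 => uq.
  have uD : D u by rewrite /unit_disc/= uq.
  have low : t^-1 ^+ 2 <= pdist a u ^+ 2.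
    have := pdist_sqr aD uD; rewrite uq => E.
    have : (1 - cmod a ^+ 2) * (1 - q ^+ 2) / cmod (1 - conjc a * u) ^+ 2 <= C * (1 - q ^+ 2).
      rewrite /C [leRHS]mulrAC ler_wpM2l//.
        by rewrite mulr_ge0//; [exact/ltW/sub_sqr_gt0|nra].
      have n0 : 0 < cmod (1 - conjc a * u) by rewrite cmod_gt0 sub1_conj_neq0.
      have n1 : 1 - cmod a <= cmod (1 - conjc a * u).
        apply: le_trans (cmod_subl _ _); rewrite cmod1 cmodM cmodJ uq.
        by have := cmod_ge0 a; nra.
      have n2 : 0 < cmod (1 - conjc a * u) ^+ 2 by exact: exprn_gt0.
      rewrite lef_pV2 ?posrE//.
      by rewrite ler_pXn2r ?nnegrE ?subr_ge0 ?cmod_ge0//; lra.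
    have : C * (1 - q ^+ 2) <= k.
      have : k / (2 * C + 1) * (2 * C + 1) = k by rewrite divfK//; lra.
      have : 1 - q <= k / (2 * C + 1) by lra.
      have : 1 - q ^+ 2 <= 2 * (1 - q) by nra.
      set m := k / _; nra.
    rewrite /k; lra.
  have p0 := pdist_ge0 a u.
  have {}low : t^-1 <= pdist a u.
    by rewrite -(@ler_pXn2r _ 2)// ?nnegrE; lra.
  have := Sp u uD; have := pdist_lt1 (proj2 (dT _ aD)) (proj2 (dT _ uD)).
  have S0 := cmod_ge0 (S u) => h1 h2.
  have : cmod (S u) * t^-1 <= 1 by nra.
  by rewrite ler_pdivrMr ?mul1r; lra.
- by rewrite subr0 ltW.
Qed.

Lemma schwarz_pick T a b : disc_map T -> D a -> D b -> pdist (T a) (T b) <= pdist a b.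
Proof.
move=> dT aD bD; have [S [hS Sp]] := schwarz_pick_quotient dT aD.
rewrite -Sp// ler_piMl ?pdist_ge0//; exact: (proj2 (hS _ bD)).
Qed.

Lemma disc_dist_contract T a b : disc_map T -> D a -> D b ->
  disc_dist (T a) (T b) <= disc_dist a b.
Proof.
move=> dT aD bD; rewrite !disc_distE psi_mono ?pdist_ge0 ?pdist_lt1//.
exact: schwarz_pick.
Qed.

(** The pseudo-hyperbolic distance of the moduli is at most that of the points, written without
    denominators. By [pdist_sqr] it reduces to the bound [1 - cmod a * cmod b] from below for the
    modulus of [1 - conjc a * b]. *)
Lemma pdist_cmod_lower a b : D a -> D b ->
  cmod b - cmod a <= pdist a b * (1 - cmod a * cmod b).
Proof.
move=> aD bD.
have ab1 : 0 < 1 - cmod a * cmod b.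
  by move: aD bD; rewrite /unit_disc/= => aD bD; have := cmod_ge0 a; have := cmod_ge0 b; nra.
have [ba|ab] := leP (cmod b) (cmod a).
  by apply: (@le_trans _ _ 0); [lra|rewrite mulr_ge0 ?pdist_ge0//; lra].
have n0 : 0 < cmod (1 - conjc a * b) by rewrite cmod_gt0 sub1_conj_neq0.
have nb : 1 - cmod a * cmod b <= cmod (1 - conjc a * b).
  by apply: le_trans (cmod_subl _ _); rewrite cmod1 cmodM cmodJ.
rewrite -(@ler_pXn2r _ 2)// ?nnegrE ?mulr_ge0 ?pdist_ge0 ?subr_ge0//; try lra.
rewrite exprMn.
have E := pdist_sqr aD bD.
have : (1 - cmod a ^+ 2) * (1 - cmod b ^+ 2) / cmod (1 - conjc a * b) ^+ 2 * (1 - cmod a * cmod b) ^+ 2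
    <= (1 - cmod a ^+ 2) * (1 - cmod b ^+ 2).
  rewrite mulrAC ler_pdivrMr ?exprn_gt0// ler_wpM2l//.
    by rewrite mulr_ge0// ltW// sub_sqr_gt0.
  by rewrite ler_pXn2r ?nnegrE//; lra.
rewrite -E => h; nra.
Qed.

(** [g] maps only into the closed disc, so Schwarz-Pick is applied to [(1 - e) * g] and [e] tends to
    0. *)
Lemma schwarz_pick_defect g z w : (forall b, D b -> holo g b /\ cmod (g b) <= 1) ->
  D z -> D w -> 1 - cmod (g z) <= expR (disc_dist z w) * (1 - cmod (g w)).
Proof.
move=> hg zD wD; rewrite disc_distE expR_psi ?pdist_ge0 ?pdist_lt1//.
set r := pdist z w; have r1 : r < 1 by exact: pdist_lt1.
have r0 : 0 <= r by exact: pdist_ge0.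
have [gz gw] : cmod (g z) <= 1 /\ cmod (g w) <= 1 by split; apply: (proj2 (hg _ _)).
suff h e : 0 < e -> e < 1 ->
    (1 - (1 - e) * cmod (g z)) * (1 - r) <= (1 + r) * (1 - (1 - e) * cmod (g w)).
  rewrite mulrAC ler_pdivlMr; last by lra.
  apply/ler_addgt0Pl => e e0.
  have := h (Num.min (e / 2) (1 / 2)).
  rewrite lt_min gt_min; set m := Num.min _ _.
  have me : m <= e / 2 by rewrite ge_min lexx.
  have m0 : 0 < m by rewrite lt_min; apply/andP; split; lra.
  move=> /(_ ltac:(lra) ltac:(lra)).
  have z0 := cmod_ge0 (g z); have w0 := cmod_ge0 (g w).
  have r1' : 0 <= 1 - r by lra.
  have h1 : 0 <= m * cmod (g z) * (1 - r) by rewrite !mulr_ge0// ltW.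
  have h2 : m * cmod (g w) <= m by rewrite ler_piMr// ltW.
  have h3 : (1 + r) * (m * cmod (g w)) <= 2 * m.
    by apply: ler_pM => //; [lra|rewrite mulr_ge0// ltW|lra].
  lra.
move=> e0 e1; pose f b := (1 - e)%:C%C * g b.
have e1' : 0 < 1 - e by lra.
have fE b : cmod (f b) = (1 - e) * cmod (g b) by rewrite /f cmodM cmod_real gtr0_norm.
have df : disc_map f.
  move=> b bD; have [h1 h2] := hg _ bD; split.
    by apply: holoM => //; exact: holo_cst.
  by rewrite /unit_disc/= fE; have := cmod_ge0 (g b); nra.
have := schwarz_pick df zD wD; rewrite -/r => p.
have := pdist_cmod_lower (proj2 (df _ zD)) (proj2 (df _ wD)); rewrite -!fE.
set x := cmod (f z); set y := cmod (f w).
have x0 : 0 <= x by exact: cmod_ge0.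
have y0 : 0 <= y by exact: cmod_ge0.
have x1 : x < 1 by exact: (proj2 (df _ zD)).
have y1 : y < 1 by exact: (proj2 (df _ wD)).
have : pdist (f z) (f w) * (1 - x * y) <= r * (1 - x * y) by rewrite ler_wpM2r//; nra.
(* This replaces [1 - x * y] by the larger [(1 - x) + (1 - y)], which makes the inequality linear in
   the two defects. *)
have h : 0 <= (1 - x) * (1 - y) by apply: mulr_ge0; lra.
have : r * (1 - x * y) <= r * (2 - x - y) by apply: ler_wpM2l => //; lra.
lra.
Qed.

(* [S a] extends the difference quotient of [T] at [a] for the pseudo-hyperbolic
   distance, so [cmod (S a a)] is the hyperbolic derivative of [T] at [a]. The
   inequality follows from two applications of the Schwarz-Pick lemma to these
   quotients, because [cmod (S a b) = cmod (S b a)]. *)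
Lemma hyperbolic_derivative_defect T (S : CC R -> CC R -> CC R) :
  (forall a, D a -> (forall b, D b -> holo (S a) b /\ cmod (S a b) <= 1) /\
    forall b, D b -> cmod (S a b) * pdist a b = pdist (T a) (T b)) ->
  forall a b, D a -> D b ->
  1 - cmod (S a a) <= expR (2 * disc_dist a b) * (1 - cmod (S b b)).
Proof.
move=> hS a b aD bD.
have [hSa Sa] := hS _ aD; have [hSb Sb] := hS _ bD.
have [->|ab] := eqVneq a b.
  by rewrite disc_distE pdistxx /psi addr0 subr0 divr1 ln1 mulr0 expR0 mul1r.
have Sab : cmod (S a b) = cmod (S b a).
  have p0 := pdist_gt0 aD bD ab.
  have p1 : pdist a b != 0 by rewrite gt_eqF.
  apply: (mulIf p1).
  by rewrite Sa// pdistC -Sb// pdistC.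
rewrite (_ : 2 * _ = disc_dist a b + disc_dist a b); last by ring.
rewrite expRD -mulrA; apply: le_trans (schwarz_pick_defect hSa aD bD) _.
rewrite ler_wpM2l ?expR_ge0// Sab.
exact: (schwarz_pick_defect hSb aD bD).
Qed.

End SchwarzPick.

(** * Liftings through coverings and the hyperbolic distortion *)

Section Lifting.
Variable R : realType.
Implicit Types (z w a c b : CC R) (x y L r d q : R) (F G p s : CC R -> CC R).
Implicit Types (E X K A B V : set (CC R)).

(** A covering in pointwise form, with a local section through each point of the fibre. The total
    space [E] is general because the notion serves both for coverings by the disc and for squaring
    on the punctured plane. *)
Definition sheeted E p X := forall x : CC R, X x -> exists V, [/\ open V, V x &
  forall b, E b -> V (p b) -> exists s A, [/\ open A, A b,
    forall b1 b2, A b1 -> A b2 -> p b1 = p b2 -> b1 = b2,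
    forall u, V u -> [/\ ccont s u, A (s u), E (s u) & p (s u) = u] & s (p b) = b]].

Definition cont_on K G := forall z, K z -> forall e : R, 0 < e ->
  exists2 d : R, 0 < d & forall w, K w -> cmod (w - z) < d -> cmod (G w - G z) < e.

Definition is_lift E p F K G :=
  cont_on K G /\ forall z, K z -> E (G z) /\ p (G z) = F z.

(** The initial value is prescribed at an arbitrary point of [K], so that a lift over one set can be
    continued over the next. *)
Definition liftable E p F K := forall z0 b, K z0 -> E b -> p b = F z0 ->
  exists2 G, is_lift E p F K G & G z0 = b.

Lemma cont_onW K K' G : K' `<=` K -> cont_on K G -> cont_on K' G.
Proof.
move=> sub cG z /sub Kz e e0; have [d d0 dP] := cG z Kz e e0.
by exists d => // w /sub; exact: dP.
Qed.

Lemma lift_unique E p X F K G1 G2 z0 : sheeted E p X -> connected K ->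
  (forall z, K z -> X (F z)) -> is_lift E p F K G1 -> is_lift E p F K G2 ->
  K z0 -> G1 z0 = G2 z0 -> forall z, K z -> G1 z = G2 z.
Proof.
move=> sh cK FX [c1 l1] [c2 l2] Kz0 G0.
apply: (connected_clopen_ind (P := [set z | G1 z = G2 z]) cK Kz0) => //=.
- move=> z Kz Gz; have [V [oV Vz VP]] := sh _ (FX _ Kz).
  have [E1 p1] := l1 _ Kz.
  have [s [A [oA Ab inj _ _]]] := VP _ E1 ltac:(by rewrite p1).
  have [e e0 eA] := proj1 (cmod_openP _) oA _ Ab.
  have [d1 d10 d1P] := c1 _ Kz _ e0; have [d2 d20 d2P] := c2 _ Kz _ e0.
  exists (Num.min d1 d2); first by rewrite lt_min d10.
  move=> w Kw; rewrite lt_min => /andP[w1 w2]; apply: inj.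
  + by apply: eA; exact: d1P.
  + by apply: eA; rewrite Gz; exact: d2P.
  + by rewrite (proj2 (l1 _ Kw)) (proj2 (l2 _ Kw)).
- move=> z Kz cl; apply/eqP; rewrite -subr_eq0 -cmod_eq0; apply/eqP/le_anti.
  rewrite cmod_ge0 andbT; apply/ler_addgt0Pl => e e0; rewrite addr0.
  have e20 : 0 < e / 2 by rewrite divr_gt0.
  have [d1 d10 d1P] := c1 _ Kz _ e20; have [d2 d20 d2P] := c2 _ Kz _ e20.
  have [|w [Kw wz Gw]] := cl (Num.min d1 d2); first by rewrite lt_min d10.
  move: wz; rewrite lt_min => /andP[/(d1P _ Kw) h1 /(d2P _ Kw) h2].
  have := cmod_triang (G1 z) (G1 w) (G2 z).
  by rewrite (cmodBC (G1 z) (G1 w)) Gw in h1 *; lra.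
Qed.

Lemma closed_sep A z : closed A -> ~ A z ->
  exists2 d : R, 0 < d & forall w, cmod (w - z) < d -> ~ A w.
Proof. by move=> /closed_openC/cmod_openP oA nA; exact: oA. Qed.

Lemma lift_glue E p F A B G1 G2 : closed A -> closed B ->
  is_lift E p F A G1 -> is_lift E p F B G2 ->
  (forall z, A z -> B z -> G1 z = G2 z) ->
  exists2 G, is_lift E p F (A `|` B) G &
    (forall z, A z -> G z = G1 z) /\ (forall z, B z -> G z = G2 z).
Proof.
move=> clA clB [c1 l1] [c2 l2] eq12.
pose G z := if pselect (A z) then G1 z else G2 z.
have GA z : A z -> G z = G1 z by rewrite /G; case: pselect.
have GB z : B z -> G z = G2 z by rewrite /G; case: pselect => // Az Bz; exact: eq12.
exists G => //; split; last first.
  by move=> z [Az|Bz]; [rewrite GA//; exact: l1|rewrite GB//; exact: l2].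
have near K G' z : closed K -> cont_on K G' -> (forall u, K u -> G u = G' u) ->
    forall e : R, 0 < e -> exists2 d : R, 0 < d & forall w, K w -> cmod (w - z) < d ->
      (K z -> cmod (G w - G z) < e) /\ (~ K z -> False).
  move=> clK cG' GG e e0; have [Kz|nKz] := pselect (K z).
    have [d d0 dP] := cG' _ Kz _ e0; exists d => // w Kw wd; split=> // _.
    by rewrite !GG//; exact: dP.
  have [d d0 dP] := closed_sep clK nKz; exists d => // w Kw wd; split=> //.
  by have := dP _ wd.
move=> z ABz e e0.
have [d1 d10 d1P] := near A G1 z clA c1 GA e e0.
have [d2 d20 d2P] := near B G2 z clB c2 GB e e0.
exists (Num.min d1 d2); first by rewrite lt_min d10.
move=> w ABw; rewrite lt_min => /andP[w1 w2].
case: ABw => [Aw|Bw].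
  by have [h nh] := d1P _ Aw w1; have [/h|/nh] := pselect (A z).
by have [h nh] := d2P _ Bw w2; have [/h|/nh] := pselect (B z).
Qed.

(** Lift over the set containing [z0], then over the other one from the value reached at a common
    point [m]; the two lifts agree on the intersection because it is connected. *)
Lemma liftableU E p X F A B : sheeted E p X -> closed A -> closed B ->
  connected (A `&` B) -> A `&` B !=set0 ->
  (forall z, (A `|` B) z -> X (F z)) ->
  liftable E p F A -> liftable E p F B -> liftable E p F (A `|` B).
Proof.
move=> sh clA clB cAB [m [Am Bm]] FX lA lB z0 b ABz0 Eb pb.
have sub K K' G : K' `<=` K -> is_lift E p F K G -> is_lift E p F K' G.
  by move=> s [cG lG]; split=> [|z /s/lG//]; exact: cont_onW cG.
have main A' B' : closed A' -> closed B' -> connected (A' `&` B') -> A' m -> B' m ->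
    (forall z, (A' `|` B') z -> X (F z)) ->
    liftable E p F A' -> liftable E p F B' -> A' z0 ->
    exists2 G, is_lift E p F (A' `|` B') G & G z0 = b.
  move=> cA' cB' cAB' A'm B'm FX' lA' lB' Az0.
  have [G1 l1 G1z] := lA' _ _ Az0 Eb pb.
  have [E1 p1] := proj2 l1 _ A'm.
  have [G2 l2 G2m] := lB' _ _ B'm E1 p1.
  have [|G lG [GA _]] := lift_glue cA' cB' l1 l2; last by exists G => //; rewrite GA.
  move=> z Az Bz; apply: (lift_unique (F := F) (K := A' `&` B') (z0 := m) sh) => //.
  - by move=> u [Au _]; apply: FX'; left.
  - by apply: sub l1 => u [].
  - by apply: sub l2 => u [].
case: ABz0 => [Az0|Bz0]; first exact: main.
rewrite setUC; apply: main => //; first by rewrite setIC.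
by move=> z; rewrite setUC; exact: FX.
Qed.

Definition crect (x x' y y' : R) : set (CC R) :=
  [set w | x <= complex.Re w <= x' /\ y <= complex.Im w <= y'].

Lemma cconvex_crect x x' y y' : cconvex (crect x x' y y').
Proof.
move=> [a b] [c d] t [/= /andP[? ?] /andP[? ?]] [/= /andP[? ?] /andP[? ?]].
move=> /andP[t0 t1]; rewrite /crect/= !mul0r !subr0 !addr0.
by split; apply/andP; split; nra.
Qed.

Lemma closed_crect x x' y y' : closed (crect x x' y y').
Proof.
rewrite -[X in closed X]setCK; apply: open_closedC; apply/cmod_openP => w nw.
apply: contrapT => no; apply: nw.
have aux (g : R -> R -> R) : (forall (u v : CC R), g (complex.Re u) (complex.Im u) -
    g (complex.Re v) (complex.Im v) <= cmod (u - v)) ->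
    (forall u, crect x x' y y' u -> g (complex.Re u) (complex.Im u) <= 0) ->
    g (complex.Re w) (complex.Im w) <= 0.
  move=> lip gle; rewrite leNgt; apply/negP => gw.
  apply: no; exists (g (complex.Re w) (complex.Im w)) => // u uw cu.
  by have := lip w u; have := gle _ cu; rewrite cmodBC; lra.
have Re_sub (u v : CC R) : complex.Re u - complex.Re v = complex.Re (u - v) by case: u v => ? ? [].
have Im_sub (u v : CC R) : complex.Im u - complex.Im v = complex.Im (u - v) by case: u v => ? ? [].
have lR (u v : CC R) := ler_Re_cmod (u - v).
have lI (u v : CC R) := ler_Im_cmod (u - v).
have h1 := aux (fun t _ : R => x - t).
have h2 := aux (fun t _ : R => t - x').
have h3 := aux (fun _ t : R => y - t).
have h4 := aux (fun _ t : R => t - y').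
split; apply/andP; split.
- rewrite -subr_le0; apply: h1 => [u v|u []]; last lra.
  by have := lR u v; rewrite -Re_sub ler_norml; lra.
- rewrite -subr_le0; apply: h2 => [u v|u []]; last lra.
  by have := lR u v; rewrite -Re_sub ler_norml; lra.
- rewrite -subr_le0; apply: h3 => [u v|u []]; last lra.
  by have := lI u v; rewrite -Im_sub ler_norml; lra.
- rewrite -subr_le0; apply: h4 => [u v|u []]; last lra.
  by have := lI u v; rewrite -Im_sub ler_norml; lra.
Qed.

Lemma crectU_h x m x' y y' : x <= m <= x' ->
  crect x m y y' `|` crect m x' y y' = crect x x' y y'.
Proof.
move=> h; apply/seteqP; split=> [w [] [h1 h2]|w [h1 h2]]; try by split=> //; lra.
by have [wm|wm] := leP (complex.Re w) m; [left|right]; split=> //; lra.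
Qed.

Lemma crectU_v x x' y m y' : y <= m <= y' ->
  crect x x' y m `|` crect x x' m y' = crect x x' y y'.
Proof.
move=> h; apply/seteqP; split=> [w [] [h1 h2]|w [h1 h2]]; try by split=> //; lra.
by have [wm|wm] := leP (complex.Im w) m; [left|right]; split=> //; lra.
Qed.

(** By bisection: a small square is mapped into a single [V] of [sheeted], and quarters are glued in
    rows and then vertically, along convex and hence connected edges. *)
Lemma lift_square E p X F x y L : sheeted E p X -> 0 < L ->
  (forall z, csquare x y L z -> ccont F z /\ X (F z)) ->
  liftable E p F (csquare x y L).
Proof.
move=> sh L0 cF.
apply: (@csquare_bisection _ (fun x y L => liftable E p F (csquare x y L))) => //.
  move=> x1 y1 L1 L10 sub h1 h2 h3 h4.
  have h0 : L1 / 2 + L1 / 2 = L1 by lra.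
  have U A B : closed A -> closed B -> cconvex A -> cconvex B -> A `&` B !=set0 ->
      A `|` B `<=` csquare x1 y1 L1 ->
      liftable E p F A -> liftable E p F B -> liftable E p F (A `|` B).
    move=> cA cB vA vB AB0 AB; apply: (liftableU sh) => //.
      by apply: cconvex_connected; exact: cconvexI.
    by move=> z /AB/sub/cF[].
  have row y' : y1 <= y' <= y1 + L1 / 2 -> liftable E p F (csquare x1 y' (L1 / 2)) ->
      liftable E p F (csquare (x1 + L1 / 2) y' (L1 / 2)) ->
      liftable E p F (crect x1 (x1 + L1) y' (y' + L1 / 2)).
    move=> hy l1 l2; rewrite -(@crectU_h x1 (x1 + L1 / 2)); last by lra.
    apply: U; [exact: closed_crect..|exact: cconvex_crect|exact: cconvex_crect| | |exact: l1|].
    - by exists (Complex (x1 + L1 / 2) y'); split; split=> /=; lra.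
    - by move=> z [] [u1 u2]; split; lra.
    - by move: l2; rewrite /csquare -addrA h0.
  have -> : csquare x1 y1 L1 = crect x1 (x1 + L1) y1 (y1 + L1) by [].
  rewrite -(@crectU_v x1 (x1 + L1) y1 (y1 + L1 / 2)); last by lra.
  apply: U; [exact: closed_crect..|exact: cconvex_crect|exact: cconvex_crect| | | |].
  - by exists (Complex x1 (y1 + L1 / 2)); split; split=> /=; lra.
  - by move=> z [] [u1 u2]; split; lra.
  - by apply: row => //; lra.
  - have := row (y1 + L1 / 2) ltac:(lra) h3 h4.
    by rewrite -addrA h0.
move=> z zs; have [/cmod_contP cz Xz] := cF _ zs.
have [V [oV Vz VP]] := sh _ Xz.
have [e e0 eV] := proj1 (cmod_openP _) oV _ Vz.
have [d d0 dP] := cz _ e0.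
exists (d / 2); first by rewrite divr_gt0.
move=> x1 y1 L1 /andP[L10 L1d] z1 sub z0 b z0s Eb pb.
have FV w : csquare x1 y1 L1 w -> V (F w).
  by move=> ws; apply/eV/dP; have := csquare_diam z1 ws; lra.
have [s [A [_ _ _ sP spb]]] := VP _ Eb ltac:(by rewrite pb; exact: FV).
exists (fun w => s (F w)); last by rewrite -pb.
split; last by move=> w /FV/sP[].
move=> w ws e1 e10; have [cs _ _ _] := sP _ (FV _ ws).
have [/cmod_contP cw _] := cF _ (sub _ ws).
move/cmod_contP: cs => /(_ _ e10)[d1 d10 d1P].
have [d2 d20 d2P] := cw _ d10.
by exists d2 => // u _ /d2P; exact: d1P.
Qed.

(** The radial retraction of the plane onto a closed disc; composing with it extends a map from the
    disc to a surrounding square, where [lift_square] applies. *)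
Definition disc_retract c q : CC R -> CC R :=
  fun w => c + (w - c) * (q / Num.max q (cmod (w - c)))%:C%C.

Lemma disc_retract_id c q w : 0 < q -> cmod (w - c) <= q -> disc_retract c q w = w.
Proof.
move=> q0 wq; rewrite /disc_retract; have -> : Num.max q (cmod (w - c)) = q.
  by apply/max_idPl.
by rewrite divff ?gt_eqF// mulr1 addrC subrK.
Qed.

Lemma disc_retract_le c q w : 0 < q -> cmod (disc_retract c q w - c) <= q.
Proof.
move=> q0; rewrite /disc_retract addrC addKr cmodM cmod_real.
have m0 : 0 < Num.max q (cmod (w - c)) by rewrite lt_max q0.
rewrite ger0_norm ?divr_ge0 ?(ltW q0) ?(ltW m0)// mulrA ler_pdivrMr// mulrC ler_pM2l//.
by rewrite le_max lexx orbT.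
Qed.

(** Lipschitz with constant 2: the change of [w] and the change of the scaling factor contribute at
    most [cmod (u - w)] each. *)
Lemma disc_retract_cont c q w : 0 < q -> ccont (disc_retract c q) w.
Proof.
move=> q0; apply/cmod_contP => e e0; exists (e / 2); first by rewrite divr_gt0.
move=> u uw; rewrite /disc_retract.
set m := Num.max q (cmod (w - c)); set n := Num.max q (cmod (u - c)).
have m0 : 0 < m by rewrite lt_max q0.
have n0 : 0 < n by rewrite lt_max q0.
have -> : c + (u - c) * (q / n)%:C%C - (c + (w - c) * (q / m)%:C%C) =
    (u - w) * (q / n)%:C%C + (w - c) * (q / n - q / m)%:C%C.
  by rewrite rmorphB/=; ring.
apply: le_lt_trans (cmodD _ _) _; rewrite !cmodM !cmod_real.
have qn : q <= n by rewrite le_max lexx.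
have h1 : cmod (u - w) * `|q / n| <= cmod (u - w).
  rewrite ger0_norm ?divr_ge0 ?(ltW q0) ?(ltW n0)// ler_piMr ?cmod_ge0//.
  by rewrite ler_pdivrMr// mul1r.
have mn : `|m - n| <= cmod (u - w).
  have max_lip (k l : R) : `|Num.max q k - Num.max q l| <= `|k - l|.
    have := ler_norm (k - l); have := ler_norm (l - k); rewrite distrC ler_norml.
    by case: (leP q k); case: (leP q l) => *; apply/andP; split; lra.
  apply: le_trans (max_lip _ _) (le_trans (ler_dist_cmod _ _) _).
  by rewrite opprB addrA subrK cmodBC.
have h2 : cmod (w - c) * `|q / n - q / m| <= cmod (u - w).
  have -> : q / n - q / m = (q / n) * ((m - n) / m) by field; rewrite !gt_eqF.
  have wm : cmod (w - c) <= m by rewrite le_max lexx orbT.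
  rewrite (normrM (q / n)) (normrM (m - n)) normfV (gtr0_norm m0) ger0_norm ?divr_ge0 ?(ltW q0) ?(ltW n0)//.
  have qn1 : q / n <= 1 by rewrite ler_pdivrMr// mul1r.
  have qn0 : 0 <= q / n by rewrite divr_ge0 ?ltW.
  have : cmod (w - c) / m <= 1 by rewrite ler_pdivrMr// mul1r.
  have : 0 <= cmod (w - c) / m by rewrite divr_ge0 ?cmod_ge0 ?ltW.
  move=> k0 k1.
  rewrite [leLHS](_ : _ = (q / n) * (cmod (w - c) / m) * `|m - n|); last by ring.
  apply: le_trans mn; rewrite ler_piMl//.
  by rewrite mulr_ile1.
lra.
Qed.

Lemma lift_closed_disc E p X F c q : sheeted E p X -> 0 < q ->
  (forall z, cmod (z - c) <= q -> ccont F z /\ X (F z)) ->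
  liftable E p F [set z | cmod (z - c) <= q].
Proof.
move=> sh q0 cF z0 b /= z0q Eb pb.
pose F' z := F (disc_retract c q z).
pose sq := csquare (complex.Re c - q) (complex.Im c - q) (q + q).
have insq w : cmod (w - c) <= q -> sq w.
  move=> wr; have := le_trans (ler_Re_cmod _) wr.
  have := le_trans (ler_Im_cmod _) wr.
  by rewrite /sq; case: w c {wr cF z0q F' sq} => [u v] [b' c'] /=; rewrite !ler_norml => h1 h2; split=> /=; lra.
have [|z _||G [cG lG] Gz0] := @lift_square E p X F' (complex.Re c - q) (complex.Im c - q) (q + q) sh _ _ z0 b (insq _ z0q) Eb.
- lra.
- have [h1 h2] := cF _ (disc_retract_le c z q0); split=> //.
  by apply: ccont_comp => //; exact: disc_retract_cont.
- by rewrite /F' disc_retract_id.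
exists G => //; split; first by apply: cont_onW cG.
by move=> z /= zq; have := lG _ (insq _ zq); rewrite /F' disc_retract_id.
Qed.

Lemma lift_disc E p X F c r z0 b : sheeted E p X ->
  (forall z, cmod (z - c) < r -> ccont F z /\ X (F z)) ->
  cmod (z0 - c) < r -> E b -> p b = F z0 ->
  exists2 G, (forall z, cmod (z - c) < r -> [/\ ccont G z, E (G z) & p (G z) = F z]) &
    G z0 = b.
Proof.
move=> sh cF z0r Eb pb.
have z00 := cmod_ge0 (z0 - c).
(* Radii exhausting the open disc, with lifts that agree by uniqueness. The shift [n.+2] makes
   already [q 0] larger than [cmod (z0 - c)], hence positive. *)
pose q n : R := cmod (z0 - c) + (r - cmod (z0 - c)) * (1 - n.+2%:R^-1).
have qn n : cmod (z0 - c) < q n < r.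
  have i0 : 0 < (n.+2%:R^-1 : R) < 1 by rewrite invr_gt0 invf_lt1 ?ltr0n// ltr1n.
  rewrite /q; set i := n.+2%:R^-1 in i0 *.
  by apply/andP; split; nra.
have lift n : exists2 G, is_lift E p F [set z | cmod (z - c) <= q n] G & G z0 = b.
  have /andP[q1 q2] := qn n.
  apply: (lift_closed_disc sh) => //=; [lra| |exact: ltW].
  by move=> z zq; apply: cF; lra.
have [G GP] := choice (fun n => let: ex_intro2 G h1 h2 := lift n in ex_intro _ G (conj h1 h2)).
have ex z : exists n, cmod (z - c) < r -> cmod (z - c) < q n.
  have [zr|] := pselect (cmod (z - c) < r); last by move=> nz; exists 0%N => /nz.
  pose k := (r - cmod (z - c)) / (r - cmod (z0 - c)).
  have k0 : 0 < k by rewrite divr_gt0 ?subr_gt0.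
  have [n nk] : exists n : nat, n.+2%:R^-1 < k.
    exists (Num.truncn k^-1); rewrite invf_plt ?posrE// ?ltr0n//.
    apply: lt_trans (truncnS_gt k^-1) _; by rewrite ltr_nat.
  exists n => _; rewrite /q.
  have : (r - cmod (z0 - c)) * n.+2%:R^-1 < r - cmod (z - c).
    by move: nk; rewrite /k ltr_pdivlMr ?subr_gt0// mulrC.
  by move: (n.+2%:R^-1 : R) => i; lra.
have [N NP] := choice ex.
have same n m z : cmod (z - c) <= q n -> cmod (z - c) <= q m -> G n z = G m z.
  wlog nm : n m / q n <= q m => [hw zn zm|zn zm].
    by have /orP[h|h] := le_total (q n) (q m); [apply: hw|apply/esym/hw].
  have [[c1 l1] G1] := GP n; have [lm G2] := GP m.
  apply: (lift_unique (F := F) (K := [set z | cmod (z - c) <= q n]) (z0 := z0) sh) => //=.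
  - by apply: cconvex_connected; exact: cconvex_closed_disc.
  - by move=> u uq; have /andP[_ q2] := qn n; apply: (proj2 (cF u _)); lra.
  - have [cm lm'] := lm; split; last by move=> u /= uq; apply: lm' => /=; lra.
    by apply: cont_onW cm => u /= uq; lra.
  - by have /andP[q1 _] := qn n; apply: ltW.
  - by rewrite G1 G2.
exists (fun z => G (N z) z); last by have [_] := GP (N z0).
move=> z zr; have zN := NP _ zr.
have [[cG lG] _] := GP (N z).
have [e1 p1] := lG z (ltW zN).
split=> //.
apply/cmod_contP => e e0; have [d d0 dP] := cG z (ltW zN) _ e0.
exists (Num.min d (q (N z) - cmod (z - c))); first by rewrite lt_min d0 subr_gt0.
move=> w; rewrite lt_min => /andP[wd wq].
have wN : cmod (w - c) < q (N z) by have := cmod_triang w z c; lra.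
have wr : cmod (w - c) < r by have /andP[_] := qn (N z); lra.
rewrite (same _ (N z) w); [|exact/ltW/NP|exact: ltW].
by apply: dP => //; exact: ltW.
Qed.

(** Near [z] the lift is [F] followed by a local section, holomorphic by [section_holo]; injectivity
    of [p] on the sheet identifies the two. *)
Lemma lift_holo E p X F G z r : sheeted E p X -> (forall b, E b -> holo_near p b) ->
  0 < r -> (forall w, cmod (w - z) < r -> [/\ ccont G w, E (G w) & p (G w) = F w]) ->
  X (F z) -> holo F z -> holo G z.
Proof.
move=> sh hp r0 lG Xz hF.
have zz : cmod (z - z) < r by rewrite subrr cmod0.
have [cG EG pG] := lG _ zz.
have [V [oV Vz VP]] := sh _ Xz.
have [s [A [oA Ab inj sP spb]]] := VP _ EG ltac:(by rewrite pG).
have [e e0 eV] := proj1 (cmod_openP _) oV _ Vz.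
have hs : holo s (F z).
  apply: (@section_holo _ p s (F z) e) => // [u /eV/sP[]//|u /eV/sP[]//|].
  by apply: hp; have [] := sP _ Vz.
have [e1 e10 eA] := proj1 (cmod_openP _) oA _ Ab.
move/cmod_contP: cG => /(_ _ e10)[d d0 dP].
have /cmod_contP/(_ _ e0)[d' d'0 d'P] := holo_cont hF.
apply: near_eq_holo (holo_comp hF hs).
apply/cmod_nbhsP; exists (Num.min r (Num.min d d')); first by rewrite !lt_min r0 d0.
move=> w; rewrite !lt_min => /andP[wr /andP[wd wd']].
have [_ As _ ps] := sP _ (eV _ (d'P _ wd')).
apply: inj => //; first by apply: eA; exact: dP.
by rewrite ps; have [] := lG _ wr.
Qed.

End Lifting.

(** * The hyperbolic distance and distortion in terms of lifts *)

Section HyperbolicDistance.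
Variable R : realType.
Implicit Types (z w a b c : CC R) (r d : R) (F G g h p q s T : CC R -> CC R).
Implicit Types (U X Y : set (CC R)).

Local Notation D := (@unit_disc R).

Lemma unit_discE a : D a = (cmod (a - 0) < 1).
Proof. by rewrite subr0. Qed.

Lemma unit_disc_open : open D.
Proof.
by have := @cdisc_open R 0 1; congr open; apply/seteqP; split=> a /=; rewrite subr0.
Qed.

Lemma disc_covering_sheeted X p : disc_covering X p -> sheeted D p X.
Proof.
move=> [_ _ cov] x Xx; have [V [W [[oV Vx] _ UW _ WP]]] := cov _ Xx.
exists V; split=> // b bD Vb.
have [A WA Ab] : (\bigcup_(A in W) A) b by rewrite UW.
have [oA [s [cs sV sA]]] := WP _ WA.
exists s, A; split=> //; last by have [] := sA _ Ab.
  move=> b1 b2 A1 A2 p12.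
  by have [_ <-] := sA _ A1; have [_ <-] := sA _ A2; rewrite p12.
move=> u Vu; have [Asu psu] := sV _ Vu; split=> //.
  apply/ccontE; move: cs; rewrite continuous_open_subspace// => cs.
  by apply: cs; rewrite inE.
have : (\bigcup_(A in W) A) (s u) by exists A.
by rewrite UW => -[].
Qed.

Lemma disc_covering_holo X p a : disc_covering X p -> D a -> holo_near p a.
Proof.
move=> [hp _ _] aD; have [e e0 eD] := proj1 (cmod_openP _) unit_disc_open _ aD.
by exists e => // w /eD/hp/holoE.
Qed.

Lemma disc_covering_image X p a : disc_covering X p -> D a -> X (p a).
Proof. by move=> [_ <- _] aD; exists a. Qed.

Lemma disc_covering_surj X p x : disc_covering X p -> X x -> exists2 a, D a & p a = x.
Proof. by move=> [_ <- _] [a aD <-]; exists a. Qed.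

Lemma disc_lift X p F a b : disc_covering X p ->
  (forall z, D z -> holo F z /\ X (F z)) -> D a -> D b -> p b = F a ->
  exists T, [/\ disc_map T, forall z, D z -> p (T z) = F z & T a = b].
Proof.
move=> cp hF aD bD pb; have sh := disc_covering_sheeted cp.
have [z||T lT Ta] := @lift_disc _ D p X F 0 1 a b sh _ _ bD pb.
- by rewrite -unit_discE => /hF[/holo_cont].
- by rewrite -unit_discE.
exists T; split=> //; last by move=> z; rewrite unit_discE => /lT[].
move=> z zD; split; last by move: zD; rewrite unit_discE => /lT[].
have [e e0 eD] := proj1 (cmod_openP _) unit_disc_open _ zD.
apply: (lift_holo sh _ e0 (F := F)).
- by move=> u; exact: disc_covering_holo cp.
- by move=> w /eD; rewrite unit_discE => /lT.
- exact: (proj2 (hF _ zD)).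
- exact: (proj1 (hF _ zD)).
Qed.

Definition hyp_dist_set X z w : set R :=
  [set t | exists p a b, disc_covering X p /\
    [/\ unit_disc a, unit_disc b, p a = z, p b = w & t = disc_dist a b]].

Lemma hyp_dist_set_ge0 X z w t : hyp_dist_set X z w t -> 0 <= t.
Proof. by move=> [p [a [b [_ [aD bD _ _ ->]]]]]; exact: disc_dist_ge0. Qed.

Lemma hyp_dist_set_lbound X z w : has_lbound (hyp_dist_set X z w).
Proof. by exists 0 => t; exact: hyp_dist_set_ge0. Qed.

Lemma hyp_dist_ge0 X z w : 0 <= hyp_dist X z w.
Proof.
rewrite /hyp_dist -/(hyp_dist_set X z w).
have [->|/set0P ne] := eqVneq (hyp_dist_set X z w) set0; first by rewrite inf0.
by apply: lb_le_inf => // t; exact: hyp_dist_set_ge0.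
Qed.

Lemma hyp_dist_uncovered X z w : ~ (exists p, disc_covering X p) -> hyp_dist X z w = 0.
Proof.
move=> no; rewrite /hyp_dist -[RHS](@inf0 R); congr inf.
by apply/seteqP; split=> // t [p [a [b [cp _]]]]; apply: no; exists p.
Qed.

Lemma disc_dist_small a0 e : 0 < e -> D a0 -> exists2 d : R, 0 < d &
  forall a, D a -> cmod (a - a0) < d -> pdist a a0 < e /\ disc_dist a a0 < e.
Proof.
move=> e0 a0D; have a01 : 0 < 1 - cmod a0 by rewrite subr_gt0.
pose m := Num.min (1 / 2) (e / 8).
have m0 : 0 < m by rewrite lt_min; apply/andP; split; lra.
exists ((1 - cmod a0) * m); first by rewrite mulr_gt0.
move=> a aD aa0.
have n0 : 1 - cmod a0 <= cmod (1 - conjc a * a0).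
  apply: le_trans (cmod_subl _ _); rewrite cmod1 cmodM cmodJ.
  have aD' : cmod a < 1 by []; have := cmod_ge0 a; have := cmod_ge0 a0; nra.
have rm : pdist a a0 < m.
  rewrite /pdist cmod_div ltr_pdivrMr; last by lra.
  by apply: lt_le_trans aa0 _; rewrite mulrC ler_pM2l.
have := le_refl m; rewrite {2}/m le_min => /andP[m1 m2].
have r0 := pdist_ge0 a a0.
split; first by lra.
rewrite disc_distE; apply: le_lt_trans (psi_upper _) _.
  by rewrite r0 pdist_lt1.
by rewrite ltr_pdivrMr; nra.
Qed.

(* Near [p a0] the infimum is attained on the sheet through [a0]: the other
   points over [p a] lie at a distance from [a0] that is bounded below, and any
   other covering factors through [p] by a contraction of the disc. *)
Lemma hyp_dist_local X p a0 : disc_covering X p -> D a0 -> exists2 d : R, 0 < d &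
  forall a, D a -> cmod (a - a0) < d -> hyp_dist X (p a) (p a0) = disc_dist a a0.
Proof.
move=> cp a0D; have sh := disc_covering_sheeted cp.
have Xa0 := disc_covering_image cp a0D.
have [V [oV Va0 VP]] := sh _ Xa0.
have [s [A [oA Aa0 inj _ _]]] := VP _ a0D Va0.
have [r r0 rA] := proj1 (cmod_openP _) oA _ Aa0.
(* The Euclidean distance is at most twice the hyperbolic one, so points outside the disc of radius
   [r] around [a0] are farther from [a0] than [a] is. *)
have [d d0 dP] := @disc_dist_small a0 (r / 2) ltac:(by rewrite divr_gt0) a0D.
exists (Num.min r d); first by rewrite lt_min r0.
move=> a aD; rewrite lt_min => /andP[ar ad].
have {}aA := rA _ ar; have [_ adist] := dP _ aD ad.
apply/le_anti/andP; split.
  apply: ge_inf; first exact: hyp_dist_set_lbound.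
  by exists p, a, a0.
apply: lb_le_inf.
  by exists (disc_dist a a0), p, a, a0.
move=> t [p' [a' [b' [cp' [a'D b'D pa' pb' ->]]]]].
have [z zD||T [dT pT Tb]] := @disc_lift X p p' b' a0 cp _ b'D a0D.
- split; last exact: disc_covering_image cp' zD.
  by have [e e0 hp] := disc_covering_holo cp' zD; apply: hp; rewrite subrr cmod0.
- by [].
have := disc_dist_contract dT a'D b'D; rewrite Tb; apply: le_trans.
have TD := proj2 (dT _ a'D).
have [Tr|rT] := ltP (cmod (T a' - a0)) r.
  have -> : T a' = a; last by [].
  by apply: inj => //; [exact: rA|rewrite pT].
have := ler_cmod_disc_dist TD a0D; lra.
Qed.

(** Uniform in [k], because it is applied with [k = cmod (S b)], which varies as [b] tends to
    [a0]. *)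
Lemma psi_ratio (k r : R) : 0 <= k <= 1 -> 0 < r <= 1 / 2 -> `|psi (k * r) / psi r - k| <= 4 * r.
Proof.
move=> /andP[k0 k1] /andP[r0 r1].
have kr : 0 <= k * r < 1 by apply/andP; split; nra.
have rr : 0 <= r < 1 by apply/andP; split; lra.
have u1 := psi_upper kr; have l1 := psi_lower kr.
have u2 := psi_upper rr; have l2 := psi_lower rr.
have p0 : 0 < psi r by apply: lt_le_trans l2; rewrite divr_gt0; lra.
move: u1 l1 u2 l2; set P := psi (k * r); set Q := psi r in p0 *.
rewrite ler_pdivlMr; last by lra.
rewrite ler_pdivrMr; last by lra.
rewrite ler_pdivlMr; last by lra.
rewrite ler_pdivrMr; last by lra.
move=> u1 l1 u2 l2.
have -> : P / Q - k = (P - k * Q) / Q by field; rewrite gt_eqF.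
rewrite normrM normfV (gtr0_norm p0) ler_pdivrMr// ler_norml.
have krr : k * r <= r by nra.
have P0 : 0 <= P by apply: psi_ge0.
have PU : P * (1 - r) <= 2 * (k * r).
  by apply: le_trans u1; rewrite ler_wpM2l//; lra.
have PL : 2 * (k * r) <= P * (1 + r).
  by apply: le_trans l1 _; rewrite ler_wpM2l//; lra.
have kQ1 : 2 * (k * r) <= k * Q * (1 + r) by nra.
have kQ2 : k * Q * (1 - r) <= 2 * (k * r) by nra.
have kQ : 0 <= k * Q <= Q by apply/andP; split; nra.
have [kQ0 kQQ] := andP kQ.
have P1 : P * (1 - r) <= k * Q * (1 + r) by lra.
have rP : r * P <= 1 / 2 * P by rewrite ler_wpM2r.
have rkQ : r * (k * Q) <= 1 / 2 * (k * Q) by rewrite ler_wpM2r.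
have P3 : P <= 3 * Q by lra.
have rP3 : r * P <= r * (3 * Q) by rewrite ler_pM2l.
have rQ : r * (k * Q) <= r * Q by rewrite ler_pM2l.
by apply/andP; split; lra.
Qed.

(** Near [p a0] both hyperbolic distances equal distances of lifted points, so with [r = pdist b a0]
    the quotient is [psi (cmod (S b) * r) / psi r]; it tends to [cmod (S a0)] by [psi_ratio] and
    continuity of [S]. *)
Lemma hyp_distortion_formula X Y p q g T a0 (S : CC R -> CC R) :
  disc_covering X p -> disc_covering Y q -> disc_map T ->
  (forall z, D z -> q (T z) = g (p z)) -> D a0 ->
  (forall b, D b -> holo S b /\ cmod (S b) <= 1) ->
  (forall b, D b -> cmod (S b) * pdist a0 b = pdist (T a0) (T b)) ->
  hyp_distortion X Y g (p a0) = cmod (S a0).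
Proof.
move=> cp cq dT qT a0D hS Sp; apply/cvg_lim => //.
apply/(@cvgrPdist_lt _ _ _ (nbhs (p a0)^')) => e e0.
have sh := disc_covering_sheeted cp.
have [V [oV Va0 VP]] := sh _ (disc_covering_image cp a0D).
have [s [A [oA Aa0 inj sP sa0]]] := VP _ a0D Va0.
have [hTa0 TDa0] := dT _ a0D.
have [d1 d10 d1P] := hyp_dist_local cp a0D.
have [d2 d20 d2P] := hyp_dist_local cq TDa0.
have /cmod_contP/(_ _ d20)[d3 d30 d3P] := holo_cont hTa0.
have /cmod_contP/(_ (e / 2))[|d4 d40 d4P] := holo_cont (proj1 (hS _ a0D)).
  by rewrite divr_gt0.
have m0 : 0 < Num.min (1 / 2) (e / 16) by rewrite lt_min; apply/andP; split; lra.
have [d5 d50 d5P] := disc_dist_small m0 a0D.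
pose m := Num.min (Num.min (Num.min d1 d3) d4) d5.
have {m0} m0 : 0 < m by rewrite !lt_min d10 d30 d40.
have [cs _ _ _] := sP _ Va0.
move/cmod_contP: cs => /(_ _ m0)[d6 d60 d6P].
have [r r0 rV] := proj1 (cmod_openP _) oV _ Va0.
apply/cmod_nbhsP; exists (Num.min r d6); first by rewrite lt_min r0.
move=> z; rewrite lt_min => /andP[zr z6] zp.
have [_ _ sD ps] := sP _ (rV _ zr).
have := d6P _ z6; rewrite sa0; set b := s z in sD ps *.
rewrite !lt_min => /andP[/andP[/andP[b1 b3] b4] b5].
have ba : b != a0 by apply: contra_neq zp => ba; rewrite -ps ba.
have [pb _] := d5P _ sD b5.
move: pb; rewrite lt_min => /andP[pb1 pb2].
have b0 : 0 < pdist b a0 by exact: pdist_gt0.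
rewrite -ps -qT// -qT// (d2P _ (proj2 (dT _ sD))); last exact: d3P.
rewrite d1P// !disc_distE.
have -> : pdist (T b) (T a0) = cmod (S b) * pdist b a0.
  by rewrite pdistC -Sp// pdistC.
have := @psi_ratio (cmod (S b)) (pdist b a0).
rewrite cmod_ge0 (proj2 (hS _ sD)) b0 (ltW pb1) => /(_ isT isT) h1.
have h2 := d4P _ b4.
have h3 := ler_dist_cmod (S b) (S a0).
set u := psi _ / psi _ in h1 *.
have := ler_normD (cmod (S a0) - cmod (S b)) (cmod (S b) - u).
by rewrite addrA subrK; rewrite distrC in h1; rewrite distrC in h3; lra.
Qed.

Lemma hyp_distortion_uncovered X Y g z :
  ~ (exists p, disc_covering X p) \/ ~ (exists p, disc_covering Y p) ->
  hyp_distortion X Y g z = 0.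
Proof.
move=> no; rewrite /hyp_distortion.
have -> : (fun w => hyp_dist Y (g w) (g z) / hyp_dist X w z) = cst 0.
  apply/funext => w; case: no => no; rewrite (hyp_dist_uncovered _ _ no).
    by rewrite invr0 mulr0.
  by rewrite mul0r.
by apply/cvg_lim => //; exact: cvg_cst.
Qed.

(** The infimum need not be attained: a strict violation at [inf A] persists at some nearby element
    of [A]. *)
Lemma expR_inf_bound (A : set R) (k l : R) : A !=set0 ->
  (forall t, A t -> 0 <= l /\ k <= expR (2 * t) * l) ->
  0 <= l /\ k <= expR (2 * inf A) * l.
Proof.
move=> [t0 At0] main; have [w0 _] := main _ At0; split=> //.
rewrite leNgt; apply/negP => lt.
have [l0|l0] := eqVneq l 0.
  by have [_] := main _ At0; rewrite l0 !mulr0 in lt *; rewrite leNgt lt.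
have {w0 l0} l0 : 0 < l by rewrite lt0r l0.
have K0 : 0 < k / l.
  by rewrite divr_gt0//; apply: le_lt_trans lt; rewrite mulr_ge0 ?expR_ge0// ltW.
have dK : inf A < ln (k / l) / 2.
  by rewrite ltr_pdivlMr// mulrC -ltr_expR lnK// ltr_pdivlMr.
have [t tP tK] : exists2 t, A t & t < ln (k / l) / 2 by apply: inf_lt => //; exists t0.
have [_] := main _ tP; apply/negP; rewrite -ltNge.
by move: tK; rewrite ltr_pdivlMr// mulrC -ltr_expR lnK// ltr_pdivlMr.
Qed.

Lemma distortion_defect U X Y g h z w :
  (exists u, disc_covering U u) -> (exists p, disc_covering X p) ->
  (exists q, disc_covering Y q) ->
  (forall x, U x -> holo h x /\ X (h x)) -> (forall x, X x -> holo g x /\ Y (g x)) ->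
  U z -> U w ->
  0 <= 1 - hyp_distortion X Y g (h w) /\
  1 - hyp_distortion X Y g (h z) <=
    expR (2 * hyp_dist U z w) * (1 - hyp_distortion X Y g (h w)).
Proof.
move=> [u cu] [p cp] [q cq] hh hg Uz Uw.
have hol V (c : CC R -> CC R) a : disc_covering V c -> D a -> holo c a.
  move=> cc aD; have [e e0 hp] := disc_covering_holo cc aD.
  by apply: hp; rewrite subrr cmod0.
have O : D 0 by rewrite /unit_disc/= cmod0.
have [T [dT qT]] : exists T, disc_map T /\ forall a, D a -> q (T a) = g (p a).
  have hgp a : D a -> holo (fun a => g (p a)) a /\ Y (g (p a)).
    move=> aD; have [h1 h2] := hg _ (disc_covering_image cp aD).
    by split=> //; apply: holo_comp h1; exact: hol cp aD.
  have [b bD qb] := disc_covering_surj cq (proj2 (hgp _ O)).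
  by have [T [dT qT _]] := disc_lift cq hgp O bD qb; exists T.
have exS a : exists S : CC R -> CC R, D a ->
    (forall b, D b -> holo S b /\ cmod (S b) <= 1) /\
    forall b, D b -> cmod (S b) * pdist a b = pdist (T a) (T b).
  have [aD|] := pselect (D a); last by move=> na; exists id => /na.
  by have [S SP] := schwarz_pick_quotient dT aD; exists S.
have [S SP] := choice exS.
have form a : D a -> hyp_distortion X Y g (p a) = cmod (S a a).
  by move=> aD; have [h1 h2] := SP _ aD; exact: hyp_distortion_formula cp cq dT qT aD h1 h2.
(* Each competitor [t] comes with its own covering [v] of [U] and its own lift [H], whereas [p],
   [q], [T] and [S] stay fixed. *)
have main t : hyp_dist_set U z w t ->
    0 <= 1 - hyp_distortion X Y g (h w) /\
    1 - hyp_distortion X Y g (h z) <= expR (2 * t) * (1 - hyp_distortion X Y g (h w)).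
  move=> [v [a [b [cv [aD bD <- <- ->]]]]].
  have hhv c : D c -> holo (fun c => h (v c)) c /\ X (h (v c)).
    move=> cD; have [h1 h2] := hh _ (disc_covering_image cv cD).
    by split=> //; apply: holo_comp h1; exact: hol cv cD.
  have [b' b'D pb'] := disc_covering_surj cp (proj2 (hhv _ O)).
  have [H [dH pH _]] := disc_lift cp hhv O b'D pb'.
  have HaD := proj2 (dH _ aD); have HbD := proj2 (dH _ bD).
  rewrite -!pH// !form//.
  have S1 : 0 <= 1 - cmod (S (H b) (H b)).
    by rewrite subr_ge0; exact: (proj2 (proj1 (SP _ HbD) _ HbD)).
  split=> //; apply: le_trans (hyperbolic_derivative_defect SP HaD HbD) _.
  rewrite ler_wpM2r// ler_expR ler_pM2l//.
  exact: disc_dist_contract.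
have [t0 t0P] : exists t, hyp_dist_set U z w t.
  have [a aD ua] := disc_covering_surj cu Uz; have [b bD ub] := disc_covering_surj cu Uw.
  by exists (disc_dist a b), u, a, b.
by have := @expR_inf_bound (hyp_dist_set U z w) _ _ (ex_intro _ _ t0P) main.
Qed.

End HyperbolicDistance.

(** * Koebe uniformization *)

Section KoebeStep.
Variable R : realType.
Implicit Types (z w a b c l : CC R) (r d : R) (F G g h p q s T : CC R -> CC R).
Implicit Types (U W X Y : set (CC R)).

Local Notation D := (@unit_disc R).

(** Over the disc around [x] of radius [cmod x], the quotient [y / x] lies in the right half-plane;
    a root of [x] times the root of [y / x] with positive real part is a section, and its sheet is
    the half-plane where [w / c1] has positive real part. *)
Lemma sqrt_sheeted : sheeted [set z : CC R | z != 0] (fun z => z ^+ 2) [set z | z != 0].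
Proof.
move=> x /= x0; exists [set y | cmod (y - x) < cmod x]; split; first exact: cdisc_open.
  by rewrite /= subrr cmod0 cmod_gt0.
move=> b /= b0 bx.
pose rt (u : CC R) : CC R := if 0 < complex.Re (sqrtc u) then sqrtc u else - sqrtc u.
have rt2 u : rt u ^+ 2 = u by rewrite /rt; case: ifP; rewrite ?sqrrN sqr_sqrtc.
have rtRe u : cmod (u - 1) < 1 -> 0 < complex.Re (rt u).
  move=> u1; have Reu : 0 < complex.Re u.
    have := le_lt_trans (ler_Re_cmod (u - 1)) u1.
    by case: u {u1} => [v1 v2] /=; rewrite ltr_norml; lra.
  rewrite /rt; case: (ltP 0 (complex.Re (sqrtc u))) => // h.
  have : complex.Re (sqrtc u) != 0.
    apply/eqP => e; have := sqr_sqrtc u; case: (sqrtc u) e => [v1 v2] /= -> E.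
    by move: Reu; rewrite -E /=; nra.
  by case: (sqrtc u) h => [v1 v2] /= h /eqP v0; lra.
have Vu y : cmod (y - x) < cmod x -> cmod (y / x - 1) < 1.
  move=> yx; have -> : y / x - 1 = (y - x) / x by field.
  by rewrite cmod_div ltr_pdivrMr ?mul1r// cmod_gt0.
(* Of the two roots of [x], [c1] is the one for which the section passes through [b]. *)
have [c1 c1x c1b] : exists2 c1 : CC R, c1 ^+ 2 = x & c1 * rt (b ^+ 2 / x) = b.
  pose c0 : CC R := sqrtc x; have c0x : c0 ^+ 2 = x by exact: sqr_sqrtc.
  have : (c0 * rt (b ^+ 2 / x)) ^+ 2 = b ^+ 2.
    by rewrite exprMn c0x rt2 mulrC divfK.
  move=> /eqP; rewrite eqf_sqr => /orP[/eqP e|/eqP e]; first by exists c0.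
  by exists (- c0); rewrite ?sqrrN// mulNr e opprK.
have c10 : c1 != 0 by apply: contra_neq x0 => c; rewrite -c1x c expr0n.
have sA y : cmod (y - x) < cmod x -> 0 < complex.Re (c1 * rt (y / x) / c1).
  by move=> /Vu/rtRe; rewrite mulrAC divff// mul1r.
exists (fun y => c1 * rt (y / x)), [set w | 0 < complex.Re (w / c1)]; split => //=.
- apply/cmod_openP => w /= w0; have c10' : 0 < cmod c1 by rewrite cmod_gt0.
  exists (complex.Re (w / c1) * cmod c1); first by rewrite mulr_gt0.
  move=> u; rewrite -ltr_pdivrMr// -cmod_div mulrBl => h.
  have := le_lt_trans (ler_Re_cmod _) h.
  by case: (u / c1) (w / c1) {h w0} => [u1 u2] [w1 w2] /=; rewrite ltr_norml; lra.
- by rewrite -[X in X / c1]c1b; exact: sA.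
- move=> b1 b2 h1 h2 /eqP; rewrite eqf_sqr => /orP[/eqP//|/eqP e].
  by exfalso; move: h1; rewrite e mulNr; case: (b2 / c1) h2 => [v1 v2] /=; lra.
- move=> y yx; split.
  + have hu := Vu _ yx; have m0 := rtRe _ hu.
    have crt : ccont rt (y / x).
      apply/cmod_contP => e e0; set m := complex.Re _ in m0.
      exists (Num.min (1 - cmod (y / x - 1)) (e * m)).
        by rewrite lt_min subr_gt0 hu mulr_gt0.
      move=> v; rewrite lt_min => /andP[v1 v2].
      have hv : cmod (v - 1) < 1 by have := cmod_triang v (y / x) 1; lra.
      have E : cmod (rt v - rt (y / x)) * cmod (rt v + rt (y / x)) = cmod (v - y / x).
        by rewrite -cmodM -subr_sqr !rt2.
      have m1 : m <= cmod (rt v + rt (y / x)).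
        have := ler_Re_cmod (rt v + rt (y / x)); apply: le_trans.
        have := rtRe _ hv; rewrite /m.
        case: (rt v) (rt (y / x)) => [a1 a2] [d1 d2] /= a10.
        by apply: le_trans (ler_norm _); lra.
      rewrite -(@ltr_pM2r _ m)//; apply: le_lt_trans v2; rewrite -E.
      by rewrite ler_wpM2l ?cmod_ge0.
    apply: (ccontM (ccont_cst c1 y)).
    apply: (ccont_comp (f := fun y => y / x) (g := rt)) => //.
    exact: (ccontM (ccont_id y) (ccont_cst x^-1 y)).
  + exact: sA.
  + rewrite mulf_neq0//; apply/eqP => r0.
    by have := rtRe _ (Vu _ yx); rewrite r0 ltxx.
  + by rewrite exprMn c1x rt2 mulrC divfK.
Qed.

(** A root of a zero-free function is a lift through squaring; no logarithm is involved. *)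
Lemma holo_sqrt g c r z0 b : (forall z, cmod (z - c) < r -> holo g z /\ g z != 0) ->
  cmod (z0 - c) < r -> b ^+ 2 = g z0 ->
  exists2 k : CC R -> CC R, (forall z, cmod (z - c) < r -> holo k z /\ k z ^+ 2 = g z) &
    k z0 = b.
Proof.
move=> hg z0r bg.
have b0 : b != 0.
  by have [_] := hg _ z0r; rewrite -bg; apply: contra_neq => ->; rewrite expr0n.
have [z|k kP kz] := @lift_disc R [set z | z != 0] (fun z => z ^+ 2) [set z | z != 0] g c r z0 b sqrt_sheeted _ z0r b0 bg.
  by move=> /hg[/holo_cont].
exists k => // z zr; split; last by have [] := kP _ zr.
have [hz gz] := hg _ zr.
apply: (@lift_holo _ [set z | z != 0] (fun z => z ^+ 2) [set z | z != 0] g k z (r - cmod (z - c)) sqrt_sheeted) => //.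
- by move=> w _; exists 1 => // u _; apply: holoX; exact: holo_id.
- by rewrite subr_gt0.
- by move=> w wz; apply: kP; have := cmod_triang w z c; lra.
Qed.

(** The automorphism of the disc exchanging [0] and [a]. With this sign it is its own inverse. *)
Definition mob a z : CC R := (a - z) / (1 - conjc a * z).

Lemma cmod_mob a z : cmod (mob a z) = pdist a z.
Proof. by []. Qed.

Lemma mob_disc a z : D a -> D z -> D (mob a z).
Proof. by move=> aD zD; rewrite /unit_disc/= cmod_mob pdist_lt1. Qed.

Lemma mobK a z : D a -> D z -> mob a (mob a z) = z.
Proof.
move=> aD zD; have h1 := sub1_conj_neq0 aD zD; have h2 := sub1_conj_neq0 aD aD.
rewrite {1}/mob.
have -> : a - mob a z = z * (1 - conjc a * a) / (1 - conjc a * z).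
  by rewrite /mob; move: h1; move: (conjc a) => a' h1; field.
have -> : 1 - conjc a * mob a z = (1 - conjc a * a) / (1 - conjc a * z).
  by rewrite /mob; move: h1; move: (conjc a) => a' h1; field.
by move: h1 h2; set u := 1 - _ * z; set v := 1 - _ => h1 h2; field; rewrite h1.
Qed.

Lemma mob_holo a z : D a -> D z -> holo (mob a) z.
Proof.
move=> aD zD; apply: (@holo_div _ (fun z => a - z) (fun z => 1 - conjc a * z)).
- exact: sub1_conj_neq0.
- by apply: holoB; [exact: holo_cst|exact: holo_id].
- by apply: holoB; [exact: holo_cst|apply: holoM; [exact: holo_cst|exact: holo_id]].
Qed.

Lemma has_cderiv_comp F G z l l' : has_cderiv F z l -> has_cderiv G (F z) l' ->
  has_cderiv (fun w => G (F w)) z (l' * l).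
Proof.
move=> hF hG e e0.
have L0 := cmod_ge0 l; have L0' := cmod_ge0 l'.
pose e1 := Num.min 1 (e / (2 * (cmod l' + 1))).
have e10 : 0 < e1 by rewrite lt_min ltr01 divr_gt0//; lra.
pose e2 := e / (2 * (cmod l + 1)).
have e20 : 0 < e2 by rewrite divr_gt0//; lra.
have [d1 d10 d1P] := hF _ e10; have [d2 d20 d2P] := hG _ e20.
exists (Num.min d1 (d2 / (cmod l + 1))); first by rewrite lt_min d10 divr_gt0//; lra.
move=> w; rewrite lt_min => /andP[wd1 wd2].
have h1 := d1P _ wd1; have w0 := cmod_ge0 (w - z).
have e11 : e1 <= 1 by rewrite ge_min lexx.
have FL : cmod (F w - F z) <= (cmod l + 1) * cmod (w - z).
  rewrite -(subrK (l * (w - z)) (F w - F z)); apply: le_trans (cmodD _ _) _.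
  by rewrite cmodM; nra.
have Fd : cmod (F w - F z) < d2.
  by apply: le_lt_trans FL _; rewrite mulrC -ltr_pdivlMr//; lra.
have h2 := d2P _ Fd.
have -> : G (F w) - G (F z) - l' * l * (w - z) =
    (G (F w) - G (F z) - l' * (F w - F z)) + l' * (F w - F z - l * (w - z)) by ring.
apply: le_trans (cmodD _ _) _; rewrite cmodM.
have k1 : e2 * cmod (F w - F z) <= e / 2 * cmod (w - z).
  apply: le_trans (ler_wpM2l (ltW e20) FL) _.
  by rewrite /e2 mulrA; apply: ler_wpM2r => //; rewrite le_eqVlt; apply/orP; left; apply/eqP; field; lra.
have k2 : cmod l' * cmod (F w - F z - l * (w - z)) <= e / 2 * cmod (w - z).
  apply: le_trans (ler_wpM2l L0' h1) _; rewrite mulrA ler_wpM2r//.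
  apply: (@le_trans _ _ (cmod l' * (e / (2 * (cmod l' + 1))))).
    by rewrite ler_wpM2l// ge_min lexx orbT.
  have -> : cmod l' * (e / (2 * (cmod l' + 1))) = e / 2 * (cmod l' / (cmod l' + 1)) by field; lra.
  by rewrite ler_piMr//; [lra|rewrite ler_pdivrMr; lra].
lra.
Qed.

Lemma near_eq_has_cderiv F G z l d : 0 < d -> (forall w, cmod (w - z) < d -> F w = G w) ->
  has_cderiv F z l -> has_cderiv G z l.
Proof.
move=> d0 FG hF e e0; have [d1 d10 d1P] := hF _ e0.
exists (Num.min d d1); first by rewrite lt_min d0.
move=> w; rewrite lt_min => /andP[wd /d1P].
by rewrite (FG _ wd) (FG z)// subrr cmod0.
Qed.

Lemma has_cderiv_id z : has_cderiv (fun w => w) z 1.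
Proof.
move=> e e0; exists 1 => // w _.
by rewrite mul1r subrr cmod0 mulr_ge0 ?cmod_ge0 ?ltW.
Qed.

Lemma has_cderiv_mulid G : ccont G 0 -> has_cderiv (fun w => w * G w) 0 (G 0).
Proof.
move=> /cmod_contP cG e e0; have [d d0 dP] := cG _ e0; exists d => // w /dP/ltW h.
rewrite subr0 mul0r subr0 [G 0 * w]mulrC -mulrBr cmodM mulrC.
by rewrite ler_wpM2r ?cmod_ge0.
Qed.

(** A section over every disc contained in [U], through every point lying over it. In contrast to
    evenly covered neighbourhoods, these discs do not depend on [h], so the property can pass to
    limits of maps. *)
Definition disc_sections U W h := forall (x : CC R) r a,
  (forall y, cmod (y - x) < r -> U y) -> W a -> cmod (h a - x) < r ->
  exists2 s, (forall y, cmod (y - x) < r -> [/\ holo s y, W (s y) & h (s y) = y]) &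
    s (h a) = a.

(* Such maps play the role of coverings of [U] by subsets of the disc. *)
Definition koebe_map U z0 W h := [/\ W 0, W `<=` D, h 0 = z0,
  forall a, W a -> holo h a /\ U (h a) & disc_sections U W h].

(** The section over the disc of radius [r] through 0 has values in the unit disc, so its
    derivative, which is inverse to [l], is at most [4 / r]. *)
Lemma koebe_derivative_lower U z0 W h l r : 0 < r ->
  (forall y, cmod (y - z0) < r -> U y) -> koebe_map U z0 W h -> has_cderiv h 0 l ->
  r / 4 <= cmod l.
Proof.
move=> r0 rU [W0 WD h0 hh sec] hl.
have [|s sP s0] := sec z0 r 0 rU W0; first by rewrite h0 subrr cmod0.
rewrite h0 in s0.
have [||l' [sl l'B _ _]] := @cauchy_estimates R s z0 r 1 r0.
- by move=> w /sP[].
- by move=> w /sP[_ /WD/ltW].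
have ll : l * l' = 1.
  apply: (@has_cderiv_unique _ (fun y => h (s y)) z0).
    by apply: has_cderiv_comp sl _; rewrite s0.
  by apply: (near_eq_has_cderiv r0 _ (has_cderiv_id z0)) => w /sP[].
have := congr1 (@cmod R) ll; rewrite cmodM cmod1 => E.
have l'0 : 0 < cmod l' by rewrite cmod_gt0; apply/eqP => l'0; move: E; rewrite l'0 cmod0 mulr0; lra.
rewrite -(@ler_pM2r _ (cmod l'))// E.
apply: le_trans (ler_wpM2l _ l'B) _; first by lra.
by rewrite mulr1 le_eqVlt; apply/orP; left; apply/eqP; field; rewrite gt_eqF.
Qed.

(* Koebe's trick: if [W] omits [b^2], precompose [h] with the two-sheeted
   self-map of the disc that branches over [b^2]. *)
Lemma koebe_step U z0 W h l b : koebe_map U z0 W h -> has_cderiv h 0 l ->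
  D b -> ~ W (b ^+ 2) -> exists W' h' l', [/\ koebe_map U z0 W' h', has_cderiv h' 0 l' &
    cmod l' = cmod l * (2 * cmod b / (1 + cmod b ^+ 2))].
Proof.
move=> [W0 WD h0 hh sec] hl bD nWb.
have D0 : D 0 by rewrite /unit_disc/= cmod0.
have sqD z : D z -> D (z ^+ 2).
  by rewrite /unit_disc/= cmodX => zD; have := cmod_ge0 z; nra.
have b2D := sqD _ bD.
(* [q] fixes 0, and its branch value is [q b = b ^+ 2], the point omitted by [W]. *)
pose q z := mob (b ^+ 2) (mob b z ^+ 2).
have qD z : D z -> D (q z) by move=> zD; apply: mob_disc => //; apply: sqD; exact: mob_disc.
have qh z : D z -> holo q z.
  move=> zD; apply: (@holo_comp _ (fun z => mob b z ^+ 2) (mob (b ^+ 2))).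
    by apply: holoX; exact: mob_holo.
  by apply: mob_holo => //; apply: sqD; exact: mob_disc.
(* The cofactor in [q z = z * K z] in closed form, so that [K 0] is the derivative of [q] at 0. *)
pose K z := (1 - conjc b * b) * (b + mob b z) /
  ((1 - conjc b * z) * (1 - conjc (b ^+ 2) * mob b z ^+ 2)).
have den z : D z -> (1 - conjc b * z) * (1 - conjc (b ^+ 2) * mob b z ^+ 2) != 0.
  move=> zD; rewrite mulf_neq0//; apply: sub1_conj_neq0 => //.
  by apply: sqD; exact: mob_disc.
have qK z : D z -> q z = z * K z.
  move=> zD; have := den _ zD; rewrite mulf_eq0 negb_or => /andP[d1 d2].
  rewrite /q {1}/mob subr_sqr.
  have -> : b - mob b z = z * (1 - conjc b * b) / (1 - conjc b * z).
    by rewrite /mob; move: d1; move: (conjc b) => a' h1; field.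
  rewrite /K; move: d1 d2; set u := 1 - _ * z; set v := 1 - _ * _ ^+ 2.
  by move=> d1 d2; rewrite invfM !mulrA; congr (_ / v); rewrite mulrAC.
have cK : ccont K 0.
  have cm := holo_cont (mob_holo bD D0).
  have lin (c : CC R) : ccont (fun z => c - conjc b * z) 0.
    exact: (ccontB (ccont_cst _ _) (ccontM (ccont_cst _ _) (ccont_id _))).
  apply: (@ccont_div _ (fun z => (1 - conjc b * b) * (b + mob b z)) (fun z =>
    (1 - conjc b * z) * (1 - conjc (b ^+ 2) * mob b z ^+ 2))); first exact: den.
    exact: (ccontM (ccont_cst _ _) (ccontD (ccont_cst _ _) cm)).
  exact: (ccontM (lin 1) (ccontB (ccont_cst _ _) (ccontM (ccont_cst _ _) (ccontX 2 cm)))).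
have q0 : q 0 = 0 by rewrite qK// mul0r.
have ql : has_cderiv q 0 (K 0).
  apply: (near_eq_has_cderiv ltr01 _ (has_cderiv_mulid cK)) => w.
  by rewrite subr0 => wD; rewrite qK.
have K0 : cmod (K 0) = 2 * cmod b / (1 + cmod b ^+ 2).
  have bb : 0 < 1 - cmod b ^+ 2 by exact: sub_sqr_gt0.
  have m0 : mob b 0 = b by rewrite /mob subr0 mulr0 subr0 divr1.
  have E1 : 1 - conjc b * b = (1 - cmod b ^+ 2)%:C%C :> CC R.
    by rewrite rmorphB rmorph1/= cmod_sqrJ mulrC.
  have E2 : 1 - conjc (b ^+ 2) * b ^+ 2 = (1 - cmod b ^+ 4)%:C%C :> CC R.
    rewrite rmorphB rmorph1/= (exprM _ 2 2) [in RHS]rmorphXn/= cmod_sqrJ.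
    by rewrite rmorphXn/= exprMn mulrC.
  have b4 : 0 < 1 - cmod b ^+ 4 by rewrite (exprM _ 2 2); have := sqr_ge0 (cmod b); nra.
  rewrite /K m0 E1 E2 mulr0 subr0 mul1r cmod_div cmodM !cmod_real !gtr0_norm//.
  have -> : b + b = 2%:R * b by ring.
  rewrite cmodM cmod_nat.
  have b40 := gt_eqF b4; have b20 : 0 < 1 + cmod b ^+ 2 by have := sqr_ge0 (cmod b); lra.
  by field; rewrite gt_eqF//= gt_eqF.
exists [set z | D z /\ W (q z)], (fun z => h (q z)), (l * K 0); split.
- split; rewrite /= ?q0//.
  + by move=> z [].
  + move=> a [aD Wqa]; have [h1 h2] := hh _ Wqa; split=> //.
    exact: holo_comp (qh _ aD) h1.
  + move=> x r a rU [aD Wqa] har.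
    have [s sP sqa] := sec x r (q a) rU Wqa har.
    (* [mob (b ^+ 2) (s y)] has no zero since [s y] avoids [b ^+ 2]; the root with value [mob b a]
       at [h (q a)] gives the section through [a]. *)
    have [y|||k kP ka] := @holo_sqrt (fun y => mob (b ^+ 2) (s y)) x r (h (q a)) (mob b a).
    * move=> /sP[hs Ws _]; split.
        by apply: holo_comp hs _; apply: mob_holo => //; exact: WD.
      rewrite -cmod_gt0 cmod_mob pdist_gt0//; first exact: WD.
      by apply/eqP => e; apply: nWb; rewrite e.
    * by [].
    * by rewrite sqa /q mobK//; apply: sqD; exact: mob_disc.
    have kD y : cmod (y - x) < r -> D (k y).
      move=> yr; have [_ k2] := kP _ yr; have [_ /WD sD _] := sP _ yr.
      have := mob_disc b2D sD; rewrite -k2 /unit_disc/= cmodX => kk.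
      by have := cmod_ge0 (k y); nra.
    have qk y : cmod (y - x) < r -> q (mob b (k y)) = s y.
      move=> yr; rewrite /q mobK//; last exact: kD.
      have [_ ->] := kP _ yr; rewrite mobK//.
      by have [_ /WD] := sP _ yr.
    exists (fun y => mob b (k y)); last by rewrite ka mobK.
    move=> y yr; have [hs Ws hsy] := sP _ yr; have [hk _] := kP _ yr; split.
    * by apply: holo_comp hk _; apply: mob_holo => //; exact: kD.
    * by rewrite /= qk//; split=> //; apply: mob_disc => //; exact: kD.
    * by rewrite qk.
- by apply: has_cderiv_comp ql _; rewrite q0.
- by rewrite cmodM K0.
Qed.

End KoebeStep.

(** * Limits along ultrafilters and coverings from sections *)

Section Uniformization.
Variable R : realType.
Implicit Types (z w a b c l v : CC R) (r d M : R) (F G H g h p q s T : CC R -> CC R).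
Implicit Types (U W X Y : set (CC R)).

Local Notation D := (@unit_disc R).

(** Equicontinuity: the Cauchy estimates give one Lipschitz constant for the whole family, so the
    limit may be taken at moving points. *)
Lemma ultra_diagonal (T : Type) (FF : set_system T) {UF : UltraFilter FF}
    (f : T -> CC R -> CC R) (u : T -> CC R) w v r M : 0 < r ->
  (\forall t \near FF, forall z, cmod (z - w) < r -> holo (f t) z /\ cmod (f t z) <= M) ->
  u @ FF --> w -> (fun t => f t w) @ FF --> v -> (fun t => f t (u t)) @ FF --> v.
Proof.
move=> r0 hf /cmod_cvgP uw /cmod_cvgP fv; apply/cmod_cvgP => e e0.
have e20 : 0 < e / 2 by rewrite divr_gt0.
have M0 : 0 <= M.
  have [t /(_ w)] := filter_ex hf; rewrite subrr cmod0 => /(_ r0)[_].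
  exact/le_trans/cmod_ge0.
have C0 : 0 <= 4 * M / r by rewrite divr_ge0 ?(ltW r0)// mulr_ge0.
have d0 : 0 < Num.min (r / 2) (e / 2 / (4 * M / r + 1)).
  by rewrite lt_min !divr_gt0//; lra.
have h1 := uw _ d0; have h2 := fv _ e20.
apply: filterS3 hf h1 h2 => t hft; rewrite lt_min => /andP[/ltW ur ue] ft.
have [l [_ _ _ lip]] := cauchy_estimates r0 (fun w wr => proj1 (hft w wr)) (fun w wr => proj2 (hft w wr)).
have := lip _ ur; have := cmod_triang (f t (u t)) (f t w) v.
move: ue; rewrite ltr_pdivlMr; last by lra.
have := cmod_ge0 (u t - w); nra.
Qed.

Lemma ultra_dichotomy (T : Type) (FF : set_system T) {UF : UltraFilter FF} (P : T -> Prop) :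
  ~ (\forall t \near FF, P t) -> \forall t \near FF, ~ P t.
Proof. by move=> nP; have [] := in_ultra_setVsetC [set t | P t] UF. Qed.

Lemma cmod_cvg_unique (T : Type) (FF : set_system T) {PF : ProperFilter FF}
    (u : T -> CC R) a b : u @ FF --> a -> u @ FF --> b -> a = b.
Proof.
move=> /cmod_cvgP ua /cmod_cvgP ub.
apply/eqP; rewrite -subr_eq0 -cmod_eq0; apply/eqP/le_anti; rewrite cmod_ge0 andbT.
apply/ler_addgt0Pl => e e0; rewrite addr0.
have e20 : 0 < e / 2 by rewrite divr_gt0.
have [t [h1 h2]] := filter_ex (filterI (ua _ e20) (ub _ e20)).
by have := cmod_triang a (u t) b; rewrite (cmodBC a (u t)); lra.
Qed.

Lemma ccont_cvg (T : Type) (FF : set_system T) {PF : ProperFilter FF} F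
    (u : T -> CC R) a : ccont F a -> u @ FF --> a -> (fun t => F (u t)) @ FF --> F a.
Proof.
move=> /cmod_contP cF /cmod_cvgP ua; apply/cmod_cvgP => e /cF[d d0 dP].
by apply: filterS (ua _ d0) => t /dP.
Qed.

Lemma disc_dist_bounded (k : R) : k < 1 -> exists B, forall a b,
  cmod a <= k -> cmod b <= k -> disc_dist a b <= B.
Proof.
move=> k1; have [k0|k0] := leP 0 k; last first.
  by exists 0 => a b ak; have := cmod_ge0 a; lra.
(* In [pdist_sqr] the numerator is at least [(1 - k ^+ 2) ^+ 2] and the denominator at most 4. *)
pose r := Num.sqrt (1 - (1 - k ^+ 2) ^+ 2 / 4).
have kk : 0 < 1 - k ^+ 2 <= 1 by apply/andP; split; nra.
have rr : 0 < (1 - k ^+ 2) ^+ 2 / 4 <= 1 / 4 by apply/andP; split; nra.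
have r1 : r < 1.
  rewrite -(@ltr_pXn2r _ 2)// ?nnegrE ?sqrtr_ge0//; rewrite sqr_sqrtr; last by lra.
  by rewrite expr1n; lra.
exists (psi r) => a b ak bk.
have aD : D a by rewrite /unit_disc/=; lra.
have bD : D b by rewrite /unit_disc/=; lra.
rewrite disc_distE psi_mono ?pdist_ge0//.
rewrite -(@ler_pXn2r _ 2)// ?nnegrE ?sqrtr_ge0 ?pdist_ge0// sqr_sqrtr; last by lra.
have := pdist_sqr aD bD.
suff : (1 - k ^+ 2) ^+ 2 / 4 <= (1 - cmod a ^+ 2) * (1 - cmod b ^+ 2) / cmod (1 - conjc a * b) ^+ 2.
  by lra.
have n0 : 0 < cmod (1 - conjc a * b) by rewrite cmod_gt0 sub1_conj_neq0.
have a0 := cmod_ge0 a; have b0 := cmod_ge0 b.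
have n2 : cmod (1 - conjc a * b) <= 2.
  by apply: le_trans (cmodB _ _) _; rewrite cmod1 cmodM cmodJ; nra.
have ak2 : 1 - k ^+ 2 <= 1 - cmod a ^+ 2 by nra.
have bk2 : 1 - k ^+ 2 <= 1 - cmod b ^+ 2 by nra.
have n2' : cmod (1 - conjc a * b) ^+ 2 <= 4 by nra.
have n20 : 0 < cmod (1 - conjc a * b) ^+ 2 by rewrite exprn_gt0.
apply: ler_pM.
- by rewrite sqr_ge0.
- by rewrite invr_ge0.
- by rewrite expr2; apply: ler_pM; lra.
- by rewrite lef_pV2// posrE.
Qed.

(** A Harnack-type bound, from [schwarz_pick_defect] rescaled to the disc around [x]. As [N] does
    not depend on [s], a limit of sections keeps its values in the open disc. *)
Lemma section_bound (x : CC R) r (k e : R) : 0 < r -> k < 1 -> 0 < e -> exists2 N : R, N < 1 &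
  forall s y y0, (forall y, cmod (y - x) < r -> holo s y /\ cmod (s y) <= 1) ->
    cmod (y - x) <= k * r -> cmod (y0 - x) <= k * r -> cmod (s y0) <= 1 - e ->
    cmod (s y) <= N.
Proof.
move=> r0 k1 e0; have [B BP] := disc_dist_bounded k1.
exists (1 - e / expR B).
  by rewrite ltrBlDr ltrDl divr_gt0// expR_gt0.
move=> s y y0 hs yk y0k s0.
pose g z := s (x + r%:C%C * z).
have inball z : D z -> cmod (x + r%:C%C * z - x) < r.
  by rewrite /unit_disc/= addrC addKr cmodM cmod_real gtr0_norm// => zD; rewrite gtr_pMr.
have hg z : D z -> holo g z /\ cmod (g z) <= 1.
  move=> zD; have [h1 h2] := hs _ (inball _ zD); split=> //.
  have lin := holoD (holo_cst x z) (holoM (holo_cst r%:C%C z) (holo_id z)).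
  exact: (holo_comp lin h1).
pose nrm y := (y - x) / r%:C%C.
have rC : r%:C%C != 0 :> CC R by rewrite -cmod_gt0 cmod_real normr_gt0 gt_eqF.
have gn y1 : g (nrm y1) = s y1.
  by rewrite /g /nrm mulrC divfK// addrC subrK.
have nk y1 : cmod (y1 - x) <= k * r -> cmod (nrm y1) <= k.
  by move=> h; rewrite /nrm cmod_div cmod_real gtr0_norm// ler_pdivrMr.
have nD y1 : cmod (y1 - x) <= k * r -> D (nrm y1).
  by move=> /nk h; rewrite /unit_disc/=; lra.
have := schwarz_pick_defect hg (nD _ y0k) (nD _ yk); rewrite !gn => h.
have E0 := expR_gt0 B.
have : 1 - cmod (s y0) <= expR B * (1 - cmod (s y)).
  apply: le_trans h _; rewrite ler_wpM2r//.
    have := proj2 (hg _ (nD _ yk)); rewrite gn; lra.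
  by rewrite ler_expR BP// nk.
rewrite lerBrDr -lerBrDl ler_pdivrMr// mulrC; lra.
Qed.

Lemma section_not_constant s h y r : 0 < r ->
  (forall w, cmod (w - y) < r -> h (s w) = w) -> ~ locally_constant s y.
Proof.
move=> r0 hs [e e0 eP]; pose t := Num.min e r / 2.
have t0 : 0 < Num.min e r by rewrite lt_min e0.
have := le_refl (Num.min e r); rewrite {2}/Num.min -/(Num.min e r) le_min => /andP[te tr].
have yt : cmod (y + t%:C%C - y) = t by rewrite addrC addKr cmod_real gtr0_norm// /t; lra.
have E := eP (y + t%:C%C) ltac:(rewrite yt /t; lra).
have := congr1 h E; rewrite !hs; [|by rewrite subrr cmod0|by rewrite yt /t; lra].
by move=> /eqP; rewrite -subr_eq0 -cmod_eq0 yt /t => /eqP; lra.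
Qed.

(** The points of agreement form an open set by the open mapping theorem: near such a point [s' w]
    is a value [s t], and applying [h] gives [t = w]. *)
Lemma ball_connected_eq (x : CC R) r s s' h y0 :
  (forall y, cmod (y - x) < r -> holo s y /\ h (s y) = y) ->
  (forall y, cmod (y - x) < r -> holo s' y /\ h (s' y) = y) ->
  cmod (y0 - x) < r -> s y0 = s' y0 -> forall y, cmod (y - x) < r -> s y = s' y.
Proof.
move=> hs hs' y0r sy0.
have cB : connected [set y : CC R | cmod (y - x) < r].
  by apply: cconvex_connected; exact: cconvex_disc.
apply: (connected_clopen_ind (P := [set y | s y = s' y]) cB y0r) => //=.
- move=> y yr sy.
  have hn : holo_near s y.
    by apply: (@holo_disc_near _ s x r y) => // w /hs[].
  have r'0 : 0 < r - cmod (y - x) by rewrite subr_gt0.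
  have nc : ~ locally_constant s y.
    apply: (@section_not_constant s h y _ r'0) => w wy; apply: (proj2 (hs _ _)).
    by have := cmod_triang w y x; lra.
  have [d d0 dP] := open_mapping hn nc r'0.
  have /cmod_contP/(_ _ d0)[d' d'0 d'P] := holo_cont (proj1 (hs' _ yr)).
  exists d' => // w wr wd.
  have := d'P _ wd; rewrite -sy => /dP[t ty st].
  have tr : cmod (t - x) < r by have := cmod_triang t y x; lra.
  have := congr1 h st; rewrite (proj2 (hs _ tr)) (proj2 (hs' _ wr)) => tw.
  by rewrite -st tw.
- move=> y yr cl; apply/eqP; rewrite -subr_eq0 -cmod_eq0; apply/eqP/le_anti.
  rewrite cmod_ge0 andbT; apply/ler_addgt0Pl => e e0; rewrite addr0.
  have e20 : 0 < e / 2 by rewrite divr_gt0.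
  have /cmod_contP/(_ _ e20)[d1 d10 d1P] := holo_cont (proj1 (hs _ yr)).
  have /cmod_contP/(_ _ e20)[d2 d20 d2P] := holo_cont (proj1 (hs' _ yr)).
  have [|w [wr wy sw]] := cl (Num.min d1 d2); first by rewrite lt_min d10.
  move: wy; rewrite lt_min => /andP[/d1P h1 /d2P h2].
  have := cmod_triang (s y) (s w) (s' y).
  by rewrite (cmodBC (s y) (s w)) sw in h1 *; lra.
Qed.

Lemma section_open (x : CC R) r s h : (forall y, cmod (y - x) < r -> holo s y /\ h (s y) = y) ->
  open (s @` [set y | cmod (y - x) < r]).
Proof.
move=> hs; apply/cmod_openP => _ [y yr <-]; rewrite /= in yr.
have hn : holo_near s y.
  by apply: (@holo_disc_near _ s x r y) => // w /hs[].
have r'0 : 0 < r - cmod (y - x) by rewrite subr_gt0.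
have nc : ~ locally_constant s y.
  apply: (@section_not_constant s h y _ r'0) => w wy; apply: (proj2 (hs _ _)).
  by have := cmod_triang w y x; lra.
have [d d0 dP] := open_mapping hn nc r'0.
exists d => // c /dP[w wy sw]; exists w => //=.
by have := cmod_triang w y x; lra.
Qed.

(** The sheets over a disc in [U] are the images of its sections, which coincide as soon as they
    meet. Surjectivity holds because the image is open and closed in the connected set [U]. *)
Lemma disc_sections_covering U h a0 : open U -> connected U -> D a0 ->
  (forall a, D a -> holo h a /\ U (h a)) -> disc_sections U D h -> disc_covering U h.
Proof.
move=> oU cU a0D hh sec; split.
- by move=> a /hh[/holoE].
- apply/seteqP; split=> [_ [a aD <-]|]; first by have [] := hh _ aD.
  apply: (connected_clopen_ind (P := h @` D) cU (proj2 (hh _ a0D))); first by exists a0.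
    move=> x Ux [a aD ax]; rewrite -{x}ax in Ux *.
    have [r r0 rU] := proj1 (cmod_openP _) oU _ (proj2 (hh _ aD)).
    exists r => // w _ wr.
    have [|s sP _] := sec (h a) r a rU aD; first by rewrite subrr cmod0.
    by exists (s w); have [] := sP _ wr.
  move=> x Ux cl; have [r r0 rU] := proj1 (cmod_openP _) oU _ Ux.
  have [y [_ yx [a aD ay]]] := cl _ r0.
  have har : cmod (h a - x) < r by rewrite ay.
  have [s sP _] := sec x r a rU aD har.
  have xx : cmod (x - x) < r by rewrite subrr cmod0.
  by exists (s x); have [] := sP _ xx.
- move=> x Ux; have [r r0 rU] := proj1 (cmod_openP _) oU _ Ux.
  pose V := [set y : CC R | cmod (y - x) < r].
  have exs a : exists s : CC R -> CC R, D a -> V (h a) ->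
      (forall y, V y -> [/\ holo s y, D (s y) & h (s y) = y]) /\ s (h a) = a.
    have [aD|] := pselect (D a); last by move=> na; exists id => /na.
    have [Va|] := pselect (V (h a)); last by move=> nV; exists id => _ /nV.
    by have [s sP sa] := sec x r a rU aD Va; exists s.
  have [s sP] := choice exs.
  pose W : set (set (CC R)) := [set A | exists a, [/\ D a, V (h a) & A = s a @` V]].
  exists V, W; split.
  + by split; [exact: cdisc_open|rewrite /V/= subrr cmod0].
  + by [].
  + apply/seteqP; split=> [e [A [a [aD Va ->]] [y Vy <-]]|e [eD Ve]].
      have [h1 _] := sP a aD Va; have [_ h2 h3] := h1 _ Vy.
      by split=> //=; rewrite h3.
    exists (s e @` V); first by exists e.
    by exists (h e) => //; have [_] := sP e eD Ve.
  + move=> A B [a [aD Va ->]] [b [bD Vb ->]] [_ [[y Vy <-] [y' Vy' E]]].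
    have [ha _] := sP a aD Va; have [hb _] := sP b bD Vb.
    have yy : y' = y.
      have := congr1 h E; have [_ _ ->] := ha _ Vy.
      by have [_ _ ->] := hb _ Vy'.
    rewrite yy in E.
    have eqs : forall y, cmod (y - x) < r -> s a y = s b y.
      apply: (@ball_connected_eq x r (s a) (s b) h y) => //.
      * by move=> w /ha[].
      * by move=> w /hb[].
    by apply/seteqP; split=> _ [w Vw <-]; exists w => //; rewrite eqs.
  + move=> _ [a [aD Va ->]]; have [ha sa] := sP a aD Va; split.
      by apply: (@section_open x r (s a) h) => y /ha[].
    exists (s a); split.
    * rewrite continuous_open_subspace; last exact: cdisc_open.
      move=> y; rewrite inE => /ha[hs _ _].
      by have /ccontE := holo_cont hs.
    * by move=> y Vy; split; [exists y|have [] := ha _ Vy].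
    * move=> _ [y Vy <-]; have [_ _ ->] := ha _ Vy; by [].
Qed.

End Uniformization.

(** * Koebe's extremal sequence and its limit *)

Section Koebe.
Variable R : realType.
Implicit Types (z w a b l v y x : CC R) (r d M k e : R) (F G H g p q s T : CC R -> CC R).
Implicit Types (W X Y : set (CC R)).

Local Notation D := (@unit_disc R).

Variables (U : set (CC R)) (c z0 : CC R) (rho : R).
Hypotheses (rho0 : 0 < rho) (U_far : forall y, U y -> rho <= cmod (y - c)).
Hypotheses (oU : open U) (cU : connected U) (Uz0 : U z0).

(** On [U] the inverse of [y - c] has modulus at most [rho^-1], so this factor brings the normalized
    inversion [phi] into the disc of radius [1 / 2]. *)
Let kap : CC R := (rho / 4)%:C%C.

Let phi y : CC R := kap * ((y - c)^-1 - (z0 - c)^-1).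

Let phiV v : CC R := c + (v / kap + (z0 - c)^-1)^-1.

Lemma kap_neq0 : kap != 0.
Proof. by rewrite /kap -cmod_gt0 cmod_real normr_gt0 gt_eqF// divr_gt0. Qed.

Lemma U_neq y : U y -> y - c != 0.
Proof. by move=> /U_far h; rewrite -cmod_gt0; apply: lt_le_trans h. Qed.

Lemma phi_arg y : phi y / kap + (z0 - c)^-1 = (y - c)^-1.
Proof. by rewrite /phi mulrC mulKf ?kap_neq0// subrK. Qed.

Lemma phiK y : phiV (phi y) = y.
Proof. by rewrite /phiV phi_arg invrK addrC subrK. Qed.

Lemma phi0 : phi z0 = 0.
Proof. by rewrite /phi subrr mulr0. Qed.

Lemma phi_bound y : U y -> cmod (phi y) <= 1 / 2.
Proof.
move=> Uy; rewrite /phi cmodM /kap cmod_real gtr0_norm ?divr_gt0//.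
have h u : U u -> cmod (u - c)^-1 <= rho^-1.
  move=> Uu; rewrite cmodV lef_pV2 ?posrE// ?U_far//.
  by apply: lt_le_trans (U_far Uu).
have b : cmod ((y - c)^-1 - (z0 - c)^-1) <= 2 / rho.
  by apply: le_trans (cmodB _ _) _; have := h _ Uy; have := h _ Uz0; lra.
have r4 : 0 <= rho / 4 by rewrite divr_ge0// ltW.
apply: le_trans (ler_wpM2l r4 b) _.
by rewrite le_eqVlt; apply/orP; left; apply/eqP; field; rewrite gt_eqF.
Qed.

Lemma phi_disc y : U y -> D (phi y).
Proof. by move=> /phi_bound h; rewrite /unit_disc/=; lra. Qed.

Lemma phi_holo y : U y -> holo phi y.
Proof.
move=> Uy; have lin := holoB (holo_id y) (holo_cst c y).
have inv := holoV (f := fun y => y - c) (U_neq Uy) lin.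
exact: (holoM (holo_cst kap y) (holoB inv (holo_cst ((z0 - c)^-1) y))).
Qed.

Lemma phiV_holo v : v / kap + (z0 - c)^-1 != 0 -> holo phiV v.
Proof.
move=> v0; have lin := holoD (holoM (holo_id v) (holo_cst kap^-1 v)) (holo_cst (z0 - c)^-1 v).
have inv := holoV (f := fun v => v / kap + (z0 - c)^-1) v0 lin.
exact: (holoD (holo_cst c v) inv).
Qed.

Lemma phiV_phi_holo y : U y -> holo phiV (phi y).
Proof. by move=> Uy; apply: phiV_holo; rewrite phi_arg invr_neq0// U_neq. Qed.

Lemma koebe_initial : koebe_map U z0 (phi @` U) phiV.
Proof.
split.
- by exists z0 => //; exact: phi0.
- by move=> _ [y Uy <-]; exact: phi_disc.
- by rewrite -phi0 phiK.
- by move=> _ [y Uy <-]; rewrite phiK; split=> //; exact: phiV_phi_holo.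
- move=> x r _ rU [y Uy <-] _; exists phi; last by rewrite phiK.
  move=> u /rU Uu; split; [exact: phi_holo|by exists u|exact: phiK].
Qed.

(* Among all such maps choose a sequence minimizing [|h'(0)|]; by Koebe's trick
   the omitted points tend to the unit circle. *)
Lemma koebe_exhaustion : exists (W : nat -> set (CC R)) (h : nat -> CC R -> CC R),
  (forall n, koebe_map U z0 (W n) (h n)) /\
  forall k, k < 1 -> \forall n \near \oo, forall a, cmod a <= k -> W n a.
Proof.
pose A : set R := [set t | exists W h l,
  [/\ koebe_map U z0 W h, has_cderiv h 0 l & t = cmod l]].
have [r r0 rU] := proj1 (cmod_openP _) oU _ Uz0.
have Alow t : A t -> r / 4 <= t.
  by move=> [W [h [l [kW hl ->]]]]; exact: koebe_derivative_lower r0 rU kW hl.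
have kdiff W h : koebe_map U z0 W h -> exists l, has_cderiv h 0 l.
  by move=> [W0 _ _ hh _]; have [/holoP] := hh _ W0.
have [t0 At0] : exists t, A t.
  have [l hl] := kdiff _ _ koebe_initial.
  by exists (cmod l), (phi @` U), phiV, l; split=> //; exact: koebe_initial.
pose m := inf A.
have lbA : has_lbound A by exists (r / 4).
have m0 : 0 < m.
  apply: (@lt_le_trans _ _ (r / 4)); first by rewrite divr_gt0.
  by apply: lb_le_inf; [exists t0|].
have ex n : exists Wh : set (CC R) * (CC R -> CC R), koebe_map U z0 Wh.1 Wh.2 /\
    exists2 l, has_cderiv Wh.2 0 l & cmod l < m * (1 + n.+1%:R^-1).
  have [||t [W [h [l [kW hl ->]]]] tm] := @inf_lt R A (m * (1 + n.+1%:R^-1)).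
  - by exists t0.
  - by rewrite -/m ltr_pMr// ltrDl invr_gt0 ltr0n.
  by exists (W, h); split=> //=; exists l.
have [Wh WhP] := choice ex.
exists (fun n => (Wh n).1), (fun n => (Wh n).2); split=> [n|k k1].
  by have [] := WhP n.
(* A bound for the modulus of a root [b] of any [a] with [cmod a <= k]; the maximum covers negative
   [k]. *)
pose b0 := Num.sqrt (Num.max 0 k).
have b00 : 0 <= b0 by exact: sqrtr_ge0.
have b01 : b0 < 1.
  rewrite -(@ltr_pXn2r _ 2)// ?nnegrE// sqr_sqrtr ?le_max ?lexx//.
  by rewrite expr1n gt_max ltr01.
(* With [t = cmod b] at most [b0 < 1], the factor of [koebe_step] falls short of 1 by
   [(1 - t) ^+ 2 / (1 + t ^+ 2)], at least [del]. Once [n.+1%:R^-1 < del], the step would push the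
   derivative below the infimum [m]. *)
pose del := (1 - b0) ^+ 2 / 2.
have del0 : 0 < del by rewrite divr_gt0// exprn_gt0// subr_gt0.
have : \forall n \near \oo, n.+1%:R^-1 < del.
  have := @cvg_harmonic R; move=> /cvgr_lt/(_ _ del0); apply: filterS => n.
  by [].
apply: filterS => n nd a ak.
apply: contrapT => nWa.
have [kW [l hl lm]] := WhP n.
pose b : CC R := sqrtc a; have b2 : b ^+ 2 = a by exact: sqr_sqrtc.
have cb : cmod b ^+ 2 = cmod a by rewrite -cmodX b2.
have bb0 : cmod b <= b0.
  rewrite -(@ler_pXn2r _ 2)// ?nnegrE ?cmod_ge0// sqr_sqrtr ?le_max ?lexx// cb.
  by rewrite ak orbT.
have bD : D b by rewrite /unit_disc/=; lra.
have [W' [h' [l' [kW' hl' El]]]] := koebe_step kW hl bD ltac:(by rewrite b2).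
have : m <= cmod l'.
  by apply: ge_inf => //; exists W', h', l'.
rewrite El; have cb0 := cmod_ge0 b.
move: nd; set i := n.+1%:R^-1 in lm * => nd.
have i0 : 0 < i by rewrite invr_gt0 ltr0n.
have k1' : 2 * cmod b / (1 + cmod b ^+ 2) <= 1 - del.
  have p0 : 0 < 1 + cmod b ^+ 2 by have := sqr_ge0 (cmod b); lra.
  rewrite ler_pdivrMr// /del.
  have h1 : (1 - b0) ^+ 2 <= (1 - cmod b) ^+ 2 by nra.
  have h2 : 1 + cmod b ^+ 2 <= 2 by nra.
  have h3 : (1 - b0) ^+ 2 / 2 * (1 + cmod b ^+ 2) <= (1 - b0) ^+ 2.
    by have := sqr_ge0 (1 - b0); nra.
  nra.
have k0' : 0 <= 2 * cmod b / (1 + cmod b ^+ 2).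
  by rewrite divr_ge0 ?mulr_ge0// addr_ge0 ?sqr_ge0.
apply/negP; rewrite -ltNge.
apply: (@le_lt_trans _ _ (cmod l * (1 - del))); first by rewrite ler_wpM2l ?cmod_ge0.
have del1 : 0 <= 1 - del by rewrite /del; nra.
apply: (@le_lt_trans _ _ (m * (1 + i) * (1 - del))); first by rewrite ler_wpM2r// ltW.
rewrite -mulrA gtr_pMr//; nra.
Qed.

Section Limit.
Variables (W : nat -> set (CC R)) (h : nat -> CC R -> CC R).
Hypothesis kW : forall n, koebe_map U z0 (W n) (h n).
Variables (FF : set_system nat) (UF : UltraFilter FF).
Hypothesis FW : forall k, k < 1 -> \forall n \near FF, forall a, cmod a <= k -> W n a.

(** [U] may be unbounded, so limits are taken of these bounded functions and transported back by
    [phiV]. *)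
Let f n a := phi (h n a).

Lemma koebe_limit_bound a r : cmod a + r < 1 ->
  \forall n \near FF, forall w, cmod (w - a) < r -> holo (f n) w /\ cmod (f n w) <= 1.
Proof.
move=> ar; apply: filterS (FW ar) => n Wn w wa.
have [_ _ _ hh _] := kW n.
have /hh[h1 h2] : W n w by apply: Wn; have := cmod_triang w a 0; rewrite !subr0; lra.
split; first exact: (holo_comp h1 (phi_holo h2)).
by apply: le_trans (phi_bound h2) _; lra.
Qed.

Lemma koebe_limit_ex : exists H : CC R -> CC R, forall a, D a -> (fun n => f n a) @ FF --> H a.
Proof.
have ex a : exists v, D a -> (fun n => f n a) @ FF --> v.
  have [aD|] := pselect (D a); last by move=> na; exists 0 => /na[].
  have r0 : 0 < (1 - cmod a) / 2 by rewrite divr_gt0// subr_gt0.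
  have ar : cmod a + (1 - cmod a) / 2 < 1 by have aD' : cmod a < 1 by []; lra.
  have [|v _ fv] := @ultra_bounded_cvg R nat FF UF (fun n => f n a) 1.
    apply: filterS (koebe_limit_bound ar) => n /(_ a); rewrite subrr cmod0.
    by move=> /(_ r0)[].
  by exists v.
by have [H HP] := choice ex; exists H.
Qed.

Variable H : CC R -> CC R.
Hypothesis fH : forall a, D a -> (fun n => f n a) @ FF --> H a.

Let rad a := (1 - cmod a) / 2.

Lemma rad_gt0 a : D a -> 0 < rad a.
Proof. by move=> aD; rewrite divr_gt0// subr_gt0. Qed.

Lemma rad_lt a : D a -> cmod a + rad a < 1.
Proof. by move=> aD; have aD' : cmod a < 1 by []; rewrite /rad; lra. Qed.

Lemma rad_disc a w : D a -> cmod (w - a) < rad a -> D w.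
Proof.
move=> aD wa; rewrite /unit_disc/=; have := rad_lt aD.
by have := cmod_triang w a 0; rewrite !subr0; lra.
Qed.

Lemma koebe_limit_holo a : D a -> holo H a.
Proof.
move=> aD; apply: (@limit_holo R nat FF UF f H a (rad a) 1 (rad_gt0 aD)).
  exact: (koebe_limit_bound (rad_lt aD)).
by move=> w /(rad_disc aD)/fH.
Qed.

Lemma koebe_limit_diagonal (u : nat -> CC R) w : D w -> u @ FF --> w ->
  (fun n => f n (u n)) @ FF --> H w.
Proof.
move=> wD uw; apply: (@ultra_diagonal R nat FF UF f u w (H w) (rad w) 1 (rad_gt0 wD) _ uw (fH wD)).
exact: (koebe_limit_bound (rad_lt wD)).
Qed.

Lemma koebe_limit0 : H 0 = 0.
Proof.
have D0 : D 0 by rewrite /unit_disc/= cmod0.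
apply: (@cmod_cvg_unique R nat FF _ (fun n => f n 0)); first exact: fH.
apply/cmod_cvgP => e e0; apply: nearW => n.
by rewrite /f; have [_ _ -> _ _] := kW n; rewrite phi0 subrr cmod0.
Qed.

(** A point [y1] at distance [r / 8] from [z0] has preimages of modulus at most
    [4 / r * (r / 8) = 1 / 2] under all [h n]. They converge inside the disc, and there [H] takes
    the value [phi y1], which is not [phi z0 = 0]. *)
Lemma koebe_limit_nonconstant : exists2 b, D b & H b != 0.
Proof.
have [r r0 rU] := proj1 (cmod_openP _) oU _ Uz0.
pose y1 : CC R := z0 + (r / 8)%:C%C.
have y1z : cmod (y1 - z0) = r / 8.
  by rewrite /y1 addrC addKr cmod_real gtr0_norm// divr_gt0.
have ex n : exists b, [/\ cmod b <= 1 / 2, W n b & h n b = y1].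
  have [W0 WD h0 hh sec] := kW n.
  have [|s sP s0] := sec z0 r 0 rU W0; first by rewrite h0 subrr cmod0.
  rewrite h0 in s0.
  have [||l [_ _ _ lip]] := @cauchy_estimates R s z0 r 1 r0.
  - by move=> w /sP[].
  - by move=> w /sP[_ /WD/ltW].
  exists (s y1); have [|_ h1 h2] := sP y1; first by rewrite y1z; lra.
  split=> //; have := lip y1 ltac:(rewrite y1z; lra).
  rewrite s0 subr0 y1z => h3; apply: le_trans h3 _.
  by rewrite le_eqVlt; apply/orP; left; apply/eqP; field; rewrite gt_eqF.
have [b bP] := choice ex.
have [|b0 b0P bb0] := @ultra_bounded_cvg R nat FF UF b (1 / 2).
  by apply: nearW => n; have [] := bP n.
have b0D : D b0 by rewrite /unit_disc/=; lra.
exists b0 => //.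
have -> : H b0 = phi y1.
  apply: (@cmod_cvg_unique R nat FF _ (fun n => f n (b n))).
    exact: koebe_limit_diagonal.
  apply/cmod_cvgP => e e0; apply: nearW => n.
  by rewrite /f; have [_ _ ->] := bP n; rewrite subrr cmod0.
apply/eqP => p0; have := phiK y1; rewrite p0 -phi0 phiK => /eqP.
by rewrite eq_sym -subr_eq0 -cmod_eq0 y1z => /eqP; lra.
Qed.

(* Hurwitz: a value omitted by every [f n] is omitted by the limit. *)
Lemma koebe_limit_image a : D a -> exists2 y, U y & H a = phi y.
Proof.
move=> aD; apply: contrapT => no.
have D0 : D 0 by rewrite /unit_disc/= cmod0.
have cD : connected D.
  have := cconvex_connected (@cconvex_disc R 0 1); congr connected.
  by apply/seteqP; split=> w /=; rewrite subr0.
have nc : ~ locally_constant H a.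
  move=> lc; have [b bD /eqP Hb] := koebe_limit_nonconstant.
  have all := identity_theorem (@unit_disc_open R) cD koebe_limit_holo aD lc.
  by apply: Hb; rewrite (all _ bD) -(all _ D0) koebe_limit0.
have hn : holo_near H a.
  by exists (rad a); [exact: rad_gt0|move=> w /(rad_disc aD)/koebe_limit_holo].
have [r r0 isol] := isolated_value hn nc.
pose q := Num.min r (rad a) / 2.
have m0 : 0 < Num.min r (rad a) by rewrite lt_min r0 rad_gt0.
have := le_refl (Num.min r (rad a)); rewrite {2}/Num.min -/(Num.min r (rad a)).
rewrite le_min => /andP[mr ma].
have [d d0 dP] := isol q ltac:(rewrite /q; lra).
have d20 : 0 < d / 2 by rewrite divr_gt0.
have q0 : 0 <= q by rewrite /q; lra.
have qa : q < rad a by rewrite /q; lra.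
(* Otherwise bad points [u n] on the circle exist along the ultrafilter, since the complement of a
   set outside an ultrafilter belongs to it. They converge to a point of the circle where
   [H w - H a] has modulus at most [d / 2]. *)
have circ : \forall n \near FF, forall w, cmod (w - a) = q -> d / 2 <= cmod (f n w - H a).
  apply: contrapT => /ultra_dichotomy nP.
  have ex n : exists w, ~ (forall w, cmod (w - a) = q -> d / 2 <= cmod (f n w - H a)) ->
      cmod (w - a) = q /\ cmod (f n w - H a) < d / 2.
    have [|nn] := pselect (forall w, cmod (w - a) = q -> d / 2 <= cmod (f n w - H a)).
      by move=> h0; exists 0 => /(_ h0).
    move/existsNP: (nn) => [w /not_implyP[h1 h2]]; exists w => _; split=> //.
    by rewrite ltNge; apply/negP.
  have [u uP] := choice ex.
  have nu : \forall n \near FF, cmod (u n - a) = q /\ cmod (f n (u n) - H a) < d / 2.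
    by apply: filterS nP => n; exact: uP.
  have [|w _ uw] := @ultra_bounded_cvg R nat FF UF u (cmod a + q).
    apply: filterS nu => n [un _]; have := cmod_triang (u n) a 0.
    by rewrite !subr0 un addrC.
  have wq : cmod (w - a) = q.
    have c1 : (fun n => cmod (u n - a) : R) @ FF --> cmod (w - a).
      exact: cvg_cmodP (ccont_cvg (ccontB (ccont_id w) (ccont_cst a w)) uw).
    have c2 : (fun n => cmod (u n - a) : R) @ FF --> q.
      apply/cvgrPdist_lt => e e0; apply: filterS nu => n [-> _].
      by rewrite subrr normr0.
    exact: cvg_unique c1 c2.
  have wD : D w by apply: (rad_disc aD); rewrite wq.
  have lim := koebe_limit_diagonal wD uw.
  have := dP _ wq; apply/negP; rewrite -ltNge.
  have : cmod (H w - H a) <= d / 2.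
    apply: (@cmod_lim_le R nat FF _ (fun n => f n (u n) - H a)).
      by apply: (ccont_cvg (F := fun v => v - H a)) lim; exact: (ccontB (ccont_id _) (ccont_cst _ _)).
    by apply: filterS nu => n [_ /ltW].
  lra.
have /cmod_cvgP/(_ _ d20) center := fH aD.
have near := koebe_limit_bound (rad_lt aD).
have nW := FW (rad_lt aD).
have [n [[h1 h2] [h3 h4]]] := filter_ex (filterI (filterI circ center) (filterI near nW)).
have [w|w wa fw] := @hurwitz_zero R (fun w => f n w - H a) a q (d / 2) d20 _ h1 q0 h2.
  move=> wq; apply: (@holoB R (f n) (fun=> H a)); last exact: holo_cst.
  by apply: (proj1 (h3 _ _)); lra.
have Ww : W n w by apply: h4; have := cmod_triang w a 0; rewrite !subr0; lra.
have [_ _ _ hh _] := kW n; have [_ Uh] := hh _ Ww.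
by apply: no; exists (h n w) => //; apply/eqP; rewrite eq_sym -subr_eq0 -/(f n w) fw.
Qed.

(** The sections of the [h n] over the given disc converge along [FF] to a section of the limit;
    [section_bound] keeps its values off the unit circle, and [ultra_diagonal] shows that it passes
    through [a]. *)
Lemma koebe_limit_sections : disc_sections U D (fun a => phiV (H a)).
Proof.
move=> x r a rU aD har.
have [ya Uya Hya] := koebe_limit_image aD.
have yaE : phiV (H a) = ya by rewrite Hya phiK.
rewrite yaE in har *.
have r0 : 0 < r by exact: le_lt_trans (cmod_ge0 _) har.
have hna : (fun n => h n a) @ FF --> ya.
  rewrite -yaE; have := ccont_cvg (holo_cont (phiV_phi_holo Uya)).
  rewrite -Hya => /(_ _ _ _ _ (fH aD)); apply: cvg_trans; apply: near_eq_cvg.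
  by apply: nearW => n; rewrite /f phiK.
have nWa : \forall n \near FF, W n a.
  by apply: filterS (FW (k := cmod a) aD) => n; apply.
have exs n : exists s : CC R -> CC R, W n a -> cmod (h n a - x) < r ->
    (forall y, cmod (y - x) < r -> [/\ holo s y, W n (s y) & h n (s y) = y]) /\ s (h n a) = a.
  have [Wa|] := pselect (W n a); last by move=> nw; exists id => /nw[].
  have [hr|] := pselect (cmod (h n a - x) < r); last by move=> nw; exists id => _ /nw[].
  have [_ _ _ _ sec] := kW n.
  by have [s h1 h2] := sec x r a rU Wa hr; exists s.
have [s sP] := choice exs.
have nr : \forall n \near FF, cmod (h n a - ya) < r - cmod (ya - x).
  by move/cmod_cvgP: hna; apply; rewrite subr_gt0.
have ns : \forall n \near FF,
    (forall y, cmod (y - x) < r -> [/\ holo (s n) y, W n (s n y) & h n (s n y) = y]) /\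
    s n (h n a) = a.
  apply: filterS2 nWa nr => n Wa hr; apply: sP => //.
  by have := cmod_triang (h n a) ya x; lra.
have nsb y0 r1 : cmod (y0 - x) + r1 <= r -> \forall n \near FF, forall y, cmod (y - y0) < r1 ->
    holo (s n) y /\ cmod (s n y) <= 1.
  move=> hr1; apply: filterS ns => n [h1 _] y yr.
  have [|h2 h3 _] := h1 y; first by have := cmod_triang y y0 x; lra.
  by split=> //; have [_ WD _ _ _] := kW n; apply/ltW/WD.
have ex y : exists v, cmod (y - x) < r -> (fun n => s n y) @ FF --> v.
  have [yr|] := pselect (cmod (y - x) < r); last by move=> nw; exists 0 => /nw[].
  have [|v _ sv] := @ultra_bounded_cvg R nat FF UF (fun n => s n y) 1.
    have hr1 : cmod (y - x) + (r - cmod (y - x)) <= r by rewrite addrC subrK.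
    apply: filterS (nsb y _ hr1) => n /(_ y).
    by rewrite subrr cmod0 subr_gt0 => /(_ yr)[].
  by exists v.
have [S SP] := choice ex.
have Sholo y : cmod (y - x) < r -> holo S y.
  move=> yr; have r10 : 0 < r - cmod (y - x) by rewrite subr_gt0.
  apply: (@limit_holo R nat FF UF s S y (r - cmod (y - x)) 1 r10).
    by apply: nsb; lra.
  by move=> w wy; apply: SP; have := cmod_triang w y x; lra.
have SD y : cmod (y - x) < r -> D (S y).
  (* The concentric disc of radius [(m + r) / 2] contains [y] and, along [FF], also [h n a], where
     the section has the value [a]; this is the reference point for [section_bound]. *)
  move=> yr; pose m := Num.max (cmod (y - x)) (cmod (ya - x)).
  have mr : m < r by rewrite gt_max yr.
  pose k := (m + r) / 2 / r.
  have k1 : k < 1 by rewrite /k ltr_pdivrMr// mul1r; lra.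
  have kr : k * r = (m + r) / 2 by rewrite /k divfK// gt_eqF.
  have [N N1 NP] := section_bound x r0 k1 (rad_gt0 aD).
  apply: (@le_lt_trans _ _ N) N1; apply: (@cmod_lim_le R nat FF _ (fun n => s n y)).
    exact: SP.
  have nr2 : \forall n \near FF, cmod (h n a - ya) < (r - m) / 2.
    by move/cmod_cvgP: hna; apply; rewrite divr_gt0// subr_gt0.
  have nsb' := nsb x r ltac:(by rewrite subrr cmod0 add0r).
  apply: filterS3 ns nr2 nsb' => n [_ sa] hr2 hsb.
  have ym : cmod (y - x) <= m by rewrite le_max lexx.
  have yam : cmod (ya - x) <= m by rewrite le_max lexx orbT.
  apply: (NP (s n) y (h n a)) => //; rewrite ?kr.
  - lra.
  - by have := cmod_triang (h n a) ya x; lra.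
  - rewrite sa /rad; have aD' : cmod a < 1 by []; lra.
have HS y : cmod (y - x) < r -> H (S y) = phi y.
  move=> yr; apply: (@cmod_cvg_unique R nat FF _ (fun n => f n (s n y))).
    by apply: koebe_limit_diagonal; [exact: SD|exact: SP].
  apply/cmod_cvgP => e e0; apply: filterS ns => n [/(_ y yr)[_ _ hs] _].
  by rewrite /f hs subrr cmod0.
exists S.
  by move=> y yr; split; [exact: Sholo|exact: SD|rewrite HS// phiK].
have r10 : 0 < r - cmod (ya - x) by rewrite subr_gt0.
apply: (@cmod_cvg_unique R nat FF _ (fun n => s n (h n a))).
  apply: (@ultra_diagonal R nat FF UF s (fun n => h n a) ya (S ya) (r - cmod (ya - x)) 1 r10 _ hna (SP _ har)).
  by apply: nsb; lra.
by apply/cmod_cvgP => e e0; apply: filterS ns => n [_ ->]; rewrite subrr cmod0.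
Qed.

Lemma koebe_limit_covering : disc_covering U (fun a => phiV (H a)).
Proof.
have D0 : D 0 by rewrite /unit_disc/= cmod0.
apply: (disc_sections_covering oU cU D0); last exact: koebe_limit_sections.
move=> a aD; have [y Uy Hy] := koebe_limit_image aD; rewrite Hy phiK; split=> //.
by apply: holo_comp; [exact: koebe_limit_holo|rewrite Hy; exact: phiV_phi_holo].
Qed.

End Limit.

Lemma uniformization : exists p, disc_covering U p.
Proof.
have [W [h [kW kexh]]] := koebe_exhaustion.
have [FF [UF FFoo]] := ultraFilterLemma (eventually_filter : ProperFilter \oo).
have FW k : k < 1 -> \forall n \near FF, forall a, cmod a <= k -> W n a.
  by move=> /kexh; exact: FFoo.
have [H fH] := koebe_limit_ex kW UF FW.
by exists (fun a => phiV (H a)); exact (koebe_limit_covering kW UF FW fH).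
Qed.

End Koebe.

(** * Fatou components *)

Section Fatou.
Variables (R : realType) (f : CC R -> Chat R).
Implicit Types (z w y x : CC R) (r : R) (A B U V X Y : set (CC R)).

Local Notation D := (@unit_disc R).

Lemma connected_component_open A z : open A -> open (connected_component A z).
Proof.
move=> /cmod_openP oA; apply/cmod_openP => y zy.
have [r r0 rA] := oA _ (connected_component_sub zy).
exists r => // w wy; rewrite (same_connected_component zy).
apply: (@connected_component_max _ A [set w | cmod (w - y) < r] y) => //=.
  by rewrite subrr cmod0.
exact: (cconvex_connected (@cconvex_disc R y r)).
Qed.

Lemma fatou_set_open : open (fatou_set f).
Proof.
rewrite openE => z [N [oN Nz dN nN]].
by apply: filterS (open_nbhs_nbhs (conj oN Nz)) => w Nw; exists N.
Qed.

Lemma fatou_component_open V : fatou_component f V -> open V.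
Proof. by move=> [z _ ->]; apply: connected_component_open; exact: fatou_set_open. Qed.

Lemma fatou_component_connected V : fatou_component f V -> connected V.
Proof. by move=> [z _ ->]; exact: component_connected. Qed.

Lemma fatou_component_sub V : fatou_component f V -> V `<=` fatou_set f.
Proof. by move=> [z _ ->]; exact: connected_component_sub. Qed.

Lemma fatou_component_nonempty V : fatou_component f V -> exists z, V z.
Proof. by move=> [z zF ->]; exists z; exact: connected_component_refl. Qed.

Lemma fatou_component_max V B z : fatou_component f V -> connected B ->
  B `<=` fatou_set f -> V z -> B z -> B `<=` V.
Proof.
move=> [v vF ->] cB BF Vz Bz; rewrite (same_connected_component Vz).
exact: connected_component_max.
Qed.

Lemma fatou_component_eq V X z : fatou_component f V -> fatou_component f X ->
  V z -> X z -> V = X.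
Proof.
move=> fV fX Vz Xz; apply/seteqP; split.
  exact: (fatou_component_max fX (fatou_component_connected fV) (fatou_component_sub fV)) Xz Vz.
exact: (fatou_component_max fV (fatou_component_connected fX) (fatou_component_sub fX)) Vz Xz.
Qed.

Lemma fatou_iterate n z : fatou_set f z -> iterate f n z = Some (finpart (iterate f n) z).
Proof.
(* That the iterate of index [n.+1] is defined means that those of index at most [n] are finite. *)
move=> [N [_ Nz dN _]]; have := dN n.+1 z Nz n (ltnSn n).
by rewrite /finpart; case: (iterate f n z).
Qed.

Lemma finpart_iterateS n z : fatou_set f z ->
  finpart (iterate f n.+1) z = finpart f (finpart (iterate f n) z).
Proof.
by move=> /(fatou_iterate n) E; rewrite {1}/finpart /iterate iterS -/(iterate f n z) E.
Qed.

Lemma iterateSr n z y : f z = Some y -> iterate f n.+1 z = iterate f n y.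
Proof. by move=> fz; rewrite /iterate iterSr /= fz. Qed.

Hypothesis merf : meromorphic f.

Lemma meromorphic_holo z : f z <> None -> holo (finpart f) z.
Proof. by move=> fz; case: (merf z) => [/nbhs_singleton[_ /holoE]|[]]. Qed.

Lemma fatou_finite z : fatou_set f z -> f z = Some (finpart f z).
Proof. by move=> /(fatou_iterate 1); rewrite /finpart. Qed.

Lemma fatou_holo z : fatou_set f z -> holo (finpart f) z.
Proof. by move=> /fatou_finite fz; apply: meromorphic_holo; rewrite fz. Qed.

Lemma iterate_holo n z : fatou_set f z -> holo (finpart (iterate f n)) z.
Proof.
move=> zF; elim: n => [|n IH].
  exact: (holo_id z).
have fin : f (finpart (iterate f n) z) <> None.
  by have := fatou_iterate n.+1 zF; rewrite /iterate iterS -/(iterate f n z) fatou_iterate//= => ->.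
apply: near_eq_holo (holo_comp IH (meromorphic_holo fin)).
apply: filterS (open_nbhs_nbhs (conj fatou_set_open zF)) => w wF.
by rewrite finpart_iterateS.
Qed.

(* Near [f w] the iterates are those at points of a compact disc around [w],
   shifted by one. *)
Lemma fatou_forward w : fatou_set f w -> ~ locally_constant (finpart f) w ->
  fatou_set f (finpart f w).
Proof.
move=> wF nc; have [r0 r00 rF] := proj1 (cmod_openP _) fatou_set_open _ wF.
have [N [oN Nw dN nN]] := wF.
have [r1 r10 rN] := proj1 (cmod_openP _) oN _ Nw.
pose r := Num.min r0 r1 / 2.
have m0 : 0 < Num.min r0 r1 by rewrite lt_min r00.
have rr0 : 0 < r by rewrite divr_gt0.
have rlt u : cmod (u - w) <= r -> cmod (u - w) < r0 /\ cmod (u - w) < r1.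
  move=> ur; apply/andP; rewrite -lt_min; apply: le_lt_trans ur _.
  by rewrite /r ltr_pdivrMr// ltr_pMr// ltr1n.
have hn : holo_near (finpart f) w by exists r0 => // u /rF/fatou_holo.
have [d d0 dP] := open_mapping hn nc rr0.
have ex c : exists u, cmod (c - finpart f w) < d -> cmod (u - w) <= r /\ f u = Some c.
  have [cd|ncd] := pselect (cmod (c - finpart f w) < d); last by exists 0 => /ncd.
  have [u uw uc] := dP _ cd; exists u => _; split; first exact: ltW.
  by rewrite fatou_finite ?uc//; apply: rF; apply: (proj1 (rlt _ (ltW uw))).
have [pre preP] := choice ex.
exists [set c | cmod (c - finpart f w) < d]; split.
- exact: cdisc_open.
- by rewrite /= subrr cmod0.
- move=> n c cd m mn; have [ur fu] := preP _ cd; rewrite -(iterateSr m fu).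
  apply: (dN n.+1 (pre c)); first by apply: rN; apply: (proj2 (rlt _ ur)).
  by rewrite ltnS.
- move=> g gI.
  have [m mP] := choice (fun k => let: ex_intro2 m _ E := gI k in ex_intro (fun m => iterate f m = g k) m E).
  have [|s [h [smono sP]]] := nN (fun k => iterate f (m k).+1).
    by move=> k; exists (m k).+1.
  (* Uniform convergence on the closed disc around [w] is transported by [pre], which is just a
     choice of preimages in that disc. *)
  exists s, (fun c => h (pre c)); split=> // K _ KN e e0.
  have := sP _ (@closed_disc_compact R w r) _ e e0.
  have KK : [set u | cmod (u - w) <= r] `<=` N by move=> u /rlt[_ /rN].
  move=> /(_ KK); apply: filterS => k kP c Kc.
  have [ur fu] := preP _ (KN _ Kc).
  by rewrite -mP -(iterateSr _ fu); exact: kP.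
Qed.

(** [fatou_forward] excludes points of local constancy; if there is one in [X], then [finpart f] is
    constant on [X] and its single value lies in [Y]. Otherwise the image is a connected subset of
    the Fatou set meeting [Y]. *)
Lemma fatou_component_image X Y x : fatou_component f X -> fatou_component f Y ->
  X x -> Y (finpart f x) -> forall z, X z -> Y (finpart f z).
Proof.
move=> fX fY Xx Yx z Xz.
have XF := fatou_component_sub fX.
have cX := fatou_component_connected fX.
have hX y : X y -> holo (finpart f) y by move=> /XF/fatou_holo.
have [[a [Xa lc]]|nlc] := pselect (exists a, X a /\ locally_constant (finpart f) a).
  have all := identity_theorem (fatou_component_open fX) cX hX Xa lc.
  by rewrite (all _ Xz) -(all _ Xx).
suff: finpart f @` X `<=` Y by apply; exists z.
have Fx : (finpart f @` X) (finpart f x) by exists x.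
apply: (fatou_component_max fY _ _ Yx Fx).
- apply: (connected_continuous_connected cX); apply: continuous_in_subspaceT => y.
  by rewrite inE => /hX/holo_cont/ccontE.
- move=> _ [y Xy <-]; apply: fatou_forward; first exact: XF.
  by move=> lc; apply: nlc; exists y.
Qed.

Lemma component_of_imageP U n z : component_of_image f U n z ->
  fatou_component f (component_of_image f U n) /\
  iterate f n @` U `<=` Some @` component_of_image f U n.
Proof.
rewrite /component_of_image; set P := (X in xget _ X) => Vz.
have [exP|nP] := pselect (exists V, P V); first exact: (xgetPex set0 exP).
move: Vz; rewrite xgetPN// => V PV; apply: nP; by exists V.
Qed.

Section Wandering.
Variable U : set (CC R).
Hypothesis wU : wandering_domain f U.

Let fU : fatou_component f U. Proof. by case: wU. Qed.

(* At most one of the [U_n] equals [U] and at most one is the default [set0], so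
   one of three is a Fatou component disjoint from [U]. *)
Lemma wandering_omits_disc : exists (c : CC R) (rho : R),
  0 < rho /\ forall y, U y -> rho <= cmod (y - c).
Proof.
have [n [n0 nU]] : exists n, component_of_image f U n <> set0 /\ component_of_image f U n <> U.
  apply: contrapT => no; have [_ dist] := wU.
  have alt n : component_of_image f U n = set0 \/ component_of_image f U n = U.
    by apply/or_asboolP/negPn/negP => /norP[/asboolPn h1 /asboolPn h2]; apply: no; exists n.
  have h01 := dist 0%N 1%N ltac:(by []); have h02 := dist 0%N 2%N ltac:(by []).
  have h12 := dist 1%N 2%N ltac:(by []).
  by case: (alt 0%N) (alt 1%N) (alt 2%N) => E0 [] E1 [] E2; congruence.
have [c Vc] : exists c, component_of_image f U n c by apply/set0P/eqP.
have [fV _] := component_of_imageP Vc.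
have [r r0 rV] := proj1 (cmod_openP _) (fatou_component_open fV) _ Vc.
exists c, r; split=> // y Uy; rewrite leNgt; apply/negP => /rV Vy.
by apply: nU; exact: fatou_component_eq fV fU Vy Uy.
Qed.

Lemma wandering_covering : exists p, disc_covering U p.
Proof.
have [c [rho [rho0 far]]] := wandering_omits_disc.
have [z Uz] := fatou_component_nonempty fU.
apply: (uniformization rho0 far _ _ Uz); first exact: fatou_component_open.
exact: fatou_component_connected.
Qed.

Lemma covered_nonempty X : (exists p, disc_covering X p) -> exists z, X z.
Proof.
by move=> [p [_ <- _]]; exists (p 0), 0 => //; rewrite /unit_disc/= cmod0.
Qed.

Lemma lambda_defect n z w : U z -> U w ->
  0 <= 1 - lambda f U n w /\
  1 - lambda f U n z <= expR (2 * hyp_dist U z w) * (1 - lambda f U n w).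
Proof.
move=> Uz Uw; rewrite /lambda.
set X := component_of_image f U n; set Y := component_of_image f U n.+1.
have [covX|nX] := pselect (exists p, disc_covering X p); last first.
  (* Both defects are 1 here, so the claim is that the exponential factor is at least 1. *)
  rewrite !hyp_distortion_uncovered; try by left.
  rewrite subr0 mulr1; split=> //; rewrite -[leLHS]expR0 ler_expR.
  by rewrite mulr_ge0 ?hyp_dist_ge0.
have [covY|nY] := pselect (exists p, disc_covering Y p); last first.
  rewrite !hyp_distortion_uncovered; try by right.
  rewrite subr0 mulr1; split=> //; rewrite -[leLHS]expR0 ler_expR.
  by rewrite mulr_ge0 ?hyp_dist_ge0.
(* An image of the disc is not empty, so [X] and [Y] are not the default [set0] but genuine Fatou
   components. *)
have [x Xx] := covered_nonempty covX; have [y Yy] := covered_nonempty covY.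
have [fX UX] := component_of_imageP Xx; have [fY UY] := component_of_imageP Yy.
have UF := fatou_component_sub fU.
have mem m V u : iterate f m @` U `<=` Some @` V -> U u -> V (finpart (iterate f m) u).
  move=> mV Uu; have [|v Vv] := mV (iterate f m u); first by exists u.
  by rewrite (fatou_iterate _ (UF _ Uu)) => -[<-].
apply: distortion_defect => //; first exact: wandering_covering.
- by move=> u Uu; split; [apply: iterate_holo; exact: UF|exact: mem].
- move=> u Xu; split; first by apply: fatou_holo; exact: (fatou_component_sub fX).
  apply: (fatou_component_image fX fY (mem _ _ _ UX Uz)) => //.
  by rewrite -finpart_iterateS; [exact: mem|exact: UF].
Qed.

End Wandering.
End Fatou.

(** * Symmetry of the distance and comparison of series *)

Lemma hyp_distC (R : realType) (X : set (CC R)) (z w : CC R) : hyp_dist X z w = hyp_dist X w z.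
Proof.
rewrite /hyp_dist; congr inf; apply/seteqP; split=> _ [p [a [b [cp [aD bD pa pb ->]]]]];
  by exists p, b, a; split=> //; split=> //; rewrite !disc_distE pdistC.
Qed.

Lemma series_scale_cvg (R : realType) (C : R) (u v : R ^nat) : (forall n, 0 <= u n) ->
  (forall n, u n <= C * v n) -> cvgn (series v) -> cvgn (series u).
Proof.
move=> u0 uv cv; apply: (series_le_cvg u0 _ uv); last exact: is_cvg_seriesZ.
by move=> n; apply: le_trans (uv n).
Qed.

Lemma scale_support_sub (R : realType) (C : R) (u v : R ^nat) : (forall n, 0 <= u n) ->
  (forall n, u n <= C * v n) -> [set n | u n <> 0] `<=` [set n | v n <> 0].
Proof.
move=> u0 uv n /= un vn; apply: un; apply: le_anti.
by rewrite u0 andbT; have := uv n; rewrite vn mulr0.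
Qed.

Theorem proposition1p1 (R : realType) (f : CC R -> Chat R) (U : set (CC R))
    (hf : meromorphic f) (hU : wandering_domain f U) :
  (forall z w : CC R, U z -> U w -> forall n : nat,
     expR (- (2 * hyp_dist U z w)) * (1 - lambda f U n w) <= 1 - lambda f U n z
     /\ 1 - lambda f U n z <= expR (2 * hyp_dist U z w) * (1 - lambda f U n w))
  /\
  (forall z w : CC R, U z -> U w ->
     [/\ cvgn (series (fun n => 1 - lambda f U n z)) <->
           cvgn (series (fun n => 1 - lambda f U n w)),
         ~ cvgn (series (fun n => 1 - lambda f U n z)) <->
           ~ cvgn (series (fun n => 1 - lambda f U n w)) &
         finite_set [set n | 1 - lambda f U n z <> 0] <->
           finite_set [set n | 1 - lambda f U n w <> 0]]).
Proof.
have defect z w n : U z -> U w -> 0 <= 1 - lambda f U n w /\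
    1 - lambda f U n z <= expR (2 * hyp_dist U z w) * (1 - lambda f U n w).
  exact: lambda_defect.
split=> [z w Uz Uw n|z w Uz Uw].
  have [_ ->] := defect z w n Uz Uw; split=> //.
  (* The lower bound is the upper one with [z] and [w] exchanged. *)
  rewrite expRN ler_pdivrMl ?expR_gt0// hyp_distC.
  by have [] := defect w z n Uw Uz.
have cvg x y : U x -> U y -> cvgn (series (fun n => 1 - lambda f U n x)) ->
    cvgn (series (fun n => 1 - lambda f U n y)).
  move=> Ux Uy; apply: (@series_scale_cvg _ (expR (2 * hyp_dist U y x))) => n.
    by have [] := defect y y n Uy Uy.
  by have [] := defect y x n Uy Ux.
have cvgE : cvgn (series (fun n => 1 - lambda f U n z)) <->
    cvgn (series (fun n => 1 - lambda f U n w)) by split; exact: cvg.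
have sub x y : U x -> U y ->
    [set n | 1 - lambda f U n x <> 0] `<=` [set n | 1 - lambda f U n y <> 0].
  move=> Ux Uy; apply: (@scale_support_sub _ (expR (2 * hyp_dist U x y))) => n.
    by have [] := defect x x n Ux Ux.
  by have [] := defect x y n Ux Uy.
split; first exact: cvgE.
  exact: (not_iff_compat cvgE).
by split; apply: sub_finite_set; exact: sub.
Qed.
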